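(* Given $\kappa>4$, set $\theta=2\bigl(1+\kappa/\sqrt{\kappa^2-16}\bigr)^{-1}\in(0,1)$, $$k(z)=e^{i\pi\theta}\,\frac{\bigl(z-2/\sqrt{1-\theta}\bigr)^{1-\theta}}{z-2\sqrt{1-\theta}},\qquad g_t(z)=(1-t)^{1/2}\,k^{-1}\bigl((1-t)^{\theta/2}k(z)\bigr),\quad 0\le t<1 .$$ Then $k$ is a conformal map of $\mathbb H$ onto $\mathbb H\setminus S_\theta$, where $S_\theta$ is a line segment in $\mathbb H$ beginning at $0$ and forming an angle $\pi\theta$ with $[0,\infty)$, and $g_t$ satisfies the Loewner equation $$\dot g_t=\frac{2}{g_t-\kappa\sqrt{1-t}},\qquad g_0(z)\equiv z .$$ The trace $\gamma=k^{-1}\bigl(\{re^{i\pi\theta}:r>0\}\setminus S_\theta\bigr)$ is a curve in $\mathbb H$ which meets $\mathbb R$ at angle $\pi/2$ at $\gamma(0)=\kappa$ and at angle $\pi(1-\theta)$ (formed with the half-line $[\gamma(1),+\infty)$) at $\gamma(1)=2\sqrt{1-\theta}$. The case $\kappa<-4$ is obtained from the case $\kappa>4$ by reflecting about the imaginary axis.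
   Context: $\mathbb H$ is the upper half-plane. The power $(z-a)^{1-\theta}$, $a\in\mathbb R$, is defined on $\mathbb H$ using $\arg(z-a)\in(0,\pi)$. The map $g_t$ is defined on $\mathbb H\setminus\gamma((0,t])$, where $\gamma$ is parametrized by half-plane capacity (the hydrodynamically normalized map $g_t$ of $\mathbb H\setminus\gamma((0,t])$ onto $\mathbb H$ satisfies $g_t(z)=z+2t/z+O(1/z^2)$ at $\infty$), and the dot denotes $\partial/\partial t$. The trace $\gamma$ is the curve generating the hulls of the Loewner equation with driving term $\lambda(t)=\kappa\sqrt{1-t}$. Reflection about the imaginary axis is $z\mapsto-\overline z$; it conjugates solutions with driving term $\lambda$ to those with driving term $-\lambda$. *)

(* Defs.v *)
From Stdlib Require Import Reals ClassicalEpsilon.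
From Coquelicot Require Import Coquelicot.
Open Scope R_scope.

Definition upper (z : C) : Prop := 0 < Im z.

Definition setminus (U K : C -> Prop) (z : C) : Prop := U z /\ ~ K z.

(* On [upper] this is the argument in (0, PI). *)
Definition arg (z : C) : R := acos (Re z / Cmod z).

Definition expi (phi : R) : C := (cos phi, sin phi).

(* The power z ^ s on [upper], with arg z in (0, PI). *)
Definition cpower (z : C) (s : R) : C :=
  (RtoC (Rpower (Cmod z) s) * expi (s * arg z))%C.

Definition holomorphic_on (U : C -> Prop) (f : C -> C) : Prop :=
  forall z, U z -> ex_derive (K := C_AbsRing) (V := C_NormedModule) f z.

Definition conformal_onto (U V : C -> Prop) (f : C -> C) : Prop :=
  holomorphic_on U f /\
  (forall z w, U z -> U w -> f z = f w -> z = w) /\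
  (forall w, V w <-> exists z, U z /\ f z = w).

(* Derivative relative to D; it is one-sided at an endpoint of an interval D. *)
Definition derive_on (D : R -> Prop) (f : R -> C) (t : R) (l : C) : Prop :=
  filterlim (fun s => ((f s - f t) / RtoC (s - t))%C)
    (within (fun s => D s /\ s <> t) (locally t)) (locally l).

(* The Loewner equation is u' = 2 / (u - lam).  The hull at time t consists of
   the starting points whose solution does not survive on all of [0, t]. *)
Definition loewner_hull (lam : R -> R) (t : R) (z : C) : Prop :=
  upper z /\
  ~ exists u : R -> C, u 0 = z /\
      forall s, 0 <= s <= t ->
        u s <> RtoC (lam s) /\
        derive_on (fun r => 0 <= r <= t) u s (2 / (u s - RtoC (lam s)))%C.

(* gamma((0, t]) *)
Definition arc (gamma : R -> C) (t : R) (z : C) : Prop :=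
  exists s, 0 < s <= t /\ gamma s = z.

(* The hulls are the arcs gamma((0, t]) themselves, since the curve stays in
   [upper] before time T and gamma((0, t]) does not disconnect [upper]. *)
Definition loewner_trace (lam : R -> R) (T : R) (gamma : R -> C) : Prop :=
  continuous_on (fun t => 0 <= t <= T) gamma /\
  (forall t, 0 < t < T -> upper (gamma t)) /\
  (forall t, 0 <= t < T ->
     forall z, loewner_hull lam t z <-> arc gamma t z).

(* g t is the hydrodynamically normalized map of H \ gamma((0, t]) onto H, and
   gamma is parametrized by half-plane capacity. *)
Definition mapping_out (T : R) (gamma : R -> C) (g : R -> C -> C) : Prop :=
  forall t, 0 <= t < T ->
    conformal_onto (setminus upper (arc gamma t)) upper (g t) /\
    exists M R0 : R, 0 < R0 /\
      forall z, upper z -> R0 < Cmod z ->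
        Cmod (g t z - (z + RtoC (2 * t) / z))%C <= M / (Cmod z) ^ 2.

Definition loewner_flow (lam : R -> R) (T : R) (gamma : R -> C)
    (g : R -> C -> C) : Prop :=
  (forall z, upper z -> g 0 z = z) /\
  forall t z, 0 <= t < T -> setminus upper (arc gamma t) z ->
    g t z <> RtoC (lam t) /\
    derive_on (fun s => 0 <= s < T) (fun s => g s z) t
      (2 / (g t z - RtoC (lam t)))%C.

(* Near the time filter F the curve gamma, lying in [upper], approaches or
   leaves the real point p along a direction forming the angle alpha with the
   half-line [p, +oo). *)
Definition angle_right (gamma : R -> C) (F : (R -> Prop) -> Prop)
    (p alpha : R) : Prop :=
  filterlim (fun t => arg (gamma t - RtoC p)%C) F (locally alpha).

Definition theta (kappa : R) : R :=
  2 * / (1 + kappa / sqrt (kappa ^ 2 - 16)).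

Definition kmap (kappa : R) (z : C) : C :=
  let th := theta kappa in
  (expi (PI * th) *
   (cpower (z - RtoC (2 / sqrt (1 - th))) (1 - th)
    / (z - RtoC (2 * sqrt (1 - th)))))%C.

(* Inverse of k on k(H); the value outside k(H) is arbitrary. *)
Definition kinv (kappa : R) (w : C) : C :=
  epsilon (inhabits (RtoC 0)) (fun z => upper z /\ kmap kappa z = w).

Definition gmap (kappa t : R) (z : C) : C :=
  (RtoC (sqrt (1 - t)) *
   kinv kappa (RtoC (Rpower (1 - t) (theta kappa / 2)) * kmap kappa z))%C.

Definition ray (phi : R) (w : C) : Prop :=
  exists r, 0 < r /\ w = (RtoC r * expi phi)%C.

(* The part in H of the segment of length L issued from 0 in direction phi. *)
Definition slit (phi L : R) (w : C) : Prop :=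
  exists r, 0 < r <= L /\ w = (RtoC r * expi phi)%C.

(* Reflection about the imaginary axis, acting on points, sets and maps. *)
Definition reflect (z : C) : C := (- Cconj z)%C.
Definition reflect_set (K : C -> Prop) (z : C) : Prop := K (reflect z).
Definition reflect_map (f : C -> C) (z : C) : C := reflect (f (reflect z)).

(* Main.v *)
Require Import Defs.
From Stdlib Require Import Reals Ranalysis5 Lra Lia ClassicalEpsilon.
From Coquelicot Require Import Coquelicot.
Open Scope R_scope.

(** Write [be = 1 - theta], [a = 2 / sqrt be], [b = 2 sqrt be].  Then [b = be a],
    [a b = 4] and [a + b = kappa], and on the upper half-plane
    [k z = exp (logk z + i pi theta)] with
    [logk z = be log (z - a) - log (z - b)].

    The map [k].  A point [z] of the upper half-plane is determined by
    [ph = arg (z - a)] and [ps = arg (z - b)], which range over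
    [0 < ps < ph < pi].  The law of sines in the triangle [a], [b], [z] gives both
    moduli, so [Im (logk z) = be ph - ps] and [Re (logk z)] are explicit.  Along a
    line [be ph - ps = de] the real part is, up to a constant, the function
    [logmod be de] of [ph]; its derivative times a product of sines is a square
    plus a positive term ([dlogmod_pos]), so it is strictly increasing.  It
    exhausts the whole real line when [de <> 0], and exactly a half-line when
    [de = 0], because then the triangle degenerates at [kappa] as [ph] tends to 0.
    Hence [logk] is a bijection onto a strip slit along a horizontal half-line
    ([logk_inj], [logk_strip], [logk_onto]), and the exponential turns this into
    the statement on [k].  The same monotonicity, with the intermediate value
    theorem applied for nearby values of [de], shows that [logk] is open
    ([logk_open]); as its derivative does not vanish, its inverse is
    differentiable.

    The flow.  In these terms [g_t = sqrt (1 - t) w] where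
    [logk w = logk z + (theta / 2) log (1 - t)].  Differentiating this relation in
    [t] yields the Loewner equation ([gmap_flow]), and the relation has a solution
    [w] exactly as long as the right-hand side stays off the slit, that is, as
    long as [z] is not on the curve traced by the tip ([arc_domain]).

    The hulls.  Conversely, along any solution [u] of the Loewner equation the
    quantity [be log (u - a sigma) - log (u - b sigma)], [sigma = sqrt (1 - t)], is
    constant ([solution_first_integral]).  If [u] starts at [gamma s] and lives up
    to time [s], then [u s / sigma] is a point of the upper half-plane mapped by
    [logk] to the tip of the slit, which is impossible ([trace_generates_hulls]).

    The normalization at infinity is read off the equation itself: a solution
    starting at a large [z] stays within distance 1 of [z], so its velocity is
    [2 / z + O(1 / z^2)] ([solution_expansion]).

    The angles.  On the trace [arg (gamma - b) = be arg (gamma - a)].  At time 1 the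
    right-hand side tends to [be pi], which is the angle at [b].  At time 0 both
    arguments tend to 0 and the real part of [gamma - kappa] is smaller than the
    imaginary part by a factor that tends to 0 ([angle_defect]), so the curve
    leaves [kappa] vertically.

    For [kappa < -4], every notion involved is carried over by the reflection. *)

(** * Derivatives along a filter *)

Definition tends {T : Type} (F : (T -> Prop) -> Prop) (y : T -> C) (y0 : C) : Prop :=
  forall eps, 0 < eps -> F (fun s => Cmod (y s - y0)%C < eps).

(** Differentiability of [y] with respect to [x] along the filter [F].  With the
    identity for [x] this is the complex derivative, and with [x = RtoC] and a filter
    of times it is a possibly one-sided time derivative, so that one set of rules
    serves the conformal maps and the flow. *)
Definition slope {T : Type} (F : (T -> Prop) -> Prop) (x y : T -> C)
    (x0 y0 l : C) : Prop :=
  forall eps, 0 < eps ->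
    F (fun s => Cmod (y s - y0 - l * (x s - x0))%C <= eps * Cmod (x s - x0)%C).

Definition cderiv (f : C -> C) (z l : C) : Prop :=
  slope (locally z) (fun w => w) f z (f z) l.

Lemma Cmod_minus_sym (x y : C) : Cmod (x - y)%C = Cmod (y - x)%C.
Proof. rewrite <- Cmod_opp. f_equal. ring. Qed.

Lemma Cmod_triangle_minus (x y : C) : Cmod (x - y)%C <= Cmod x + Cmod y.
Proof.
  unfold Cminus. eapply Rle_trans; [apply Cmod_triangle|]. rewrite Cmod_opp. lra.
Qed.

Lemma Cmod_triangle_rev (x y : C) : Cmod x - Cmod y <= Cmod (x - y)%C.
Proof.
  assert (H := Cmod_triangle (x - y) y). replace (x - y + y)%C with x in H by ring. lra.
Qed.

(** Neighbourhoods of a complex number are given by squares; discs are equivalent. *)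
Lemma locally_Cmod (z : C) (P : C -> Prop) :
  locally z P <-> exists d, 0 < d /\ forall w, Cmod (w - z)%C < d -> P w.
Proof.
  split.
  - intros [d Hd]. exists d. split; [apply cond_pos|].
    intros w Hw. apply Hd. apply C_NormedModule_mixin_compat1. exact Hw.
  - intros [d [Hd H]].
    assert (Hs : 0 < sqrt 2) by (apply sqrt_lt_R0; lra).
    exists (mkposreal (d / sqrt 2) (Rdiv_lt_0_compat _ _ Hd Hs)).
    intros w Hw. apply H.
    apply C_NormedModule_mixin_compat2 in Hw. simpl in Hw.
    replace (sqrt 2 * (d / sqrt 2)) with d in Hw by (field; lra). exact Hw.
Qed.

Lemma filterlim_tends {T : Type} (F : (T -> Prop) -> Prop) {FF : Filter F}
    (y : T -> C) (y0 : C) : filterlim y F (locally y0) <-> tends F y y0.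
Proof.
  split.
  - intros H eps Heps. apply (H (fun w => Cmod (w - y0)%C < eps)).
    apply locally_Cmod. exists eps. auto.
  - intros H P HP. apply locally_Cmod in HP. destruct HP as [d [Hd HP]].
    unfold filtermap. generalize (H d Hd). apply filter_imp. intros s Hs. auto.
Qed.

Lemma tends_id (z : C) : tends (locally z) (fun w => w) z.
Proof. intros eps Heps. apply locally_Cmod. exists eps. auto. Qed.

Lemma Cmod_minus_self (z : C) : Cmod (z - z)%C = 0.
Proof. replace (z - z)%C with (RtoC 0) by ring. apply Cmod_0. Qed.

Section Slope_rules.

Context {T : Type} (F : (T -> Prop) -> Prop) {FF : Filter F}.

Lemma tends_ext (y y' : T -> C) (y0 : C) :
  F (fun s => y s = y' s) -> tends F y y0 -> tends F y' y0.
Proof.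
  intros He H eps Heps. generalize (filter_and (F := F) _ _ He (H eps Heps)).
  apply filter_imp. intros s [E Hs]. now rewrite <- E.
Qed.

Lemma slope_ext (x y y' : T -> C) (x0 y0 l : C) :
  F (fun s => y s = y' s) -> slope F x y x0 y0 l -> slope F x y' x0 y0 l.
Proof.
  intros He H eps Heps. generalize (filter_and (F := F) _ _ He (H eps Heps)).
  apply filter_imp. intros s [E Hs]. now rewrite <- E.
Qed.

Lemma slope_const (x : T -> C) (x0 c : C) : slope F x (fun _ => c) x0 c 0.
Proof.
  intros eps Heps. apply filter_forall. intros s.
  replace (c - c - 0 * (x s - x0))%C with (RtoC 0) by ring. rewrite Cmod_0.
  apply Rmult_le_pos; [lra | apply Cmod_ge_0].
Qed.

Lemma slope_id (x : T -> C) (x0 : C) : slope F x x x0 x0 1.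
Proof.
  intros eps Heps. apply filter_forall. intros s.
  replace (x s - x0 - 1 * (x s - x0))%C with (RtoC 0) by ring. rewrite Cmod_0.
  apply Rmult_le_pos; [lra | apply Cmod_ge_0].
Qed.

Lemma slope_lipschitz (x y : T -> C) (x0 y0 l : C) :
  slope F x y x0 y0 l ->
  F (fun s => Cmod (y s - y0)%C <= (Cmod l + 1) * Cmod (x s - x0)%C).
Proof.
  intros H. generalize (H 1 Rlt_0_1). apply filter_imp. intros s Hs.
  replace (y s - y0)%C with ((y s - y0 - l * (x s - x0)) + l * (x s - x0))%C by ring.
  eapply Rle_trans; [apply Cmod_triangle|]. rewrite (Cmod_mult l). lra.
Qed.

Lemma slope_tends (x y : T -> C) (x0 y0 l : C) :
  tends F x x0 -> slope F x y x0 y0 l -> tends F y y0.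
Proof.
  intros Hx H eps Heps.
  assert (Hl : 0 < Cmod l + 1) by (generalize (Cmod_ge_0 l); lra).
  assert (Hd : 0 < eps / (Cmod l + 1)) by (apply Rdiv_lt_0_compat; lra).
  generalize (filter_and (F := F) _ _ (Hx _ Hd) (slope_lipschitz _ _ _ _ _ H)).
  apply filter_imp. intros s [H1 H2]. eapply Rle_lt_trans; [exact H2|].
  apply (Rmult_lt_compat_l _ _ _ Hl) in H1.
  replace ((Cmod l + 1) * (eps / (Cmod l + 1))) with eps in H1 by (field; lra). exact H1.
Qed.

Lemma slope_plus (x y z : T -> C) (x0 y0 z0 l m : C) :
  slope F x y x0 y0 l -> slope F x z x0 z0 m ->
  slope F x (fun s => y s + z s)%C x0 (y0 + z0)%C (l + m)%C.
Proof.
  intros H1 H2 eps Heps.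
  generalize (filter_and (F := F) _ _ (H1 (eps/2) ltac:(lra)) (H2 (eps/2) ltac:(lra))).
  apply filter_imp. intros s [A B].
  replace (y s + z s - (y0 + z0) - (l + m) * (x s - x0))%C with
    ((y s - y0 - l * (x s - x0)) + (z s - z0 - m * (x s - x0)))%C by ring.
  eapply Rle_trans; [apply Cmod_triangle|]. lra.
Qed.

Lemma slope_mult (x y z : T -> C) (x0 y0 z0 l m : C) :
  tends F x x0 -> slope F x y x0 y0 l -> slope F x z x0 z0 m ->
  slope F x (fun s => y s * z s)%C x0 (y0 * z0)%C (l * z0 + y0 * m)%C.
Proof.
  intros Hx H1 H2 eps Heps.
  assert (Hz := Cmod_ge_0 z0). assert (Hy := Cmod_ge_0 y0). assert (Hl := Cmod_ge_0 l).
  (* The error is (dy - l dx) z0 + y0 (dz - m dx) + dy dz, each summand getting a third. *)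
  assert (E1 : 0 < eps / 3 / (Cmod z0 + 1)) by (repeat apply Rdiv_lt_0_compat; lra).
  assert (E2 : 0 < eps / 3 / (Cmod y0 + 1)) by (repeat apply Rdiv_lt_0_compat; lra).
  assert (E3 : 0 < eps / 3 / (Cmod l + 1)) by (repeat apply Rdiv_lt_0_compat; lra).
  generalize (filter_and (F := F) _ _ (filter_and (F := F) _ _ (H1 _ E1) (H2 _ E2))
    (filter_and (F := F) _ _ (slope_lipschitz _ _ _ _ _ H1) (slope_tends _ _ _ _ _ Hx H2 _ E3))).
  apply filter_imp. intros s [[A B] [D E]].
  replace (y s * z s - y0 * z0 - (l * z0 + y0 * m) * (x s - x0))%C with
    ((y s - y0 - l * (x s - x0)) * z0 + y0 * (z s - z0 - m * (x s - x0))
      + (y s - y0) * (z s - z0))%C by ring.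
  eapply Rle_trans; [apply Cmod_triangle|].
  eapply Rle_trans; [apply Rplus_le_compat_r, Cmod_triangle|].
  rewrite !Cmod_mult.
  set (X := Cmod (x s - x0)%C) in *.
  assert (HX : 0 <= X) by apply Cmod_ge_0.
  assert (P1 : Cmod (y s - y0 - l * (x s - x0))%C * Cmod z0 <= eps / 3 * X).
  { apply Rle_trans with (eps / 3 / (Cmod z0 + 1) * X * (Cmod z0 + 1)).
    - apply Rmult_le_compat; try apply Cmod_ge_0; [exact A | lra].
    - right. field. lra. }
  assert (P2 : Cmod y0 * Cmod (z s - z0 - m * (x s - x0))%C <= eps / 3 * X).
  { apply Rle_trans with ((Cmod y0 + 1) * (eps / 3 / (Cmod y0 + 1) * X)).
    - apply Rmult_le_compat; try apply Cmod_ge_0; [lra | exact B].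
    - right. field. lra. }
  assert (P3 : Cmod (y s - y0)%C * Cmod (z s - z0)%C <= eps / 3 * X).
  { apply Rle_trans with ((Cmod l + 1) * X * (eps / 3 / (Cmod l + 1))).
    - apply Rmult_le_compat; try apply Cmod_ge_0; [exact D | lra].
    - right. field. lra. }
  lra.
Qed.

Lemma slope_scal (x y : T -> C) (x0 y0 l c : C) :
  slope F x y x0 y0 l -> slope F x (fun s => c * y s)%C x0 (c * y0)%C (c * l)%C.
Proof.
  intros H eps Heps. assert (Hc := Cmod_ge_0 c).
  assert (E : 0 < eps / (Cmod c + 1)) by (apply Rdiv_lt_0_compat; lra).
  generalize (H _ E). apply filter_imp. intros s A.
  replace (c * y s - c * y0 - c * l * (x s - x0))%C with
    (c * (y s - y0 - l * (x s - x0)))%C by ring.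
  rewrite Cmod_mult.
  apply Rle_trans with ((Cmod c + 1) * (eps / (Cmod c + 1) * Cmod (x s - x0)%C)).
  - apply Rmult_le_compat; try apply Cmod_ge_0; [lra | exact A].
  - right. field. lra.
Qed.

Lemma slope_comp (f : C -> C) (x y : T -> C) (x0 y0 l m : C) :
  tends F x x0 -> slope F x y x0 y0 l -> cderiv f y0 m ->
  slope F x (fun s => f (y s)) x0 (f y0) (m * l)%C.
Proof.
  intros Hx H Hf eps Heps.
  assert (Hl := Cmod_ge_0 l). assert (Hm := Cmod_ge_0 m).
  assert (E1 : 0 < eps / 2 / (Cmod l + 1)) by (repeat apply Rdiv_lt_0_compat; lra).
  assert (E2 : 0 < eps / 2 / (Cmod m + 1)) by (repeat apply Rdiv_lt_0_compat; lra).
  destruct (proj1 (locally_Cmod _ _) (Hf _ E1)) as [d [Hd Hf']].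
  generalize (filter_and (F := F) _ _ (filter_and (F := F) _ _ (H _ E2) (slope_lipschitz _ _ _ _ _ H))
    (slope_tends _ _ _ _ _ Hx H d Hd)).
  apply filter_imp. intros s [[A B] D]. specialize (Hf' _ D). cbv beta in Hf'.
  replace (f (y s) - f y0 - m * l * (x s - x0))%C with
    ((f (y s) - f y0 - m * (y s - y0)) + m * (y s - y0 - l * (x s - x0)))%C by ring.
  eapply Rle_trans; [apply Cmod_triangle|]. rewrite (Cmod_mult m).
  set (X := Cmod (x s - x0)%C) in *.
  assert (P1 : Cmod (f (y s) - f y0 - m * (y s - y0))%C <= eps / 2 * X).
  { eapply Rle_trans; [exact Hf'|].
    apply Rle_trans with (eps / 2 / (Cmod l + 1) * ((Cmod l + 1) * X)).
    - apply Rmult_le_compat_l; [lra | exact B].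
    - right. field. lra. }
  assert (P2 : Cmod m * Cmod (y s - y0 - l * (x s - x0))%C <= eps / 2 * X).
  { apply Rle_trans with ((Cmod m + 1) * (eps / 2 / (Cmod m + 1) * X)).
    - apply Rmult_le_compat; try apply Cmod_ge_0; [lra | exact A].
    - right. field. lra. }
  lra.
Qed.

(** Solving for [y] in [f (y s)]: differentiability of an inverse function and
    implicit differentiation are both instances of this rule.  Since
    [m <> 0], the error [o(y - y0)] in the expansion of [f] is absorbed by
    [m (y - y0)], so that [y - y0 = O(x - x0)] first. *)
Lemma slope_inverse (f : C -> C) (x y : T -> C) (x0 y0 l m : C) :
  m <> 0%C -> tends F y y0 -> cderiv f y0 m ->
  slope F x (fun s => f (y s)) x0 (f y0) l ->
  slope F x y x0 y0 (l / m)%C.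
Proof.
  intros Hm Hy Hf H eps Heps.
  assert (Hl := Cmod_ge_0 l).
  assert (Hm' : 0 < Cmod m) by now apply Cmod_gt_0.
  set (K := 2 * (Cmod l + 1) / Cmod m).
  assert (HK : 0 < K) by (unfold K; apply Rdiv_lt_0_compat; lra).
  set (e1 := Rmin (Cmod m / 2) (eps * Cmod m / (2 * K))).
  assert (He1 : 0 < e1).
  { unfold e1. apply Rmin_pos; [lra|]. apply Rdiv_lt_0_compat; [|lra].
    now apply Rmult_lt_0_compat. }
  assert (He2 : 0 < eps * Cmod m / 2).
  { apply Rdiv_lt_0_compat; [|lra]. now apply Rmult_lt_0_compat. }
  destruct (proj1 (locally_Cmod _ _) (Hf _ He1)) as [d [Hd Hf']].
  generalize (filter_and (F := F) _ _ (filter_and (F := F) _ _ (H _ He2) (slope_lipschitz _ _ _ _ _ H))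
    (Hy d Hd)).
  apply filter_imp. intros s [[A B] D]. specialize (Hf' _ D). cbv beta in Hf'.
  set (X := Cmod (x s - x0)%C) in *. set (Y := Cmod (y s - y0)%C) in *.
  assert (HX : 0 <= X) by apply Cmod_ge_0.
  assert (HY : 0 <= Y) by apply Cmod_ge_0.
  assert (M1 : e1 <= Cmod m / 2) by apply Rmin_l.
  assert (M2 : e1 <= eps * Cmod m / (2 * K)) by apply Rmin_r.
  assert (BY : Y <= K * X).
  { assert (Q : Cmod m * Y <= Cmod m / 2 * Y + (Cmod l + 1) * X).
    { unfold Y at 1. rewrite <- Cmod_mult.
      replace (m * (y s - y0))%C with
        ((f (y s) - f y0) - (f (y s) - f y0 - m * (y s - y0)))%C by ring.
      eapply Rle_trans; [apply Cmod_triangle_minus|].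
      assert (e1 * Y <= Cmod m / 2 * Y) by (apply Rmult_le_compat_r; lra).
      lra. }
    apply Rmult_le_reg_l with (Cmod m / 2); [lra|].
    replace (Cmod m / 2 * (K * X)) with ((Cmod l + 1) * X); [lra|].
    unfold K. field. lra. }
  apply Rmult_le_reg_l with (Cmod m); [lra|]. rewrite <- Cmod_mult.
  replace (m * (y s - y0 - l / m * (x s - x0)))%C with
    ((f (y s) - f y0 - l * (x s - x0)) - (f (y s) - f y0 - m * (y s - y0)))%C
    by (field; exact Hm).
  eapply Rle_trans; [apply Cmod_triangle_minus|].
  assert (e1 * Y <= eps * Cmod m / 2 * X).
  { apply Rle_trans with (eps * Cmod m / (2 * K) * (K * X)).
    - apply Rmult_le_compat; lra.
    - right. field. lra. }
  lra.
Qed.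

Lemma slope_Re (r : T -> R) (y : T -> C) (r0 : R) (y0 l : C) :
  slope F (fun s => RtoC (r s)) y (RtoC r0) y0 l ->
  slope F (fun s => RtoC (r s)) (fun s => RtoC (Re (y s))) (RtoC r0)
    (RtoC (Re y0)) (RtoC (Re l)).
Proof.
  intros H eps Heps. generalize (H eps Heps). apply filter_imp. intros s Hs.
  eapply Rle_trans; [|exact Hs].
  replace (RtoC (Re (y s)) - RtoC (Re y0) - RtoC (Re l) * (RtoC (r s) - RtoC r0))%C
    with (RtoC (Re (y s - y0 - l * (RtoC (r s) - RtoC r0))%C)).
  - rewrite Cmod_R. apply re_le_Cmod.
  - apply injective_projections; unfold RtoC, Re; simpl; ring.
Qed.

End Slope_rules.

Lemma slope_filter_le {T : Type} (F G : (T -> Prop) -> Prop) (x y : T -> C)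
    (x0 y0 l : C) :
  filter_le F G -> slope G x y x0 y0 l -> slope F x y x0 y0 l.
Proof. intros HFG H eps Heps. apply HFG, H, Heps. Qed.

Lemma cderiv_ext (f g : C -> C) (z l : C) :
  locally z (fun w => f w = g w) -> cderiv f z l -> cderiv g z l.
Proof.
  intros He H. unfold cderiv. rewrite <- (locally_singleton _ _ He).
  eapply slope_ext; [|exact He|exact H]. apply locally_filter.
Qed.

Lemma cderiv_ex_derive (f : C -> C) (z l : C) :
  cderiv f z l -> ex_derive (K := C_AbsRing) (V := C_NormedModule) f z.
Proof.
  intros H. exists l. split; [apply is_linear_scal_l|].
  intros w Hw.
  assert (E := is_filter_lim_locally_unique (V := AbsRing_NormedModule C_AbsRing) _ _ Hw).
  rewrite <- E. clear w Hw E.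
  intros eps.
  destruct (proj1 (locally_Cmod _ _) (H eps (cond_pos eps))) as [d [Hd Hf]].
  exists (mkposreal d Hd). intros w Hw.
  specialize (Hf w Hw). cbv beta in Hf.
  change (Cmod ((f w - f z) - (w - z) * l)%C <= eps * Cmod (w - z)%C).
  now rewrite (Cmult_comm (w - z)).
Qed.

Lemma ex_derive_cderiv (f : C -> C) (z : C) :
  ex_derive (K := C_AbsRing) (V := C_NormedModule) f z -> exists l, cderiv f z l.
Proof.
  intros [l [_ H]]. exists l. intros eps Heps.
  specialize (H z (fun P HP => HP) (mkposreal eps Heps)).
  destruct H as [d Hd].
  apply locally_Cmod. exists d. split; [apply cond_pos|]. intros w Hw.
  specialize (Hd w Hw).
  change (Cmod ((f w - f z) - (w - z) * l)%C <= eps * Cmod (w - z)%C) in Hd.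
  now rewrite (Cmult_comm (w - z)) in Hd.
Qed.

Definition on (D : R -> Prop) (t : R) := within D (locally t).

#[local] Instance on_filter (D : R -> Prop) (t : R) : Filter (on D t).
Proof. apply within_filter, locally_filter. Qed.

Lemma tends_RtoC_on (D : R -> Prop) (t : R) : tends (on D t) RtoC (RtoC t).
Proof.
  intros eps Heps. unfold on, within. exists (mkposreal eps Heps). intros s Hs _.
  rewrite <- RtoC_minus, Cmod_R. exact Hs.
Qed.

Lemma derive_on_slope (D : R -> Prop) (f : R -> C) (t : R) (l : C) :
  derive_on D f t l <-> slope (on D t) RtoC f (RtoC t) (f t) l.
Proof.
  assert (FF : Filter (within (fun s => D s /\ s <> t) (locally t)))
    by (apply within_filter, locally_filter).
  assert (Q : forall s, s <> t -> (f s - f t - l * (RtoC s - RtoC t))%C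
    = (((f s - f t) / RtoC (s - t) - l) * (RtoC s - RtoC t))%C).
  { intros s Hs. rewrite RtoC_minus. field.
    intros E. apply Hs. rewrite <- RtoC_minus in E. apply RtoC_inj in E. lra. }
  unfold derive_on. rewrite (filterlim_tends _ _ l). split; intros H eps Heps.
  - generalize (H eps Heps). unfold on, within. apply filter_imp. intros s Hs Ds.
    destruct (Req_dec s t) as [->|Hst].
    + rewrite !Cmod_minus_self. replace (f t - f t - l * (RtoC t - RtoC t))%C with (RtoC 0) by ring.
      rewrite Cmod_0. lra.
    + rewrite Q by assumption. rewrite Cmod_mult. apply Rmult_le_compat_r; [apply Cmod_ge_0|].
      left. apply Hs. auto.
  - generalize (H (eps / 2) ltac:(lra)). unfold on, within. apply filter_imp.
    intros s Hs [Ds Hst]. specialize (Hs Ds). rewrite Q in Hs by assumption.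
    rewrite Cmod_mult in Hs.
    assert (0 < Cmod (RtoC s - RtoC t)%C).
    { apply Cmod_gt_0. intros E. rewrite <- RtoC_minus in E. apply RtoC_inj in E. lra. }
    apply Rmult_le_reg_r in Hs; lra.
Qed.

Lemma slope_real (D : R -> Prop) (f : R -> R) (t l : R) :
  is_derive f t l ->
  slope (on D t) RtoC (fun s => RtoC (f s)) (RtoC t) (RtoC (f t)) (RtoC l).
Proof.
  intros [_ H] eps Heps. specialize (H t (fun P HP => HP) (mkposreal eps Heps)).
  unfold on, within. revert H. apply filter_imp. intros s Hs _.
  rewrite <- !RtoC_minus, <- RtoC_mult, <- RtoC_minus, !Cmod_R.
  change (Rabs ((f s - f t) - (s - t) * l) <= eps * Rabs (s - t)) in Hs.
  now rewrite (Rmult_comm l).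
Qed.

(** * A mean value inequality for one-sided derivatives *)

Definition seg (t s : R) : Prop := 0 <= s <= t.

Definition clamp (t s : R) : R := Rmax 0 (Rmin t s).

Lemma clamp_seg (t s : R) : 0 <= t -> seg t (clamp t s).
Proof.
  intros Ht. unfold clamp, seg. split; [apply Rmax_l|].
  apply Rmax_lub; [exact Ht | apply Rmin_l].
Qed.

Lemma clamp_id (t s : R) : seg t s -> clamp t s = s.
Proof.
  intros [H1 H2]. unfold clamp. rewrite Rmin_right by assumption. now rewrite Rmax_right.
Qed.

Lemma clamp_lipschitz (t s r : R) : Rabs (clamp t s - clamp t r) <= Rabs (s - r).
Proof.
  unfold clamp, Rmax, Rmin, Rabs.
  repeat destruct Rle_dec; repeat destruct Rcase_abs; lra.
Qed.

(** Composing with [clamp] turns continuity relative to [0, t] into continuity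
    on the whole line, where the classical theorems of real analysis apply. *)
Lemma clamp_continuity (t : R) (h : R -> R) (s : R) :
  0 <= t ->
  (forall s, seg t s -> tends (on (seg t) s) (fun r => RtoC (h r)) (RtoC (h s))) ->
  continuity_pt (fun r => h (clamp t r)) s.
Proof.
  intros Ht H. apply continuity_pt_filterlim. intros P [e He].
  destruct (H _ (clamp_seg t s Ht) e (cond_pos e)) as [d Hd].
  exists d. intros r Hr. apply He.
  assert (B : ball (clamp t s) d (clamp t r)).
  { eapply Rle_lt_trans; [apply (clamp_lipschitz t r s) | exact Hr]. }
  specialize (Hd _ B (clamp_seg t r Ht)). cbv beta in Hd.
  rewrite <- RtoC_minus, Cmod_R in Hd. exact Hd.
Qed.

Lemma slope_on_tends (D : R -> Prop) (h : R -> C) (s : R) (y l : C) :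
  slope (on D s) RtoC h (RtoC s) y l -> tends (on D s) h y.
Proof. apply slope_tends; [apply on_filter | apply tends_RtoC_on]. Qed.

Lemma tends_Re {T : Type} (F : (T -> Prop) -> Prop) {FF : Filter F} (y : T -> C) (y0 : C) :
  tends F y y0 -> tends F (fun s => RtoC (Re (y s))) (RtoC (Re y0)).
Proof.
  intros H eps Heps. generalize (H eps Heps). apply filter_imp. intros s Hs.
  eapply Rle_lt_trans; [|exact Hs]. rewrite <- RtoC_minus, Cmod_R.
  change (Re (y s) - Re y0) with (Re (y s - y0)%C). apply re_le_Cmod.
Qed.

Lemma mean_value_Re (t M : R) (h l : R -> C) :
  0 <= t ->
  (forall s, seg t s -> slope (on (seg t) s) RtoC h (RtoC s) (h s) (l s)) ->
  (forall s, seg t s -> Re (l s) <= M) ->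
  Re (h t) - Re (h 0) <= M * t.
Proof.
  intros Ht H HM.
  destruct (MVT_gen (fun s => Re (h (clamp t s))) 0 t (fun s => Re (l s))) as [c [Hc E]].
  - rewrite Rmin_left, Rmax_right by assumption. intros s Hs.
    split; [apply is_linear_scal_l|]. intros w Hw.
    assert (E := is_filter_lim_locally_unique (V := AbsRing_NormedModule R_AbsRing) _ _ Hw).
    rewrite <- E. clear w Hw E.
    intros eps.
    assert (S : seg t s) by (unfold seg; lra).
    destruct (slope_Re _ (fun r => r) _ _ _ _ (H s S) eps (cond_pos eps)) as [d Hd].
    assert (Hd' : 0 < Rmin d (Rmin s (t - s))).
    { repeat apply Rmin_pos; [apply cond_pos | lra | lra]. }
    exists (mkposreal _ Hd'). intros r Hr.
    change (Rabs (r - s) < Rmin d (Rmin s (t - s))) in Hr.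
    assert (A1 := Rmin_l d (Rmin s (t - s))). assert (A2 := Rmin_r d (Rmin s (t - s))).
    assert (A3 := Rmin_l s (t - s)). assert (A4 := Rmin_r s (t - s)).
    assert (B := Hr). apply Rabs_def2 in B.
    assert (Sr : seg t r) by (unfold seg; lra).
    rewrite !clamp_id by assumption.
    assert (Br : ball s d r) by (change (Rabs (r - s) < d); lra).
    specialize (Hd r Br Sr). cbv beta in Hd.
    rewrite <- !RtoC_minus, <- RtoC_mult, <- RtoC_minus, !Cmod_R in Hd.
    rewrite (Rmult_comm (Re (l s))) in Hd. exact Hd.
  - intros s _. apply (clamp_continuity t (fun r => Re (h r))); [assumption|].
    intros r Hr. apply tends_Re; [apply on_filter|].
    eapply slope_on_tends, H, Hr.
  - rewrite Rmin_left, Rmax_right in Hc by assumption.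
    rewrite !clamp_id in E by (unfold seg; lra). rewrite E.
    rewrite Rminus_0_r. apply Rmult_le_compat_r; [assumption | apply HM, Hc].
Qed.

(** The real version, applied to [h] rotated by the conjugate of its increment. *)
Lemma mean_value_Cmod (t M : R) (h l : R -> C) :
  0 <= t ->
  (forall s, seg t s -> slope (on (seg t) s) RtoC h (RtoC s) (h s) (l s)) ->
  (forall s, seg t s -> Cmod (l s) <= M) ->
  Cmod (h t - h 0)%C <= M * t.
Proof.
  intros Ht H HM. set (c := Cconj (h t - h 0)%C).
  assert (Hc : Cmod c = Cmod (h t - h 0)%C) by apply Cmod_conj.
  destruct (Req_dec (Cmod c) 0) as [E|E].
  - rewrite <- Hc, E. apply Rmult_le_pos; [|assumption].
    apply Rle_trans with (Cmod (l 0)); [apply Cmod_ge_0 | apply HM; unfold seg; lra].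
  - assert (P : 0 < Cmod c) by (generalize (Cmod_ge_0 c); lra).
    assert (Q : Re (c * h t)%C - Re (c * h 0)%C <= (Cmod c * M) * t).
    { apply (mean_value_Re t (Cmod c * M) (fun s => c * h s)%C (fun s => c * l s)%C Ht).
      - intros s Hs. apply slope_scal; [apply on_filter | apply H, Hs].
      - intros s Hs. eapply Rle_trans; [apply Rle_abs|].
        eapply Rle_trans; [apply re_le_Cmod|]. rewrite Cmod_mult.
        apply Rmult_le_compat_l; [lra | apply HM, Hs]. }
    assert (R1 : Re (c * h t)%C - Re (c * h 0)%C = Cmod c * Cmod c).
    { rewrite Hc. generalize (Cmod2_alt (h t - h 0)%C). intros A. simpl pow in A.
      rewrite !Rmult_1_r in A. rewrite A. unfold c. simpl. ring. }
    rewrite R1, Rmult_assoc in Q. apply Rmult_le_reg_l in Q; [|assumption].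
    now rewrite <- Hc.
Qed.

(** * Polar coordinates, exponential and logarithm *)

Definition cexp (z : C) : C := (RtoC (exp (Re z)) * expi (Im z))%C.

Definition clog (z : C) : C := (ln (Cmod z), arg z).

Lemma Cmod_expi (x : R) : Cmod (expi x) = 1.
Proof.
  unfold Cmod, expi. simpl fst. simpl snd. rewrite <- sqrt_1. f_equal.
  generalize (sin2_cos2 x). unfold Rsqr. lra.
Qed.

Lemma Cmod_polar (r x : R) : 0 <= r -> Cmod (RtoC r * expi x)%C = r.
Proof. intros H. rewrite Cmod_mult, Cmod_expi, Cmod_R, Rabs_right; lra. Qed.

Lemma expi_plus (x y : R) : expi (x + y) = (expi x * expi y)%C.
Proof.
  unfold expi. rewrite cos_plus, sin_plus. apply injective_projections; simpl; ring.
Qed.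

Lemma cexp_plus (z w : C) : cexp (z + w)%C = (cexp z * cexp w)%C.
Proof.
  unfold cexp. change (Re (z + w)%C) with (Re z + Re w).
  change (Im (z + w)%C) with (Im z + Im w).
  rewrite exp_plus, RtoC_mult, expi_plus. ring.
Qed.

Lemma cexp_0 : cexp 0 = 1%C.
Proof.
  unfold cexp, expi. simpl. rewrite exp_0, cos_0, sin_0.
  apply injective_projections; simpl; ring.
Qed.

Lemma cexp_real (x : R) : cexp (RtoC x) = RtoC (exp x).
Proof.
  unfold cexp, expi. simpl. rewrite cos_0, sin_0.
  apply injective_projections; simpl; ring.
Qed.

Lemma upper_neq_0 (z : C) : upper z -> z <> 0%C.
Proof. intros H E. rewrite E in H. unfold upper in H. simpl in H. lra. Qed.

Lemma upper_Cmod_pos (z : C) : upper z -> 0 < Cmod z.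
Proof. intros H. now apply Cmod_gt_0, upper_neq_0. Qed.

Lemma upper_minus_real (z : C) (p : R) : upper z -> upper (z - RtoC p)%C.
Proof. unfold upper, Im. simpl. lra. Qed.

Lemma Im_le_Cmod (z : C) : Rabs (Im z) <= Cmod z.
Proof. eapply Rle_trans; [|apply (Rmax_Cmod z)]. apply Rmax_r. Qed.

Lemma upper_cos_bound (z : C) : upper z -> -1 < Re z / Cmod z < 1.
Proof.
  intros H. assert (P := upper_Cmod_pos z H).
  assert (Q : (Re z) ^ 2 < (Cmod z) ^ 2).
  { rewrite Cmod2_alt. assert (0 < Im z ^ 2) by (apply pow_lt; exact H). lra. }
  split.
  - apply Rmult_lt_reg_r with (Cmod z); [assumption|]. unfold Rdiv.
    rewrite Rmult_assoc, Rinv_l by lra. nra.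
  - apply Rmult_lt_reg_r with (Cmod z); [assumption|]. unfold Rdiv.
    rewrite Rmult_assoc, Rinv_l by lra. nra.
Qed.

Lemma arg_bounds (z : C) : upper z -> 0 < arg z < PI.
Proof. intros H. apply acos_bound_lt, upper_cos_bound, H. Qed.

Lemma polar_form (z : C) : upper z -> z = (RtoC (Cmod z) * expi (arg z))%C.
Proof.
  intros H. assert (P := upper_Cmod_pos z H). assert (B := upper_cos_bound z H).
  unfold expi, arg. rewrite cos_acos, sin_acos by lra.
  replace (sqrt (1 - (Re z / Cmod z)²)) with (Im z / Cmod z).
  - apply injective_projections; simpl; unfold Re, Im; field; lra.
  - symmetry. replace (1 - (Re z / Cmod z)²) with ((Im z / Cmod z)²).
    + apply sqrt_Rsqr. apply Rlt_le, Rdiv_lt_0_compat; assumption.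
    + assert (E := Cmod2_alt z). unfold Rsqr.
      apply Rmult_eq_reg_r with (Cmod z ^ 2); [|apply pow_nonzero; lra].
      transitivity (Im z ^ 2); [field; lra|].
      transitivity (Cmod z ^ 2 - Re z ^ 2); [lra | field; lra].
Qed.

Lemma upper_polar (r x : R) : 0 < r -> 0 < x < PI -> upper (RtoC r * expi x)%C.
Proof.
  intros Hr Hx. unfold upper, expi. simpl. assert (0 < sin x) by (apply sin_gt_0; lra).
  assert (0 < r * sin x) by (apply Rmult_lt_0_compat; assumption). lra.
Qed.

Lemma arg_polar (r x : R) : 0 < r -> 0 <= x <= PI -> arg (RtoC r * expi x)%C = x.
Proof.
  intros Hr Hx. unfold arg. rewrite Cmod_polar by lra.
  rewrite <- (acos_cos x) at 2 by assumption. f_equal. unfold expi. simpl. field. lra.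
Qed.

Lemma upper_cexp (z : C) : 0 < Im z < PI -> upper (cexp z).
Proof. apply upper_polar, exp_pos. Qed.

Lemma cexp_clog (z : C) : upper z -> cexp (clog z) = z.
Proof.
  intros H. unfold cexp, clog. cbn [Re Im fst snd].
  rewrite exp_ln by now apply upper_Cmod_pos. symmetry. now apply polar_form.
Qed.

Lemma clog_cexp (z : C) : 0 < Im z < PI -> clog (cexp z) = z.
Proof.
  intros H. unfold clog, cexp. assert (P := exp_pos (Re z)).
  rewrite Cmod_polar, arg_polar by lra. rewrite ln_exp. now destruct z.
Qed.

Lemma clog_scale (r : R) (z : C) : 0 < r -> upper z ->
  clog (RtoC r * z)%C = (RtoC (ln r) + clog z)%C.
Proof.
  intros Hr H. assert (P := upper_Cmod_pos z H).
  unfold clog, arg. rewrite Cmod_mult, Cmod_R, (Rabs_right r), re_scal_l by lra.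
  rewrite ln_mult by assumption.
  replace (r * Re z / (r * Cmod z)) with (Re z / Cmod z) by (field; lra).
  apply injective_projections; simpl; ring.
Qed.

Lemma cpower_cexp (z : C) (s : R) : cpower z s = cexp (RtoC s * clog z)%C.
Proof.
  unfold cpower, cexp, clog, Rpower. rewrite re_scal_l, im_scal_l. reflexivity.
Qed.

(** ** Continuity of polar coordinates *)

Lemma locally_upper (z : C) : upper z -> locally z upper.
Proof.
  intros H. apply locally_Cmod. exists (Im z). split; [exact H|].
  intros w Hw. unfold upper. assert (A := Im_le_Cmod (w - z)%C).
  change (Im (w - z)%C) with (Im w - Im z) in A.
  assert (B : Rabs (Im w - Im z) < Im z) by lra. apply Rabs_def2 in B. lra.
Qed.

Lemma acos_continuity (x : R) : -1 < x < 1 -> continuity_pt acos x.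
Proof. intros H. now apply derivable_continuous_pt, derivable_pt_acos. Qed.

Lemma ln_continuity (x : R) : 0 < x -> continuity_pt ln x.
Proof.
  intros H. apply derivable_continuous_pt. exists (/ x). now apply derivable_pt_lim_ln.
Qed.

Section Limits.

Context {T : Type} (F : (T -> Prop) -> Prop) {FF : Filter F}.

Definition rtends (y : T -> R) (y0 : R) : Prop := filterlim y F (locally y0).

Lemma rtends_eps (y : T -> R) (y0 : R) :
  rtends y y0 <-> forall eps, 0 < eps -> F (fun s => Rabs (y s - y0) < eps).
Proof.
  split.
  - intros H eps Heps. apply (H (fun w => Rabs (w - y0) < eps)).
    exists (mkposreal eps Heps). intros w Hw. exact Hw.
  - intros H P [d Hd]. unfold filtermap. generalize (H d (cond_pos d)).
    apply filter_imp. intros s Hs. apply Hd. exact Hs.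
Qed.

Lemma rtends_comp (f : R -> R) (y : T -> R) (y0 : R) :
  continuity_pt f y0 -> rtends y y0 -> rtends (fun s => f (y s)) (f y0).
Proof.
  intros Hf H. apply continuity_pt_filterlim in Hf.
  eapply filterlim_comp; [exact H | exact Hf].
Qed.

Lemma rtends_const (c : R) : rtends (fun _ => c) c.
Proof. apply filterlim_const. Qed.

Lemma rtends_plus (y z : T -> R) (y0 z0 : R) :
  rtends y y0 -> rtends z z0 -> rtends (fun s => y s + z s) (y0 + z0).
Proof.
  intros H1 H2. eapply filterlim_comp_2; [exact H1 | exact H2|].
  apply (filterlim_plus (V := R_NormedModule)).
Qed.

Lemma rtends_mult (y z : T -> R) (y0 z0 : R) :
  rtends y y0 -> rtends z z0 -> rtends (fun s => y s * z s) (y0 * z0).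
Proof.
  intros H1 H2. eapply filterlim_comp_2; [exact H1 | exact H2|].
  apply (filterlim_mult (K := R_AbsRing)).
Qed.

Lemma rtends_opp (y : T -> R) (y0 : R) :
  rtends y y0 -> rtends (fun s => - y s) (- y0).
Proof. apply (rtends_comp Ropp). apply continuity_pt_opp, derivable_continuous_pt, derivable_pt_id. Qed.

Lemma rtends_minus (y z : T -> R) (y0 z0 : R) :
  rtends y y0 -> rtends z z0 -> rtends (fun s => y s - z s) (y0 - z0).
Proof. intros H1 H2. apply rtends_plus; [assumption | now apply rtends_opp]. Qed.

Lemma rtends_inv (y : T -> R) (y0 : R) :
  y0 <> 0 -> rtends y y0 -> rtends (fun s => / y s) (/ y0).
Proof.
  intros H. apply (rtends_comp Rinv).
  apply (continuity_pt_inv id); [apply derivable_continuous_pt, derivable_pt_id | exact H].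
Qed.

Lemma rtends_ext (y z : T -> R) (y0 : R) :
  F (fun s => y s = z s) -> rtends y y0 -> rtends z y0.
Proof. intros He. now apply filterlim_ext_loc. Qed.

Lemma tends_pair (y : T -> C) (y0 : C) :
  rtends (fun s => Re (y s)) (Re y0) -> rtends (fun s => Im (y s)) (Im y0) ->
  tends F y y0.
Proof.
  intros H1 H2 eps Heps. apply (proj1 (rtends_eps _ _)) with (eps := eps / 2) in H1, H2; try lra.
  generalize (filter_and (F := F) _ _ H1 H2). apply filter_imp. intros s [A B].
  replace (y s - y0)%C with
    (RtoC (Re (y s) - Re y0) + Ci * RtoC (Im (y s) - Im y0))%C
    by (apply injective_projections; unfold Re, Im; simpl; ring).
  eapply Rle_lt_trans; [apply Cmod_triangle|]. rewrite Cmod_mult, Cmod_Ci, !Cmod_R. lra.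
Qed.

Lemma rtends_of_tends (h : C -> R) (y : T -> C) (y0 : C) :
  (forall z w, Rabs (h z - h w) <= Cmod (z - w)%C) ->
  tends F y y0 -> rtends (fun s => h (y s)) (h y0).
Proof.
  intros Hh H. apply rtends_eps. intros eps Heps. generalize (H eps Heps).
  apply filter_imp. intros s Hs. eapply Rle_lt_trans; [apply Hh | exact Hs].
Qed.

Lemma rtends_Re (y : T -> C) (y0 : C) : tends F y y0 -> rtends (fun s => Re (y s)) (Re y0).
Proof. apply rtends_of_tends. intros z w. apply (re_le_Cmod (z - w)%C). Qed.

Lemma rtends_Im (y : T -> C) (y0 : C) : tends F y y0 -> rtends (fun s => Im (y s)) (Im y0).
Proof. apply rtends_of_tends. intros z w. apply (Im_le_Cmod (z - w)%C). Qed.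

Lemma rtends_Cmod (y : T -> C) (y0 : C) : tends F y y0 -> rtends (fun s => Cmod (y s)) (Cmod y0).
Proof.
  apply rtends_of_tends. intros z w. apply Rabs_le.
  assert (A := Cmod_triangle_rev z w). assert (B := Cmod_triangle_rev w z).
  rewrite (Cmod_minus_sym w z) in B. lra.
Qed.

Lemma rtends_arg (y : T -> C) (y0 : C) :
  upper y0 -> tends F y y0 -> rtends (fun s => arg (y s)) (arg y0).
Proof.
  intros H0 H. apply (rtends_comp acos); [now apply acos_continuity, upper_cos_bound|].
  apply rtends_mult; [now apply rtends_Re|].
  apply rtends_inv; [|now apply rtends_Cmod]. generalize (upper_Cmod_pos _ H0). lra.
Qed.

Lemma tends_clog (y : T -> C) (y0 : C) :
  upper y0 -> tends F y y0 -> tends F (fun s => clog (y s)) (clog y0).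
Proof.
  intros H0 H. apply tends_pair; cbn [clog Re Im fst snd]; [|now apply rtends_arg].
  apply (rtends_comp ln); [|now apply rtends_Cmod].
  now apply ln_continuity, upper_Cmod_pos.
Qed.

End Limits.

(** ** Derivatives of exponential and logarithm *)

Lemma derivative_at_0 (f : R -> R) (m : R) :
  is_derive f 0 m -> forall eps, 0 < eps ->
  exists d, 0 < d /\ forall x, Rabs x < d -> Rabs (f x - f 0 - m * x) <= eps * Rabs x.
Proof.
  intros [_ H] eps Heps. destruct (H 0 (fun P HP => HP) (mkposreal eps Heps)) as [d Hd].
  exists d. split; [apply cond_pos|]. intros x Hx.
  assert (B : ball 0 d x) by (change (Rabs (x - 0) < d); now rewrite Rminus_0_r).
  specialize (Hd x B).
  change (Rabs (f x - f 0 - (x - 0) * m) <= eps * Rabs (x - 0)) in Hd.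
  rewrite Rminus_0_r in Hd. now rewrite (Rmult_comm m).
Qed.

Lemma cderiv_cexp_0 : cderiv cexp 0 1.
Proof.
  intros eps Heps. apply locally_Cmod.
  (* With [x + i y] for the point, the error splits into four terms, of total size at
     most 11/2 of [e] times the modulus. *)
  set (e := Rmin 1 (eps / 6)).
  assert (He : 0 < e) by (unfold e; apply Rmin_pos; lra).
  assert (He1 : e <= 1) by apply Rmin_l. assert (He2 : e <= eps / 6) by apply Rmin_r.
  assert (D1 : is_derive exp 0 1) by (auto_derive; [easy | rewrite exp_0; ring]).
  assert (D2 : is_derive cos 0 0) by (auto_derive; [easy | rewrite sin_0; ring]).
  assert (D3 : is_derive sin 0 1) by (auto_derive; [easy | rewrite cos_0; ring]).
  destruct (derivative_at_0 exp _ D1 e He) as [d1 [Hd1 E1]].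
  destruct (derivative_at_0 cos _ D2 e He) as [d2 [Hd2 E2]].
  destruct (derivative_at_0 sin _ D3 e He) as [d3 [Hd3 E3]].
  exists (Rmin (Rmin d1 d2) (Rmin d3 (e / 2))).
  split; [repeat apply Rmin_pos; lra|]. intros w Hw.
  assert (M1 := Rmin_l (Rmin d1 d2) (Rmin d3 (e / 2))).
  assert (M2 := Rmin_r (Rmin d1 d2) (Rmin d3 (e / 2))).
  assert (M3 := Rmin_l d1 d2). assert (M4 := Rmin_r d1 d2).
  assert (M5 := Rmin_l d3 (e / 2)). assert (M6 := Rmin_r d3 (e / 2)).
  replace (w - 0)%C with w in * by ring.
  assert (X := re_le_Cmod w). assert (Y := Im_le_Cmod w).
  set (x := Re w) in *. set (y := Im w) in *.
  assert (N := Cmod_ge_0 w). set (n := Cmod w) in *.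
  specialize (E1 x ltac:(lra)). specialize (E2 y ltac:(lra)). specialize (E3 y ltac:(lra)).
  rewrite exp_0 in E1. rewrite cos_0 in E2. rewrite sin_0 in E3.
  rewrite cexp_0.
  set (A := exp x - 1 - 1 * x) in *. set (B := cos y - 1 - 0 * y) in *.
  set (S := sin y - 0 - 1 * y) in *.
  replace (cexp w - 1 - 1 * w)%C with
    (RtoC (A * cos y + (1 + x) * B) + Ci * RtoC ((A + x) * sin y + S))%C.
  2:{ unfold A, B, S, x, y, cexp, expi. apply injective_projections; unfold Re, Im; simpl; ring. }
  eapply Rle_trans; [apply Cmod_triangle|]. rewrite Cmod_mult, Cmod_Ci, !Cmod_R, Rmult_1_l.
  assert (C1 : Rabs (cos y) <= 1) by (apply Rabs_le, COS_bound).
  assert (S1 : Rabs (sin y) <= 1) by (apply Rabs_le, SIN_bound).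
  assert (S2 : Rabs (sin y) <= 2 * n).
  { replace (sin y) with (S + y) by (unfold S; ring). eapply Rle_trans; [apply Rabs_triang|].
    assert (e * Rabs y <= 1 * Rabs y) by (apply Rmult_le_compat_r; [apply Rabs_pos | lra]). lra. }
  assert (T1 : Rabs (A * cos y) <= e * n).
  { rewrite Rabs_mult. apply Rle_trans with (Rabs A * 1).
    - apply Rmult_le_compat_l; [apply Rabs_pos | assumption].
    - assert (e * Rabs x <= e * n) by (apply Rmult_le_compat_l; lra). lra. }
  assert (T2 : Rabs ((1 + x) * B) <= 3 / 2 * (e * n)).
  { rewrite Rabs_mult. apply Rmult_le_compat; try apply Rabs_pos.
    - eapply Rle_trans; [apply Rabs_triang|]. rewrite Rabs_R1. lra.
    - assert (e * Rabs y <= e * n) by (apply Rmult_le_compat_l; lra). lra. }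
  assert (T3 : Rabs ((A + x) * sin y) <= e * (2 * n)).
  { rewrite Rabs_mult. apply Rmult_le_compat; try apply Rabs_pos; [|assumption].
    eapply Rle_trans; [apply Rabs_triang|].
    assert (e * Rabs x <= 1 * Rabs x) by (apply Rmult_le_compat_r; [apply Rabs_pos | lra]). lra. }
  assert (T4 : Rabs S <= e * n).
  { assert (e * Rabs y <= e * n) by (apply Rmult_le_compat_l; lra). lra. }
  assert (U1 := Rabs_triang (A * cos y) ((1 + x) * B)).
  assert (U2 := Rabs_triang ((A + x) * sin y) S).
  assert (e * n <= eps / 6 * n) by (apply Rmult_le_compat_r; lra).
  assert (0 <= eps * n) by (apply Rmult_le_pos; lra).
  lra.
Qed.

Lemma cderiv_cexp (z : C) : cderiv cexp z (cexp z).
Proof.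
  assert (F : Filter (locally z)) by apply locally_filter.
  assert (E : (z + - z)%C = RtoC 0) by ring.
  assert (S : slope (locally z) (fun w => w) (fun w => cexp (w + - z)%C) z
    (cexp (z + - z)%C) (1 * (1 + 0))%C).
  { apply slope_comp; [exact F | apply tends_id | |].
    - apply slope_plus; [exact F | apply slope_id, F | apply slope_const, F].
    - rewrite E. apply cderiv_cexp_0. }
  apply (slope_scal (locally z) _ _ _ _ _ (cexp z)) in S.
  rewrite E, cexp_0 in S. rewrite Cplus_0_r, !Cmult_1_r in S.
  eapply slope_ext; [exact F | | exact S].
  apply filter_forall. intros w. rewrite <- cexp_plus. f_equal. ring.
Qed.

(** Implicit differentiation of [cexp (clog w) = w]. *)
Lemma cderiv_clog (z : C) : upper z -> cderiv clog z (/ z)%C.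
Proof.
  intros H. assert (F : Filter (locally z)) by apply locally_filter.
  replace (/ z)%C with (1 / cexp (clog z))%C.
  2:{ rewrite cexp_clog by assumption. field. now apply upper_neq_0. }
  apply slope_inverse with (f := cexp); [exact F| | | |].
  - rewrite cexp_clog by assumption. now apply upper_neq_0.
  - apply tends_clog; [exact F | exact H | apply tends_id].
  - apply cderiv_cexp.
  - apply slope_ext with (y := fun w => w); [exact F | |].
    + generalize (locally_upper z H). apply filter_imp. intros w Hw. now rewrite cexp_clog.
    + rewrite cexp_clog by assumption. apply slope_id. exact F.
Qed.

Lemma ex_derive_continuity_pt (f : R -> R) (x : R) : ex_derive f x -> continuity_pt f x.
Proof.
  intros H. apply continuity_pt_filterlim.
  exact (ex_derive_continuous (K := R_AbsRing) (V := R_NormedModule) f x H).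
Qed.

(** * The modulus along a line of constant argument *)

(** For [z] with [arg (z - a) = ph] and [arg (z - b) = be * ph - de], the law of sines
    gives [Re (logk z) = logmod be de ph - (1 - be) * ln (a - b)]; the three sines are
    those of the angles of the triangle [a], [b], [z]. *)
Definition logmod (be de ph : R) : R :=
  be * ln (sin (be * ph - de)) + (1 - be) * ln (sin ((1 - be) * ph + de)) - ln (sin ph).

(** The angles of the triangle are positive. *)
Definition phase_dom (be de ph : R) : Prop :=
  0 < be * ph - de /\ 0 < (1 - be) * ph + de /\ ph < PI.

Lemma phase_dom_up (be de p q : R) : 0 < be < 1 -> phase_dom be de p -> p <= q < PI -> phase_dom be de q.
Proof.
  intros Hb [H1 [H2 H3]] Hq. repeat split; [| |lra].
  - assert (be * p <= be * q) by (apply Rmult_le_compat_l; lra). lra.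
  - assert ((1 - be) * p <= (1 - be) * q) by (apply Rmult_le_compat_l; lra). lra.
Qed.

Lemma phase_dom_pos (be de p : R) : phase_dom be de p -> 0 < p < PI.
Proof. intros [H1 [H2 H3]]. split; [nra | exact H3]. Qed.

Lemma phase_dom_sin (be de p : R) : phase_dom be de p ->
  0 < sin (be * p - de) /\ 0 < sin ((1 - be) * p + de) /\ 0 < sin p.
Proof.
  intros H. assert (P := phase_dom_pos _ _ _ H). destruct H as [H1 [H2 H3]].
  repeat split; apply sin_gt_0; lra.
Qed.

(** Exchanging the exponents [be] and [1 - be] changes the sign of [de], which halves
    the discussion of the behaviour at the lower end of the domain. *)
Lemma logmod_sym (be de p : R) : logmod be de p = logmod (1 - be) (- de) p.
Proof.
  unfold logmod. replace (1 - (1 - be)) with be by ring.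
  replace ((1 - be) * p - - de) with ((1 - be) * p + de) by ring.
  replace (be * p + - de) with (be * p - de) by ring. ring.
Qed.

Lemma phase_dom_sym (be de p : R) : phase_dom (1 - be) (- de) p -> phase_dom be de p.
Proof.
  unfold phase_dom. intros [H1 [H2 H3]]. replace (1 - (1 - be)) with be in H2 by ring.
  repeat split; lra.
Qed.

Definition dlogmod (be de p : R) : R :=
  be ^ 2 * (cos (be * p - de) / sin (be * p - de))
  + (1 - be) ^ 2 * (cos ((1 - be) * p + de) / sin ((1 - be) * p + de)) - cos p / sin p.

Lemma logmod_derive (be de p : R) : phase_dom be de p -> is_derive (logmod be de) p (dlogmod be de p).
Proof.
  intros H. destruct (phase_dom_sin _ _ _ H) as [A [B D]].
  unfold logmod, dlogmod. auto_derive; unfold Rminus in *.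
  - repeat split; assumption.
  - field. repeat split; lra.
Qed.

(** With [c1], [s1], [c2], [s2] the cosines and sines of the first two angles, the
    derivative times [s1 * s2 * sin p] is
    [(be c1 s2 - (1 - be) c2 s1)^2 + (s1 s2)^2]. *)
Lemma dlogmod_pos (be de p : R) : phase_dom be de p -> 0 < dlogmod be de p.
Proof.
  intros H. destruct (phase_dom_sin _ _ _ H) as [A [B D]]. unfold dlogmod.
  assert (E : p = (be * p - de) + ((1 - be) * p + de)) by ring.
  assert (Es := f_equal sin E). assert (Ec := f_equal cos E).
  rewrite sin_plus in Es. rewrite cos_plus in Ec.
  revert A B D Es Ec. generalize (sin (be * p - de)), (cos (be * p - de)),
    (sin ((1 - be) * p + de)), (cos ((1 - be) * p + de)), (sin p), (cos p).
  intros s1 c1 s2 c2 s c A B D -> ->.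
  apply Rmult_lt_reg_r with (s1 * s2 * (s1 * c2 + c1 * s2)).
  { repeat apply Rmult_lt_0_compat; assumption. }
  rewrite Rmult_0_l.
  replace (_ * _) with ((be * c1 * s2 - (1 - be) * c2 * s1) ^ 2 + (s1 * s2) ^ 2)
    by (field; repeat split; lra).
  assert (0 < (s1 * s2) ^ 2) by (apply pow_lt, Rmult_lt_0_compat; assumption).
  assert (Q := pow2_ge_0 (be * c1 * s2 - (1 - be) * c2 * s1)). lra.
Qed.

Lemma logmod_continuity (be de p : R) : phase_dom be de p -> continuity_pt (logmod be de) p.
Proof.
  intros H. apply ex_derive_continuity_pt.
  exists (dlogmod be de p). now apply logmod_derive.
Qed.

Lemma logmod_increasing (be de p q : R) : 0 < be < 1 -> phase_dom be de p -> p < q < PI ->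
  logmod be de p < logmod be de q.
Proof.
  intros Hb H Hq.
  assert (D : forall r, p <= r <= q -> phase_dom be de r).
  { intros r Hr. apply phase_dom_up with p; [assumption..|lra]. }
  destruct (MVT_gen (logmod be de) p q (dlogmod be de)) as [c [Hc E]].
  - rewrite Rmin_left, Rmax_right by lra. intros r Hr. apply logmod_derive, D. lra.
  - rewrite Rmin_left, Rmax_right by lra. intros r Hr. apply logmod_continuity, D. lra.
  - rewrite Rmin_left, Rmax_right in Hc by lra.
    assert (0 < dlogmod be de c * (q - p)).
    { apply Rmult_lt_0_compat; [apply dlogmod_pos, D, Hc | lra]. }
    lra.
Qed.

Lemma logmod_lt_iff (be de p q : R) : 0 < be < 1 -> phase_dom be de p -> phase_dom be de q ->
  (logmod be de p < logmod be de q <-> p < q).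
Proof.
  intros Hb Hp Hq. split; intros H.
  - destruct (Rtotal_order p q) as [L|[->|L]]; [exact L | lra |].
    assert (logmod be de q < logmod be de p).
    { apply logmod_increasing; [assumption..|]. split; [exact L | apply (phase_dom_pos _ _ _ Hp)]. }
    lra.
  - apply logmod_increasing; [assumption..|]. split; [exact H | apply (phase_dom_pos _ _ _ Hq)].
Qed.

Lemma logmod_inj (be de p q : R) : 0 < be < 1 -> phase_dom be de p -> phase_dom be de q ->
  logmod be de p = logmod be de q -> p = q.
Proof.
  intros Hb Hp Hq E. destruct (Rtotal_order p q) as [L|[L|L]]; [|exact L|];
    apply (logmod_lt_iff be de) in L; try assumption; lra.
Qed.

Lemma logmod_intermediate (be de p q r : R) : 0 < be < 1 -> phase_dom be de p -> phase_dom be de q ->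
  logmod be de p < r < logmod be de q -> exists x, p < x < q /\ phase_dom be de x /\ logmod be de x = r.
Proof.
  intros Hb Hp Hq Hr.
  assert (Hpq : p < q) by (apply (logmod_lt_iff be de p q Hb Hp Hq); lra).
  assert (Q := phase_dom_pos _ _ _ Hq).
  destruct (IVT_interv (fun x => logmod be de x - r) p q) as [x [Hx E]]; [|assumption|lra|lra|].
  - intros a Ha. apply continuity_pt_minus; [|apply continuity_pt_const; now intros ? ?].
    apply logmod_continuity, phase_dom_up with p; [assumption..|lra].
  - assert (Hd : phase_dom be de x) by (apply phase_dom_up with p; [assumption..|lra]).
    exists x. assert (logmod be de x = r) by lra.
    split; [|now split]. split; apply (logmod_lt_iff be de); try assumption; lra.
Qed.

Lemma ln_blowup {T : Type} (F : (T -> Prop) -> Prop) {FF : Filter F}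
    (u s : T -> R) (u0 c M : R) :
  0 < c -> rtends F u u0 -> rtends F s 0 -> F (fun x => 0 < s x) ->
  F (fun x => M < u x - c * ln (s x)).
Proof.
  intros Hc Hu Hs Hp.
  assert (E := exp_pos ((u0 - 1 - M) / c)).
  apply (proj1 (rtends_eps F _ _)) with (eps := 1) in Hu; [|lra].
  apply (proj1 (rtends_eps F _ _)) with (eps := exp ((u0 - 1 - M) / c)) in Hs; [|exact E].
  generalize (filter_and (F := F) _ _ Hu (filter_and (F := F) _ _ Hs Hp)).
  apply filter_imp. intros x [A [B D]].
  rewrite Rminus_0_r, Rabs_right in B by lra.
  apply Rabs_def2 in A. apply ln_increasing in B; [|assumption]. rewrite ln_exp in B.
  apply (Rmult_lt_compat_l c) in B; [|assumption].
  replace (c * ((u0 - 1 - M) / c)) with (u0 - 1 - M) in B by (field; lra). lra.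
Qed.

Lemma sin_affine_continuity (k m x : R) : continuity_pt (fun p => sin (k * p + m)) x.
Proof.
  apply ex_derive_continuity_pt. auto_derive. easy.
Qed.

Lemma rtends_sin_affine {T : Type} (F : (T -> Prop) -> Prop) {FF : Filter F}
    (y : T -> R) (k m x : R) :
  rtends F y x -> rtends F (fun s => sin (k * y s + m)) (sin (k * x + m)).
Proof. apply (rtends_comp F (fun p => sin (k * p + m))), sin_affine_continuity. Qed.

Lemma rtends_ln {T : Type} (F : (T -> Prop) -> Prop) {FF : Filter F} (y : T -> R) (x : R) :
  0 < x -> rtends F y x -> rtends F (fun s => ln (y s)) (ln x).
Proof. intros H. now apply rtends_comp, ln_continuity. Qed.

Lemma rtends_scal {T : Type} (F : (T -> Prop) -> Prop) {FF : Filter F} (c : R) (y : T -> R) (x : R) :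
  rtends F y x -> rtends F (fun s => c * y s) (c * x).
Proof. intros H. apply rtends_mult; [exact FF | now apply rtends_const | exact H]. Qed.

Lemma rtends_within (D : R -> Prop) (x : R) : rtends (within D (locally x)) (fun s => s) x.
Proof. intros P HP. unfold filtermap, within. revert HP. now apply filter_imp. Qed.

Lemma at_left_gt (x y : R) : y < x -> at_left x (fun p => y < p < x).
Proof.
  intros H. unfold at_left, within.
  exists (mkposreal (x - y) ltac:(lra)). intros p Hp Hpx.
  change (Rabs (p - x) < x - y) in Hp. apply Rabs_def2 in Hp. lra.
Qed.

Lemma at_right_lt (x y : R) : x < y -> at_right x (fun p => x < p < y).
Proof.
  intros H. unfold at_right, within.
  exists (mkposreal (y - x) ltac:(lra)). intros p Hp Hpx.
  change (Rabs (p - x) < y - x) in Hp. apply Rabs_def2 in Hp. lra.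
Qed.

(** As the phase tends to [PI], only the term [- ln (sin ph)] is unbounded. *)
Lemma logmod_unbounded_above (be de M p : R) : 0 < be < 1 -> phase_dom be de p ->
  exists q, p < q /\ phase_dom be de q /\ M < logmod be de q.
Proof.
  intros Hb H. assert (P := phase_dom_pos _ _ _ H).
  assert (FF : ProperFilter (at_left PI)) by apply at_left_proper_filter.
  assert (I : rtends (at_left PI) (fun s => s) PI) by apply rtends_within.
  assert (A : 0 < be * PI - de /\ 0 < (1 - be) * PI + de).
  { destruct H as [H1 [H2 H3]]. split; nra. }
  assert (G : at_left PI (fun q => M <
    (be * ln (sin (be * q + - de)) + (1 - be) * ln (sin ((1 - be) * q + de)))
    - 1 * ln (sin (1 * q + 0)))).
  { apply ln_blowup with (u0 := be * ln (sin (be * PI + - de))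
      + (1 - be) * ln (sin ((1 - be) * PI + de))); try exact _; [lra| | |].
    - apply rtends_plus; try exact _; apply rtends_scal; try exact _;
        (apply rtends_ln; try exact _; [|apply (rtends_sin_affine _ (fun s => s)); try exact _; exact I]); apply sin_gt_0; lra.
    - assert (Z : sin (1 * PI + 0) = 0) by (rewrite Rmult_1_l, Rplus_0_r; apply sin_PI).
      generalize (rtends_sin_affine _ (fun s => s) 1 0 PI I). now rewrite Z.
    - generalize (at_left_gt PI 0 PI_RGT_0). apply filter_imp. intros q Hq.
      apply sin_gt_0; lra. }
  destruct (filter_ex _ (filter_and _ _ G (at_left_gt PI p (proj2 P)))) as [q [G1 G2]].
  exists q. split; [lra|]. split; [apply phase_dom_up with p; [assumption..|lra]|].
  unfold logmod. rewrite !Rmult_1_l, Rplus_0_r in G1. exact G1.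
Qed.

(** At the lower end [de / be] of the domain only the first sine vanishes. *)
Lemma logmod_unbounded_below_pos (be de M : R) : 0 < be < 1 -> 0 < de < be * PI ->
  exists q, phase_dom be de q /\ logmod be de q < M.
Proof.
  intros Hb Hd. set (p := de / be).
  assert (Ep : be * p = de) by (unfold p; field; lra).
  assert (P : 0 < p < PI).
  { split; [unfold p; apply Rdiv_lt_0_compat; lra|].
    apply Rmult_lt_reg_l with be; lra. }
  assert (FF : ProperFilter (at_right p)) by apply at_right_proper_filter.
  assert (I : rtends (at_right p) (fun s => s) p) by apply rtends_within.
  assert (D : at_right p (fun q => p < q /\ phase_dom be de q)).
  { generalize (at_right_lt p PI (proj2 P)). apply filter_imp. intros q Hq.
    split; [lra|].
    assert (be * p < be * q) by (apply Rmult_lt_compat_l; lra).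
    assert (0 < (1 - be) * q) by (apply Rmult_lt_0_compat; lra).
    repeat split; lra. }
  assert (G : at_right p (fun q => - M <
    (ln (sin (1 * q + 0)) - (1 - be) * ln (sin ((1 - be) * q + de)))
    - be * ln (sin (be * q + - de)))).
  { apply ln_blowup with (u0 := ln (sin (1 * p + 0))
      - (1 - be) * ln (sin ((1 - be) * p + de))); try exact _; [lra| | |].
    - apply rtends_minus; try exact _; [|apply rtends_scal; try exact _];
        (apply rtends_ln; try exact _; [|apply (rtends_sin_affine _ (fun s => s)); try exact _; exact I]); apply sin_gt_0; lra.
    - assert (Z : sin (be * p + - de) = 0) by (replace (be * p + - de) with 0 by lra; apply sin_0).
      rewrite <- Z. apply (rtends_sin_affine _ (fun s => s)); try exact _; exact I.
    - revert D. apply filter_imp. intros q [_ Hq]. apply (phase_dom_sin _ _ _ Hq). }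
  destruct (filter_ex _ (filter_and _ _ G D)) as [q [G1 [G2 G3]]].
  exists q. split; [exact G3|]. unfold logmod.
  rewrite Rmult_1_l, Rplus_0_r in G1. unfold Rminus in *. lra.
Qed.

Lemma logmod_unbounded_below (be de M : R) : 0 < be < 1 -> de <> 0 ->
  - ((1 - be) * PI) < de < be * PI -> exists q, phase_dom be de q /\ logmod be de q < M.
Proof.
  intros Hb H0 Hd. destruct (Rlt_or_le 0 de) as [L|L].
  - apply logmod_unbounded_below_pos; lra.
  - destruct (logmod_unbounded_below_pos (1 - be) (- de) M) as [q [D H]]; [lra..|].
    exists q. split; [now apply phase_dom_sym | now rewrite logmod_sym].
Qed.

(** The limit at 0 of [logmod be 0], where all three sines vanish: the finite value
    that produces the slit. *)
Definition slit_tip (be : R) : R := be * ln be + (1 - be) * ln (1 - be).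

Lemma sinc_limit (k : R) : rtends (at_right 0) (fun p => sin (k * p) / p) k.
Proof.
  apply rtends_eps; try exact _. intros eps Heps.
  assert (D : is_derive (fun p => sin (k * p)) 0 k).
  { auto_derive; [easy|]. rewrite Rmult_0_r, cos_0. ring. }
  destruct (derivative_at_0 _ _ D (eps / 2) ltac:(lra)) as [d [Hd H]].
  generalize (at_right_lt 0 d Hd). apply filter_imp. intros p Hp.
  specialize (H p). rewrite Rmult_0_r, sin_0, Rminus_0_r, (Rabs_right p) in H by lra.
  specialize (H ltac:(lra)).
  replace (sin (k * p) / p - k) with ((sin (k * p) - k * p) / p) by (field; lra).
  unfold Rdiv. rewrite Rabs_mult, Rabs_inv, (Rabs_right p) by lra.
  apply Rle_lt_trans with (eps / 2 * p * / p).
  - apply Rmult_le_compat_r; [|exact H]. left. apply Rinv_0_lt_compat. lra.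
  - rewrite Rmult_assoc, Rinv_r; lra.
Qed.

Lemma phase_dom_0 (be p : R) : 0 < be < 1 -> phase_dom be 0 p <-> 0 < p < PI.
Proof.
  intros Hb. split; [apply phase_dom_pos|]. intros Hp.
  assert (0 < be * p) by (apply Rmult_lt_0_compat; lra).
  assert (0 < (1 - be) * p) by (apply Rmult_lt_0_compat; lra).
  repeat split; lra.
Qed.

Lemma logmod_limit_0 (be : R) : 0 < be < 1 -> rtends (at_right 0) (logmod be 0) (slit_tip be).
Proof.
  intros Hb.
  apply rtends_ext with (y := fun p => be * ln (sin (be * p) / p)
    + (1 - be) * ln (sin ((1 - be) * p) / p) - ln (sin (1 * p) / p)); try exact _.
  - generalize (at_right_lt 0 PI PI_RGT_0). apply filter_imp. intros p Hp.
    assert (D : phase_dom be 0 p) by now apply phase_dom_0.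
    destruct (phase_dom_sin _ _ _ D) as [A [B E]].
    unfold logmod. rewrite Rminus_0_r in *. rewrite Rplus_0_r in *. rewrite Rmult_1_l.
    rewrite !ln_div by lra. ring.
  - replace (slit_tip be) with (be * ln be + (1 - be) * ln (1 - be) - ln 1)
      by (unfold slit_tip; rewrite ln_1; ring).
    apply rtends_minus; try exact _; [apply rtends_plus; try exact _; apply rtends_scal; try exact _|];
      (apply rtends_ln; try exact _; [lra | apply sinc_limit]).
Qed.

Lemma slit_tip_lt_logmod (be p : R) : 0 < be < 1 -> phase_dom be 0 p -> slit_tip be < logmod be 0 p.
Proof.
  intros Hb H. assert (P := phase_dom_pos _ _ _ H).
  assert (H2 : phase_dom be 0 (p / 2)) by (apply phase_dom_0; lra).
  apply Rle_lt_trans with (logmod be 0 (p / 2)); [|apply logmod_increasing; [assumption..|lra]].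
  apply Rnot_lt_le. intros L.
  assert (A := proj1 (rtends_eps _ _ _) (logmod_limit_0 be Hb) (slit_tip be - logmod be 0 (p / 2)) ltac:(lra)).
  assert (FF : ProperFilter (at_right 0)) by apply at_right_proper_filter.
  destruct (filter_ex _ (filter_and _ _ A (at_right_lt 0 (p / 2) ltac:(lra)))) as [q [B D]].
  assert (Dq : phase_dom be 0 q) by (apply phase_dom_0; lra).
  assert (logmod be 0 q < logmod be 0 (p / 2)) by (apply logmod_increasing; [assumption..|lra]).
  apply Rabs_def2 in B. lra.
Qed.

Lemma logmod_onto (be de r : R) : 0 < be < 1 -> - ((1 - be) * PI) < de < be * PI ->
  (de = 0 -> slit_tip be < r) -> exists p, phase_dom be de p /\ logmod be de p = r.
Proof.
  intros Hb Hd Ht.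
  assert (L : exists p, phase_dom be de p /\ logmod be de p < r).
  { destruct (Req_dec de 0) as [->|N]; [|now apply logmod_unbounded_below].
    specialize (Ht eq_refl).
    assert (A := proj1 (rtends_eps _ _ _) (logmod_limit_0 be Hb) (r - slit_tip be) ltac:(lra)).
    assert (FF : ProperFilter (at_right 0)) by apply at_right_proper_filter.
    destruct (filter_ex _ (filter_and _ _ A (at_right_lt 0 PI PI_RGT_0))) as [q [B D]].
    exists q. split; [now apply phase_dom_0 | apply Rabs_def2 in B; lra]. }
  destruct L as [p [Dp Lp]].
  destruct (logmod_unbounded_above be de r p Hb Dp) as [q [_ [Dq Lq]]].
  destruct (logmod_intermediate be de p q r Hb Dp Dq) as [x [_ [Dx Ex]]]; [lra|].
  now exists x.
Qed.

Lemma logmod_continuity_de (be de p : R) : phase_dom be de p ->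
  rtends (locally de) (fun d => logmod be d p) (logmod be de p).
Proof.
  intros H. destruct (phase_dom_sin _ _ _ H) as [A [B D]].
  apply (proj1 (continuity_pt_filterlim (fun d => logmod be d p) de)), ex_derive_continuity_pt.
  unfold logmod. auto_derive. unfold Rminus in *. repeat split; assumption.
Qed.

(** * The logarithm of the conformal map *)

(** The third vertex of the triangle with base [b], [a] and with [arg (z - a) = ph],
    [arg (z - b) = ps]. *)
Definition apex (a b ph ps : R) : C :=
  (RtoC b + RtoC ((a - b) * sin ph / sin (ph - ps)) * expi ps)%C.

(** A logarithm of the conformal map, up to the additive constant [i PI (1 - be)]. *)
Definition logk (be a b : R) (z : C) : C :=
  (RtoC be * clog (z - RtoC a) - clog (z - RtoC b))%C.

Lemma apex_minus_b (a b ph ps : R) :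
  (apex a b ph ps - RtoC b)%C = (RtoC ((a - b) * sin ph / sin (ph - ps)) * expi ps)%C.
Proof. unfold apex. ring. Qed.

Lemma apex_minus_a (a b ph ps : R) : sin (ph - ps) <> 0 ->
  (apex a b ph ps - RtoC a)%C = (RtoC ((a - b) * sin ps / sin (ph - ps)) * expi ph)%C.
Proof.
  intros H. unfold apex, expi. rewrite sin_minus in *.
  apply injective_projections; simpl; field; exact H.
Qed.

Lemma sin_pos3 (ph ps : R) : 0 < ps < ph -> ph < PI ->
  0 < sin ps /\ 0 < sin ph /\ 0 < sin (ph - ps).
Proof. intros H1 H2. repeat split; apply sin_gt_0; lra. Qed.

Lemma apex_radii_pos (a b ph ps : R) : b < a -> 0 < ps < ph -> ph < PI ->
  0 < (a - b) * sin ph / sin (ph - ps) /\ 0 < (a - b) * sin ps / sin (ph - ps).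
Proof.
  intros Hab H1 H2. destruct (sin_pos3 _ _ H1 H2) as [A [B D]].
  split; apply Rdiv_lt_0_compat; try assumption; apply Rmult_lt_0_compat; lra.
Qed.

Lemma apex_upper (a b ph ps : R) : b < a -> 0 < ps < ph -> ph < PI -> upper (apex a b ph ps).
Proof.
  intros Hab H1 H2. destruct (apex_radii_pos a b ph ps Hab H1 H2) as [A _].
  assert (U : upper (apex a b ph ps - RtoC b)%C).
  { rewrite apex_minus_b. apply upper_polar; [exact A | lra]. }
  unfold upper, Im in *. simpl in *. lra.
Qed.

Lemma arg_apex_a (a b ph ps : R) : b < a -> 0 < ps < ph -> ph < PI ->
  arg (apex a b ph ps - RtoC a)%C = ph.
Proof.
  intros Hab H1 H2. destruct (apex_radii_pos a b ph ps Hab H1 H2) as [_ A].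
  destruct (sin_pos3 _ _ H1 H2) as [_ [_ D]].
  rewrite apex_minus_a by lra. apply arg_polar; [exact A | lra].
Qed.

Lemma arg_apex_b (a b ph ps : R) : b < a -> 0 < ps < ph -> ph < PI ->
  arg (apex a b ph ps - RtoC b)%C = ps.
Proof.
  intros Hab H1 H2. destruct (apex_radii_pos a b ph ps Hab H1 H2) as [A _].
  rewrite apex_minus_b. apply arg_polar; [exact A | lra].
Qed.

(** Law of sines in the triangle with vertices [a], [b] and [z]. *)
Lemma apex_of_args (a b : R) (z : C) : b < a -> upper z ->
  0 < arg (z - RtoC b)%C < arg (z - RtoC a)%C /\
  arg (z - RtoC a)%C < PI /\
  z = apex a b (arg (z - RtoC a)%C) (arg (z - RtoC b)%C).
Proof.
  intros Hab H.
  assert (Ha := upper_minus_real z a H). assert (Hb := upper_minus_real z b H).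
  assert (Ea := polar_form _ Ha). assert (Eb := polar_form _ Hb).
  assert (Ra := upper_Cmod_pos _ Ha). assert (Rb := upper_Cmod_pos _ Hb).
  assert (Ba := arg_bounds _ Ha). assert (Bb := arg_bounds _ Hb).
  set (ph := arg (z - RtoC a)%C) in *. set (ps := arg (z - RtoC b)%C) in *.
  set (r := Cmod (z - RtoC a)%C) in *. set (s := Cmod (z - RtoC b)%C) in *.
  assert (Sp : 0 < sin ph) by (apply sin_gt_0; lra).
  assert (X1 := f_equal Re Ea). assert (Y1 := f_equal Im Ea).
  assert (X2 := f_equal Re Eb). assert (Y2 := f_equal Im Eb).
  rewrite re_scal_l in X1, X2. rewrite im_scal_l in Y1, Y2.
  unfold expi, Re, Im in X1, Y1, X2, Y2. simpl in X1, Y1, X2, Y2.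
  assert (K : s * sin (ph - ps) = (a - b) * sin ph).
  { rewrite sin_minus.
    transitivity (sin ph * (s * cos ps) - cos ph * (s * sin ps)); [ring|].
    replace (s * sin ps) with (r * sin ph) by lra.
    replace (s * cos ps) with (r * cos ph + (a - b)) by lra. ring. }
  assert (L : ps < ph).
  { apply Rnot_le_lt. intros L.
    assert (sin (ph - ps) <= 0).
    { replace (ph - ps) with (- (ps - ph)) by ring. rewrite sin_neg.
      assert (0 <= sin (ps - ph)) by (apply sin_ge_0; lra). lra. }
    assert (0 < (a - b) * sin ph) by (apply Rmult_lt_0_compat; lra).
    nra. }
  assert (D : 0 < sin (ph - ps)) by (apply sin_gt_0; lra).
  split; [lra|]. split; [lra|]. unfold apex.
  replace ((a - b) * sin ph / sin (ph - ps)) with s.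
  - rewrite <- Eb. ring.
  - apply Rmult_eq_reg_r with (sin (ph - ps)); [|lra]. rewrite K. field. lra.
Qed.

Lemma logk_apex (be a b ph ps : R) : b < a -> 0 < ps < ph -> ph < PI ->
  logk be a b (apex a b ph ps)
  = (logmod be (be * ph - ps) ph - (1 - be) * ln (a - b), be * ph - ps).
Proof.
  intros Hab H1 H2. destruct (apex_radii_pos a b ph ps Hab H1 H2) as [A B].
  destruct (sin_pos3 _ _ H1 H2) as [S1 [S2 S3]].
  unfold logk, clog. rewrite arg_apex_a, arg_apex_b, apex_minus_a, apex_minus_b by (lra || assumption).
  rewrite !Cmod_polar by lra. unfold logmod.
  replace (be * ph - (be * ph - ps)) with ps by ring.
  replace ((1 - be) * ph + (be * ph - ps)) with (ph - ps) by ring.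
  rewrite !ln_div, !ln_mult; try assumption; try lra; try (apply Rmult_lt_0_compat; lra).
  apply injective_projections; simpl; ring.
Qed.

(** The value of [logk] at the critical point, i.e. at the tip of the slit. *)
Definition tip_height (be a b : R) : R := slit_tip be - (1 - be) * ln (a - b).

(** The point of the level line [Im (logk z) = de] with [arg (z - a) = ph]. *)
Definition level_point (be a b de ph : R) : C := apex a b ph (be * ph - de).

Lemma level_point_upper (be a b de ph : R) : b < a -> phase_dom be de ph -> upper (level_point be a b de ph).
Proof. intros Hab [H1 [H2 H3]]. apply apex_upper; lra. Qed.

Lemma logk_level_point (be a b de ph : R) : b < a -> phase_dom be de ph ->
  logk be a b (level_point be a b de ph) = (logmod be de ph - (1 - be) * ln (a - b), de).
Proof.
  intros Hab [H1 [H2 H3]]. unfold level_point. rewrite logk_apex by lra.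
  now replace (be * ph - (be * ph - de)) with de by ring.
Qed.

Lemma upper_level_point (be a b : R) (z : C) : b < a -> upper z ->
  exists de ph, phase_dom be de ph /\ z = level_point be a b de ph.
Proof.
  intros Hab H. destruct (apex_of_args a b z Hab H) as [H1 [H2 E]].
  set (ph := arg (z - RtoC a)%C) in *. set (ps := arg (z - RtoC b)%C) in *.
  exists (be * ph - ps), ph. unfold level_point, phase_dom.
  replace (be * ph - (be * ph - ps)) with ps by ring.
  replace ((1 - be) * ph + (be * ph - ps)) with (ph - ps) by ring.
  repeat split; try lra. exact E.
Qed.

Lemma logk_inj (be a b : R) (z w : C) : 0 < be < 1 -> b < a -> upper z -> upper w ->
  logk be a b z = logk be a b w -> z = w.
Proof.
  intros Hb Hab Hz Hw E.
  destruct (upper_level_point be a b z Hab Hz) as [d1 [p1 [D1 ->]]].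
  destruct (upper_level_point be a b w Hab Hw) as [d2 [p2 [D2 ->]]].
  rewrite !logk_level_point in E by assumption. injection E as E1 E2. subst d2.
  f_equal. apply (logmod_inj be d1); try assumption. lra.
Qed.

Lemma phase_dom_strip (be de p : R) : 0 < be < 1 -> phase_dom be de p ->
  - ((1 - be) * PI) < de < be * PI.
Proof.
  intros Hb H. assert (P := phase_dom_pos _ _ _ H). destruct H as [H1 [H2 H3]].
  assert (be * p < be * PI) by (apply Rmult_lt_compat_l; lra).
  assert ((1 - be) * p < (1 - be) * PI) by (apply Rmult_lt_compat_l; lra). lra.
Qed.

(** The image of [logk]: a strip without a horizontal half-line. *)
Definition slit_strip (be a b : R) (w : C) : Prop :=
  - ((1 - be) * PI) < Im w < be * PI /\ (Im w = 0 -> tip_height be a b < Re w).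

Lemma logk_strip (be a b : R) (z : C) : 0 < be < 1 -> b < a -> upper z ->
  slit_strip be a b (logk be a b z).
Proof.
  intros Hb Hab Hz. destruct (upper_level_point be a b z Hab Hz) as [de [p [D ->]]].
  rewrite logk_level_point by assumption. unfold slit_strip, tip_height. cbn [Re Im fst snd].
  split; [now apply phase_dom_strip with p|]. intros ->.
  apply (slit_tip_lt_logmod be p Hb) in D. lra.
Qed.

Lemma logk_onto (be a b : R) (w : C) : 0 < be < 1 -> b < a -> slit_strip be a b w ->
  exists z, upper z /\ logk be a b z = w.
Proof.
  intros Hb Hab [H1 H2].
  destruct (logmod_onto be (Im w) (Re w + (1 - be) * ln (a - b)) Hb H1) as [p [D E]].
  { intros H. apply H2 in H. unfold tip_height in H. lra. }
  exists (level_point be a b (Im w) p). split; [now apply level_point_upper|].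
  rewrite logk_level_point by assumption. rewrite E. apply injective_projections; simpl; [|reflexivity].
  unfold Re. ring.
Qed.

Lemma tends_expi {T : Type} (F : (T -> Prop) -> Prop) {FF : Filter F} (y : T -> R) (x : R) :
  rtends F y x -> tends F (fun s => expi (y s)) (expi x).
Proof.
  intros H. apply tends_pair; try exact _; unfold expi; cbn [Re Im fst snd].
  - apply (rtends_comp F cos); [|exact H]. apply derivable_continuous_pt, derivable_pt_cos.
  - apply (rtends_comp F sin); [|exact H]. apply derivable_continuous_pt, derivable_pt_sin.
Qed.

Lemma tends_polar {T : Type} (F : (T -> Prop) -> Prop) {FF : Filter F} (r y : T -> R) (r0 x p : R) :
  rtends F r r0 -> rtends F y x ->
  tends F (fun s => RtoC p + RtoC (r s) * expi (y s))%C (RtoC p + RtoC r0 * expi x)%C.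
Proof.
  intros Hr Hy. apply tends_expi in Hy; [|exact _].
  assert (A := rtends_Re F _ _ Hy). assert (B := rtends_Im F _ _ Hy).
  apply tends_pair; try exact _; unfold expi, Re, Im in *; simpl in *.
  - apply rtends_plus; try exact _; [now apply rtends_const|].
    apply rtends_minus; try exact _; apply rtends_mult; try exact _; try assumption.
    now apply rtends_const.
  - apply rtends_plus; try exact _; [now apply rtends_const|].
    apply rtends_plus; try exact _; apply rtends_mult; try exact _; try assumption.
    now apply rtends_const.
Qed.

Lemma rtends_sin {T : Type} (F : (T -> Prop) -> Prop) {FF : Filter F} (y : T -> R) (x : R) :
  rtends F y x -> rtends F (fun s => sin (y s)) (sin x).
Proof. apply (rtends_comp F sin). apply derivable_continuous_pt, derivable_pt_sin. Qed.

Lemma tends_level_point {T : Type} (F : (T -> Prop) -> Prop) {FF : Filter F}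
    (be a b : R) (de ph : T -> R) (d0 p0 : R) :
  phase_dom be d0 p0 -> rtends F de d0 -> rtends F ph p0 ->
  tends F (fun s => level_point be a b (de s) (ph s)) (level_point be a b d0 p0).
Proof.
  intros D Hd Hp. destruct (phase_dom_sin _ _ _ D) as [_ [S _]].
  unfold level_point, apex.
  assert (Hs : rtends F (fun s => be * ph s - de s) (be * p0 - d0)).
  { apply rtends_minus; try exact _; [now apply rtends_scal | exact Hd]. }
  apply tends_polar; try exact _; [|exact Hs].
  apply rtends_mult; try exact _.
  - apply rtends_scal; try exact _. now apply rtends_sin.
  - apply rtends_inv; try exact _.
    + replace (p0 - (be * p0 - d0)) with ((1 - be) * p0 + d0) by ring. lra.
    + apply rtends_sin; try exact _. now apply rtends_minus.
Qed.

(** Two phases around that of [z] give values of [logmod] strictly below and above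
    the one at [z].  By continuity in [de] this persists on neighbouring level lines,
    where the intermediate value theorem finds the required preimage. *)
Lemma logk_open (be a b : R) (z : C) (eps : R) : 0 < be < 1 -> b < a -> upper z -> 0 < eps ->
  exists d, 0 < d /\ forall w, Cmod (w - logk be a b z)%C < d ->
    exists z', upper z' /\ Cmod (z' - z)%C < eps /\ logk be a b z' = w.
Proof.
  intros Hb Hab Hz Heps.
  destruct (upper_level_point be a b z Hab Hz) as [d0 [p0 [D ->]]].
  rewrite logk_level_point by assumption.
  assert (P := phase_dom_pos _ _ _ D).
  assert (G : locally (d0, p0) (fun s : R * R =>
    Cmod (level_point be a b (fst s) (snd s) - level_point be a b d0 p0)%C < eps)).
  { apply (tends_level_point (locally (d0, p0)) be a b fst snd d0 p0 D); [| |exact Heps].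
    - intros Q [e He]. exists e. intros s [Hs _]. apply He, Hs.
    - intros Q [e He]. exists e. intros s [_ Hs]. apply He, Hs. }
  destruct G as [e He].
  (* The window of arguments in which the preimage is sought: inside the
     domain, and within [e] of [p0]. *)
  destruct D as [H1 [H2 H3]].
  assert (D : phase_dom be d0 p0) by (repeat split; assumption).
  set (n := Rmin (e / 2) (Rmin (Rmin ((be * p0 - d0) / 2) (((1 - be) * p0 + d0) / 2)) ((PI - p0) / 2))).
  assert (E0 := cond_pos e).
  assert (Hn : 0 < n) by (unfold n; repeat apply Rmin_pos; lra).
  assert (N1 : n <= e / 2) by apply Rmin_l.
  assert (N2 : n <= (be * p0 - d0) / 2).
  { unfold n. eapply Rle_trans; [apply Rmin_r|]. eapply Rle_trans; [apply Rmin_l|]. apply Rmin_l. }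
  assert (N3 : n <= ((1 - be) * p0 + d0) / 2).
  { unfold n. eapply Rle_trans; [apply Rmin_r|]. eapply Rle_trans; [apply Rmin_l|]. apply Rmin_r. }
  assert (N4 : n <= (PI - p0) / 2).
  { unfold n. eapply Rle_trans; [apply Rmin_r|]. apply Rmin_r. }
  assert (B1 : be * n < 1 * n) by (apply Rmult_lt_compat_r; lra).
  assert (B2 : (1 - be) * n < 1 * n) by (apply Rmult_lt_compat_r; lra).
  assert (Dl : phase_dom be d0 (p0 - n)) by (repeat split; lra).
  assert (Dr : phase_dom be d0 (p0 + n)) by (apply phase_dom_up with p0; [assumption..|lra]).
  assert (L1 : logmod be d0 (p0 - n) < logmod be d0 p0) by (apply logmod_increasing; [assumption..|lra]).
  assert (L2 : logmod be d0 p0 < logmod be d0 (p0 + n)) by (apply logmod_increasing; [assumption..|lra]).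
  set (m := Rmin (logmod be d0 p0 - logmod be d0 (p0 - n)) (logmod be d0 (p0 + n) - logmod be d0 p0) / 2).
  assert (Hm : 0 < m).
  { unfold m. apply Rdiv_lt_0_compat; [apply Rmin_pos|]; lra. }
  assert (M1 : 2 * m <= logmod be d0 p0 - logmod be d0 (p0 - n)).
  { unfold m. assert (X := Rmin_l (logmod be d0 p0 - logmod be d0 (p0 - n)) (logmod be d0 (p0 + n) - logmod be d0 p0)). lra. }
  assert (M2 : 2 * m <= logmod be d0 (p0 + n) - logmod be d0 p0).
  { unfold m. assert (X := Rmin_r (logmod be d0 p0 - logmod be d0 (p0 - n)) (logmod be d0 (p0 + n) - logmod be d0 p0)). lra. }
  destruct (filter_and _ _ (proj1 (rtends_eps _ _ _) (logmod_continuity_de _ _ _ Dl) m Hm)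
    (proj1 (rtends_eps _ _ _) (logmod_continuity_de _ _ _ Dr) m Hm)) as [f Hf].
  set (d := Rmin (Rmin f m) n).
  assert (F0 := cond_pos f).
  exists d. split; [unfold d; repeat apply Rmin_pos; lra|]. intros w Hw.
  assert (Q1 : d <= f) by (unfold d; eapply Rle_trans; [apply Rmin_l|]; apply Rmin_l).
  assert (Q2 : d <= m) by (unfold d; eapply Rle_trans; [apply Rmin_l|]; apply Rmin_r).
  assert (Q3 : d <= n) by apply Rmin_r.
  set (r0 := logmod be d0 p0 - (1 - be) * ln (a - b)) in *.
  assert (X := re_le_Cmod (w - (r0, d0))%C). assert (Y := Im_le_Cmod (w - (r0, d0))%C).
  change (Re (w - (r0, d0))%C) with (Re w - r0) in X.
  change (Im (w - (r0, d0))%C) with (Im w - d0) in Y.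
  assert (Bf : ball d0 f (Im w)) by (change (Rabs (Im w - d0) < f); lra).
  destruct (Hf _ Bf) as [A1 A2].
  assert (X' : Rabs (Re w - r0) < m) by lra. assert (Y' : Rabs (Im w - d0) < n) by lra.
  apply Rabs_def2 in A1. apply Rabs_def2 in A2. apply Rabs_def2 in X'.
  assert (Y'' := Y'). apply Rabs_def2 in Y''.
  assert (Dl' : phase_dom be (Im w) (p0 - n)) by (repeat split; lra).
  assert (Dr' : phase_dom be (Im w) (p0 + n)) by (apply phase_dom_up with (p0 - n); [assumption..|lra]).
  destruct (logmod_intermediate be (Im w) (p0 - n) (p0 + n) (Re w + (1 - be) * ln (a - b)) Hb Dl' Dr')
    as [p [Hp [Dp Ep]]].
  { unfold r0 in *. lra. }
  exists (level_point be a b (Im w) p). split; [now apply level_point_upper|]. split.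
  - apply (He (Im w, p)). split.
    + change (Rabs (Im w - d0) < e). lra.
    + change (Rabs (p - p0) < e). apply Rabs_def1; lra.
  - rewrite logk_level_point by assumption. rewrite Ep.
    apply injective_projections; simpl; [|reflexivity]. unfold Re. ring.
Qed.

Lemma cderiv_clog_shift (z : C) (p : R) : upper z ->
  cderiv (fun w => clog (w - RtoC p)%C) z (/ (z - RtoC p))%C.
Proof.
  intros H. assert (F : Filter (locally z)) by apply locally_filter.
  replace (/ (z - RtoC p))%C with (/ (z - RtoC p) * (1 + 0))%C by ring.
  apply slope_comp with (f := clog) (y := fun w => (w - RtoC p)%C); try exact _.
  - apply tends_id.
  - apply (slope_plus _ _ (fun w => w) (fun _ => (- RtoC p)%C)); try exact _.
    + now apply slope_id.
    + now apply slope_const.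
  - apply cderiv_clog. now apply upper_minus_real.
Qed.

Definition dlogk (be a b : R) (z : C) : C :=
  (RtoC be * / (z - RtoC a) + RtoC (-1) * / (z - RtoC b))%C.

Lemma cderiv_logk (be a b : R) (z : C) : upper z ->
  cderiv (logk be a b) z (dlogk be a b z).
Proof.
  intros H. assert (F : Filter (locally z)) by apply locally_filter.
  unfold cderiv, logk, dlogk.
  apply slope_ext with (y := fun w => (RtoC be * clog (w - RtoC a) + RtoC (-1) * clog (w - RtoC b))%C);
    try exact _.
  - apply filter_forall. intros w. ring.
  - replace (RtoC be * clog (z - RtoC a) - clog (z - RtoC b))%C with
      (RtoC be * clog (z - RtoC a) + RtoC (-1) * clog (z - RtoC b))%C by ring.
    apply slope_plus; try exact _; apply slope_scal; try exact _; now apply cderiv_clog_shift.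
Qed.

(** The only critical point of [logk] is real, so [logk] has none in the upper
    half-plane. *)
Lemma dlogk_neq_0 (be a b : R) (z : C) : be < 1 -> upper z -> dlogk be a b z <> 0%C.
Proof.
  intros Hb H E.
  assert (Na := upper_neq_0 _ (upper_minus_real z a H)).
  assert (Nb := upper_neq_0 _ (upper_minus_real z b H)).
  assert (K : (RtoC be * (z - RtoC b) - (z - RtoC a))%C = 0%C).
  { transitivity (dlogk be a b z * ((z - RtoC a) * (z - RtoC b)))%C.
    - unfold dlogk. field. now split.
    - rewrite E. ring. }
  apply (f_equal Im) in K. unfold upper, Im in *. simpl in K. nra.
Qed.

(** * The conformal map and its inverse *)

(** The exponent and the two real singularities of the conformal map; the two
    relations between [a], [b] and [kappa] are what the Loewner equation uses. *)
Definition admissible (kappa be a b : R) : Prop :=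
  theta kappa = 1 - be /\ 2 / sqrt (1 - theta kappa) = a /\
  2 * sqrt (1 - theta kappa) = b /\
  0 < be < 1 /\ 0 < b < a /\ b = be * a /\ a * b = 4 /\ a + b = kappa.

Lemma admissible_exists (kappa : R) : 4 < kappa ->
  exists be a b, admissible kappa be a b.
Proof.
  intros Hk. set (q := sqrt (kappa ^ 2 - 16)).
  assert (P : 0 < kappa ^ 2 - 16) by nra.
  assert (Hq : 0 < q) by now apply sqrt_lt_R0.
  assert (Q2 : q * q = kappa ^ 2 - 16) by (apply sqrt_sqrt; lra).
  assert (Hqk : q < kappa) by nra.
  assert (E : theta kappa = 1 - ((kappa - q) / 4) ^ 2).
  { unfold theta. fold q.
    apply Rmult_eq_reg_r with (kappa + q); [|lra].
    transitivity (2 * q); [field; lra|].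
    transitivity (kappa + q - (kappa - q) * ((kappa ^ 2 - q * q) / 16)); [rewrite Q2|]; field. }
  assert (S : sqrt (((kappa - q) / 4) ^ 2) = (kappa - q) / 4).
  { rewrite <- Rsqr_pow2. apply sqrt_Rsqr. lra. }
  assert (K : 1 - theta kappa = ((kappa - q) / 4) ^ 2) by lra.
  assert (B : (kappa - q) * (kappa + q) = 16) by nra.
  assert (A : 8 / (kappa - q) = (kappa + q) / 2).
  { apply Rmult_eq_reg_r with (kappa - q); [|lra].
    transitivity 8; [field; lra | lra]. }
  exists (((kappa - q) / 4) ^ 2), ((kappa + q) / 2), ((kappa - q) / 2).
  unfold admissible. rewrite K, S.
  repeat split; try nra.
  rewrite <- A. field. lra.
Qed.

(** The second factor of the conformal map: it takes the strip onto the upper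
    half-plane, and the real axis onto the ray that carries the slit. *)
Definition strip_map (be : R) (w : C) : C := cexp (w + (0, (PI * (1 - be))%R))%C.

Definition strip (be : R) (w : C) : Prop := - ((1 - be) * PI) < Im w < be * PI.

Lemma strip_map_Im (be : R) (w : C) : strip be w ->
  0 < Im (w + (0, (PI * (1 - be))%R))%C < PI.
Proof. unfold strip, Im. simpl. lra. Qed.

Lemma clog_strip_map (be : R) (w : C) : strip be w ->
  clog (strip_map be w) = (w + (0, (PI * (1 - be))%R))%C.
Proof. intros H. now apply clog_cexp, strip_map_Im. Qed.

Lemma strip_map_inj (be : R) (w w' : C) : strip be w -> strip be w' ->
  strip_map be w = strip_map be w' -> w = w'.
Proof.
  intros H H' E. apply (f_equal clog) in E. rewrite !clog_strip_map in E by assumption.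
  apply (f_equal (fun z => z - (0, (PI * (1 - be))%R)))%C in E.
  replace w with (w + (0, (PI * (1 - be))%R) - (0, (PI * (1 - be))%R))%C by ring.
  rewrite E. ring.
Qed.

Lemma strip_map_upper (be : R) (w : C) : strip be w -> upper (strip_map be w).
Proof. intros H. now apply upper_cexp, strip_map_Im. Qed.

Lemma strip_map_onto (be : R) (v : C) : upper v ->
  exists w, strip be w /\ strip_map be w = v.
Proof.
  intros H. exists (clog v - (0, (PI * (1 - be))%R))%C. split.
  - assert (B := arg_bounds v H). unfold strip, clog, Im. simpl. lra.
  - unfold strip_map. rewrite <- (cexp_clog v H) at 2. f_equal. ring.
Qed.

Lemma strip_map_ray (be : R) (w : C) : 0 < be < 1 -> strip be w ->
  (ray (PI * (1 - be)) (strip_map be w) <-> Im w = 0).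
Proof.
  intros Hb H. split.
  - intros [r [Hr E]].
    assert (H0 : strip be (RtoC (ln r))).
    { unfold strip. simpl. assert (P := PI_RGT_0). split; nra. }
    assert (Q : strip_map be (RtoC (ln r)) = (RtoC r * expi (PI * (1 - be)))%C).
    { unfold strip_map, cexp. unfold Re, Im. simpl. now rewrite Rplus_0_r, Rplus_0_l, exp_ln. }
    rewrite <- Q in E. apply strip_map_inj in E; try assumption. rewrite E. reflexivity.
  - intros E. exists (exp (Re w)). split; [apply exp_pos|].
    unfold strip_map, cexp. unfold Re, Im in *. simpl. now rewrite E, Rplus_0_r, Rplus_0_l.
Qed.

Lemma strip_map_slit (be h : R) (w : C) : 0 < be < 1 -> strip be w ->
  (slit (PI * (1 - be)) (exp h) (strip_map be w) <-> Im w = 0 /\ Re w <= h).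
Proof.
  intros Hb H. split.
  - intros [r [Hr E]].
    assert (I : Im w = 0) by (apply (strip_map_ray be w Hb H); exists r; split; [lra | exact E]).
    split; [exact I|]. apply Rnot_lt_le. intros L. apply exp_increasing in L.
    apply (f_equal Cmod) in E. unfold strip_map, cexp in E. rewrite !Cmod_polar in E.
    + unfold Re in *. simpl in E. rewrite Rplus_0_r in E. lra.
    + lra.
    + left. apply exp_pos.
  - intros [I L]. exists (exp (Re w)). split.
    + split; [apply exp_pos|]. destruct L as [L|L]; [left; now apply exp_increasing | right; now rewrite L].
    + unfold strip_map, cexp. unfold Re, Im in *. simpl. now rewrite I, Rplus_0_r, Rplus_0_l.
Qed.

Lemma strip_map_slit_domain (be a b : R) (w : C) : 0 < be < 1 -> strip be w ->
  (setminus upper (slit (PI * (1 - be)) (exp (tip_height be a b))) (strip_map be w)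
   <-> slit_strip be a b w).
Proof.
  intros Hb H. unfold setminus. rewrite strip_map_slit by assumption. unfold slit_strip.
  split.
  - intros [_ N]. split; [exact H|]. intros E. apply Rnot_le_lt. intros L. now apply N.
  - intros [_ N]. split; [now apply strip_map_upper|]. intros [E L]. apply N in E. lra.
Qed.

Lemma strip_map_scale (be x : R) (w : C) :
  (RtoC (exp x) * strip_map be w)%C = strip_map be (w + RtoC x)%C.
Proof.
  unfold strip_map. rewrite <- cexp_real, <- cexp_plus. f_equal. ring.
Qed.

Lemma strip_add_real (be x : R) (w : C) : strip be w -> strip be (w + RtoC x)%C.
Proof. unfold strip, Im. simpl. now rewrite Rplus_0_r. Qed.

Lemma Im_add_real (x : R) (w : C) : Im (w + RtoC x)%C = Im w.
Proof. apply Rplus_0_r. Qed.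

Section Conformal_map.

Context {kappa be a b : R} (Adm : admissible kappa be a b).

Lemma be_range : 0 < be < 1. Proof. apply Adm. Qed.
Lemma b_lt_a : b < a. Proof. apply Adm. Qed.
Lemma theta_be : theta kappa = 1 - be. Proof. apply Adm. Qed.

Hint Resolve be_range b_lt_a : core.

Lemma kmap_strip_map (z : C) : upper z -> kmap kappa z = strip_map be (logk be a b z).
Proof.
  intros H. destruct Adm as [Et [Ea [Eb _]]]. unfold kmap. cbv zeta.
  rewrite Ea, Eb, cpower_cexp, Et.
  replace (1 - (1 - be)) with be by ring.
  unfold strip_map, logk.
  assert (N : cexp (clog (z - RtoC b)) = (z - RtoC b)%C) by now apply cexp_clog, upper_minus_real.
  assert (N0 := upper_neq_0 _ (upper_minus_real z b H)).
  rewrite <- N at 1.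
  assert (N1 : cexp (clog (z - RtoC b)) <> 0%C) by now rewrite N.
  replace (expi (PI * (1 - be))) with (cexp (0, (PI * (1 - be))%R)).
  2:{ unfold cexp. unfold Re, Im. simpl. rewrite exp_0. ring. }
  set (A := (RtoC be * clog (z - RtoC a))%C). set (B := clog (z - RtoC b)) in *.
  replace (A - B + (0, (PI * (1 - be))%R))%C with ((0, (PI * (1 - be))%R) + (A + - B))%C by ring.
  rewrite !cexp_plus.
  replace (cexp (- B)) with (/ cexp B)%C; [reflexivity|].
  assert (E : (cexp (- B) * cexp B)%C = 1%C).
  { rewrite <- cexp_plus. replace (- B + B)%C with (RtoC 0) by ring. apply cexp_0. }
  transitivity ((cexp (- B) * cexp B) * / cexp B)%C; [rewrite E; ring | field; exact N1].
Qed.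

Lemma logk_in_strip (z : C) : upper z -> strip be (logk be a b z).
Proof. intros H. now apply (logk_strip be a b z). Qed.

Lemma kmap_inj (z w : C) : upper z -> upper w -> kmap kappa z = kmap kappa w -> z = w.
Proof.
  intros Hz Hw. rewrite !kmap_strip_map by assumption. intros E.
  apply strip_map_inj in E; try now apply logk_in_strip.
  now apply logk_inj in E.
Qed.

Lemma cderiv_kmap (z : C) : upper z -> exists l, cderiv (kmap kappa) z l.
Proof.
  intros H. eexists.
  apply cderiv_ext with (f := fun w => strip_map be (logk be a b w)).
  { generalize (locally_upper z H). apply filter_imp. intros w Hw. now rewrite kmap_strip_map. }
  unfold cderiv, strip_map.
  apply slope_comp with (f := cexp) (y := fun w => (logk be a b w + (0, (PI * (1 - be))%R))%C).
  - apply locally_filter.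
  - apply tends_id.
  - apply slope_plus; [apply locally_filter | now apply cderiv_logk | apply slope_const; apply locally_filter].
  - apply cderiv_cexp.
Qed.

Lemma kmap_conformal :
  conformal_onto upper (setminus upper (slit (PI * (1 - be)) (exp (tip_height be a b)))) (kmap kappa).
Proof.
  split; [|split].
  - intros z Hz. destruct (cderiv_kmap z Hz) as [l Hl]. eapply cderiv_ex_derive, Hl.
  - apply kmap_inj.
  - intros w. split.
    + intros Hw. destruct (strip_map_onto be w (proj1 Hw)) as [v [Hv <-]].
      apply strip_map_slit_domain in Hw; auto.
      apply logk_onto in Hw; auto. destruct Hw as [z [Hz E]].
      exists z. split; [exact Hz|]. now rewrite kmap_strip_map, E.
    + intros [z [Hz <-]]. rewrite kmap_strip_map by assumption.
      apply strip_map_slit_domain; auto; [now apply logk_in_strip | now apply logk_strip].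
Qed.

(** ** Inverting [logk] *)

(** On the image of [logk] this is the inverse of [logk]. *)
Definition linv (w : C) : C := kinv kappa (strip_map be w).

Lemma kinv_kmap (z : C) : upper z -> kinv kappa (kmap kappa z) = z.
Proof.
  intros H. unfold kinv.
  assert (S := epsilon_spec (inhabits (RtoC 0))
    (fun z' => upper z' /\ kmap kappa z' = kmap kappa z) (ex_intro _ z (conj H eq_refl))).
  destruct S as [S1 S2]. now apply kmap_inj.
Qed.

Lemma linv_logk (z : C) : upper z -> linv (logk be a b z) = z.
Proof. intros H. unfold linv. rewrite <- kmap_strip_map by assumption. now apply kinv_kmap. Qed.

Section Inverse_along_filter.

Context {T : Type} (F : (T -> Prop) -> Prop) {FF : Filter F}.

(** Injectivity makes [linv] undo [logk], and [logk_open] then says both that [linv]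
    is continuous and that values near a value of [logk] are values of [logk]. *)
Lemma linv_tends (y : T -> C) (z : C) : upper z -> tends F y (logk be a b z) ->
  tends F (fun s => linv (y s)) z /\
  F (fun s => upper (linv (y s)) /\ logk be a b (linv (y s)) = y s).
Proof.
  intros Hz H.
  assert (G : forall eps, 0 < eps -> F (fun s => Cmod (linv (y s) - z)%C < eps /\
    upper (linv (y s)) /\ logk be a b (linv (y s)) = y s)).
  { intros eps Heps. destruct (logk_open be a b z eps be_range b_lt_a Hz Heps) as [d [Hd G]].
    generalize (H d Hd). apply filter_imp. intros s Hs.
    destruct (G _ Hs) as [z' [U [D E]]].
    rewrite <- E, linv_logk by assumption. now repeat split. }
  split.
  - intros eps Heps. generalize (G eps Heps). apply filter_imp. now intros s [Hs _].
  - generalize (G 1 Rlt_0_1). apply filter_imp. now intros s [_ Hs].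
Qed.

Lemma linv_slope (x y : T -> C) (x0 z l : C) : upper z -> tends F x x0 ->
  slope F x y x0 (logk be a b z) l ->
  slope F x (fun s => linv (y s)) x0 z (l / dlogk be a b z)%C.
Proof.
  intros Hz Hx H.
  assert (Hy := slope_tends F _ _ _ _ _ Hx H).
  destruct (linv_tends y z Hz Hy) as [L1 L2].
  apply slope_inverse with (f := logk be a b); [exact FF | | exact L1 | now apply cderiv_logk |].
  - apply dlogk_neq_0; [apply be_range | exact Hz].
  - apply slope_ext with (y := y); [exact FF| |exact H].
    revert L2. apply filter_imp. intros s [_ E]. now rewrite E.
Qed.

End Inverse_along_filter.

(** ** The maps [g t] *)

(** Multiplication by [(1 - t)^(theta / 2)] read in the logarithmic coordinate. *)
Definition shift (t : R) : R := (1 - be) / 2 * ln (1 - t).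

Lemma gmap_linv (t : R) (z : C) : upper z ->
  gmap kappa t z = (RtoC (sqrt (1 - t)) * linv (logk be a b z + RtoC (shift t)))%C.
Proof.
  intros H. unfold gmap, linv. rewrite kmap_strip_map by assumption.
  unfold Rpower. rewrite strip_map_scale, theta_be. reflexivity.
Qed.

Lemma scaled_kmap_domain (t : R) (z : C) : upper z ->
  (setminus upper (slit (PI * (1 - be)) (exp (tip_height be a b)))
     (RtoC (Rpower (1 - t) (theta kappa / 2)) * kmap kappa z)%C <->
   slit_strip be a b (logk be a b z + RtoC (shift t))%C).
Proof.
  intros H. rewrite kmap_strip_map by assumption. unfold Rpower.
  rewrite strip_map_scale, theta_be.
  apply strip_map_slit_domain; auto. apply strip_add_real. now apply logk_in_strip.
Qed.

Lemma shift_0 : shift 0 = 0.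
Proof. unfold shift. rewrite Rminus_0_r, ln_1. ring. Qed.

Lemma shift_decreasing (s t : R) : s < t < 1 -> shift t < shift s.
Proof.
  intros H. destruct be_range. unfold shift. apply Rmult_lt_compat_l; [lra|]. apply ln_increasing; lra.
Qed.

Lemma shift_onto (x : R) : x < 0 -> exists s, 0 < s < 1 /\ shift s = x.
Proof.
  intros H. destruct be_range. exists (1 - exp (2 / (1 - be) * x)).
  assert (P := exp_pos (2 / (1 - be) * x)).
  assert (L : exp (2 / (1 - be) * x) < 1).
  { apply Rlt_le_trans with (exp 0); [apply exp_increasing | rewrite exp_0; lra].
    assert (0 < 2 / (1 - be)) by (apply Rdiv_lt_0_compat; lra).
    rewrite <- (Rmult_0_r (2 / (1 - be))). apply Rmult_lt_compat_l; assumption. }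
  split; [lra|]. unfold shift.
  replace (1 - (1 - exp (2 / (1 - be) * x))) with (exp (2 / (1 - be) * x)) by ring.
  rewrite ln_exp. field. lra.
Qed.

(** In the logarithmic coordinate the curve is the real half-line beyond the tip,
    timed so that [shift s] brings [gamma s] back to the tip. *)
Definition traces (gamma : R -> C) : Prop :=
  forall s, 0 < s < 1 ->
    upper (gamma s) /\ logk be a b (gamma s) = RtoC (tip_height be a b - shift s).

(** Translation by [shift t] moves the values of [logk] to the left; a value is swallowed
    by the slit when it is real and passed the tip before time [t], i.e. when it is the
    value at a point of the arc. *)
Lemma arc_domain (gamma : R -> C) (t : R) (z : C) : traces gamma -> 0 <= t < 1 ->
  (setminus upper (arc gamma t) z <->
   upper z /\ slit_strip be a b (logk be a b z + RtoC (shift t))%C).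
Proof.
  intros HG Ht. unfold setminus. split; intros [Hz H]; (split; [exact Hz|]);
    assert (S := logk_strip be a b z be_range b_lt_a Hz); destruct S as [S1 S2].
  - split; [apply (strip_add_real be), S1|]. intros E.
    assert (E' : Im (logk be a b z) = 0) by now rewrite Im_add_real in E.
    specialize (S2 E'). apply Rnot_le_lt. intros L. apply H.
    destruct (shift_onto (tip_height be a b - Re (logk be a b z))) as [s [Hs Es]]; [lra|].
    exists s. change (Re (logk be a b z + RtoC (shift t))%C) with (Re (logk be a b z) + shift t) in L.
    split.
    + split; [lra|]. apply Rnot_lt_le. intros L'.
      assert (shift s < shift t) by (apply shift_decreasing; lra). lra.
    + destruct (HG s Hs) as [U K]. apply (logk_inj be a b); auto.
      rewrite K, Es. apply injective_projections; [|now symmetry].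
      simpl. unfold Re. ring.
  - intros [s [Hs <-]]. destruct (HG s ltac:(lra)) as [U K].
    destruct H as [_ H]. rewrite K in H. unfold Re, Im in H. simpl in H.
    specialize (H ltac:(lra)).
    assert (shift t <= shift s); [|lra].
    destruct (proj2 Hs) as [L| ->]; [left; apply shift_decreasing; lra | lra].
Qed.

Lemma arc_domain_pre (gamma : R -> C) (t : R) (z : C) : traces gamma -> 0 <= t < 1 ->
  setminus upper (arc gamma t) z ->
  exists w, upper w /\ logk be a b w = (logk be a b z + RtoC (shift t))%C
    /\ gmap kappa t z = (RtoC (sqrt (1 - t)) * w)%C.
Proof.
  intros HG Ht H. apply arc_domain in H; [|assumption..]. destruct H as [Hz H].
  apply logk_onto in H; auto. destruct H as [w [Hw E]].
  exists w. repeat split; try assumption. rewrite gmap_linv, <- E, linv_logk by assumption. reflexivity.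
Qed.

Lemma upper_scale (r : R) (z : C) : 0 < r -> upper z -> upper (RtoC r * z)%C.
Proof. intros Hr Hz. unfold upper in *. rewrite im_scal_l. now apply Rmult_lt_0_compat. Qed.

Lemma gmap_conformal (gamma : R -> C) (t : R) : traces gamma -> 0 <= t < 1 ->
  conformal_onto (setminus upper (arc gamma t)) upper (gmap kappa t).
Proof.
  intros HG Ht. assert (Hs : 0 < sqrt (1 - t)) by (apply sqrt_lt_R0; lra).
  assert (Hs' : RtoC (sqrt (1 - t)) <> 0%C) by (intros E; apply RtoC_inj in E; lra).
  split; [|split].
  - intros z H. destruct (arc_domain_pre gamma t z HG Ht H) as [w [Hw [E Eg]]].
    assert (FF : Filter (locally z)) by apply locally_filter.
    eapply cderiv_ex_derive.
    apply cderiv_ext with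
      (f := fun v => (RtoC (sqrt (1 - t)) * linv (logk be a b v + RtoC (shift t)))%C).
    { generalize (locally_upper z (proj1 H)). apply filter_imp. intros v Hv. now rewrite gmap_linv. }
    unfold cderiv. rewrite <- E, linv_logk by assumption.
    apply slope_scal; [exact FF|].
    apply linv_slope; [exact FF | exact Hw | apply tends_id |].
    rewrite E. apply slope_plus; [exact FF | apply cderiv_logk, H | apply slope_const, FF].
  - intros z z' H H'.
    destruct (arc_domain_pre gamma t z HG Ht H) as [w [Hw [E ->]]].
    destruct (arc_domain_pre gamma t z' HG Ht H') as [w' [Hw' [E' ->]]].
    intros Q. assert (w = w').
    { transitivity (/ RtoC (sqrt (1 - t)) * (RtoC (sqrt (1 - t)) * w))%C; [field; exact Hs'|].
      rewrite Q. field. exact Hs'. }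
    subst w'. rewrite E in E'.
    apply (logk_inj be a b); auto; [apply H | apply H' |].
    replace (logk be a b z) with (logk be a b z + RtoC (shift t) - RtoC (shift t))%C by ring.
    rewrite E'. ring.
  - intros v. split.
    + intros Hv. set (w := (RtoC (/ sqrt (1 - t)) * v)%C).
      assert (Hw : upper w) by (apply upper_scale; [now apply Rinv_0_lt_compat | exact Hv]).
      assert (S := logk_strip be a b w be_range b_lt_a Hw).
      assert (S' : slit_strip be a b (logk be a b w + RtoC (- shift t))%C).
      { destruct S as [S1 S2]. split; [now apply (strip_add_real be)|]. intros I.
        assert (I' : Im (logk be a b w) = 0) by now rewrite Im_add_real in I.
        specialize (S2 I').
        change (Re (logk be a b w + RtoC (- shift t))%C) with (Re (logk be a b w) + - shift t).
        assert (shift t <= 0); [|lra]. rewrite <- shift_0.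
        destruct (proj1 Ht) as [L| <-]; [left; now apply shift_decreasing | lra]. }
      apply logk_onto in S'; auto. destruct S' as [z [Hz Ez]].
      assert (Ew : (logk be a b z + RtoC (shift t))%C = logk be a b w).
      { rewrite Ez, RtoC_opp. ring. }
      assert (D : setminus upper (arc gamma t) z).
      { apply arc_domain; [assumption..|]. rewrite Ew. now split. }
      exists z. split; [exact D|].
      rewrite gmap_linv, Ew, linv_logk by assumption. unfold w. rewrite RtoC_inv by lra.
      field. exact Hs'.
    + intros [z [H <-]]. destruct (arc_domain_pre gamma t z HG Ht H) as [w [Hw [_ ->]]].
      now apply upper_scale.
Qed.

(** Writing [g = sigma w] with [sigma = sqrt (1 - t)], the logarithmic derivative
    of [k] gives [w' = (w - a) (w - b) / (2 sigma^2 (w - kappa))], and the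
    relations [a b = 4], [a + b = kappa] turn [sigma' w + sigma w'] into
    [2 / (g - kappa sigma)]. *)
Lemma gmap_flow (gamma : R -> C) : traces gamma ->
  loewner_flow (fun t => kappa * sqrt (1 - t)) 1 gamma (gmap kappa).
Proof.
  intros HG. split.
  - intros z Hz. rewrite gmap_linv, shift_0 by assumption.
    rewrite Cplus_0_r, linv_logk by assumption. rewrite Rminus_0_r, sqrt_1. ring.
  - intros t z Ht H. destruct (arc_domain_pre gamma t z HG Ht H) as [w [Hw [E Eg]]].
    set (sg := sqrt (1 - t)) in *.
    assert (Hs : 0 < sg) by (apply sqrt_lt_R0; lra).
    assert (Hs2 : sg * sg = 1 - t) by (apply sqrt_sqrt; lra).
    assert (Hs' : RtoC sg <> 0%C) by (intros Q; apply RtoC_inj in Q; lra).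
    split.
    { intros Q. apply (f_equal Im) in Q. rewrite Eg, im_scal_l in Q. unfold upper in Hw.
      change (Im (RtoC (kappa * sg))) with 0 in Q.
      assert (0 < sg * Im w) by (apply Rmult_lt_0_compat; assumption). lra. }
    apply derive_on_slope.
    assert (S1 : slope (on (fun s => 0 <= s < 1) t) RtoC (fun s => RtoC (sqrt (1 - s)))
      (RtoC t) (RtoC sg) (RtoC (- / (2 * sg)))).
    { apply slope_real. auto_derive; [lra|]. fold sg. unfold sg, Rminus. field.
      fold (Rminus 1 t). fold sg. lra. }
    assert (S2 : slope (on (fun s => 0 <= s < 1) t) RtoC (fun s => RtoC (shift s))
      (RtoC t) (RtoC (shift t)) (RtoC (- ((1 - be) / (2 * (sg * sg)))))).
    { apply slope_real. rewrite Hs2. unfold shift. auto_derive; [lra|]. field. lra. }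
    assert (S3 : slope (on (fun s => 0 <= s < 1) t) RtoC
      (fun s => linv (logk be a b z + RtoC (shift s))%C) (RtoC t) w
      ((0 + RtoC (- ((1 - be) / (2 * (sg * sg))))) / dlogk be a b w)%C).
    { apply linv_slope; [exact _ | exact Hw | apply tends_RtoC_on |].
      rewrite E. apply slope_plus; [exact _ | apply slope_const; exact _ | exact S2]. }
    assert (S4 := slope_mult _ _ _ _ _ _ _ _ _ (tends_RtoC_on _ t) S1 S3).
    cbv beta in S4. rewrite <- Eg in S4.
    eapply slope_ext; [exact _| |].
    2:{ match type of S4 with slope _ _ _ _ _ ?l =>
          replace (2 / (gmap kappa t z - RtoC (kappa * sg)))%C with l; [exact S4|] end.
        rewrite Eg.
        assert (Na := upper_neq_0 _ (upper_minus_real w a Hw)).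
        assert (Nb := upper_neq_0 _ (upper_minus_real w b Hw)).
        assert (Nk := upper_neq_0 _ (upper_minus_real w kappa Hw)).
        destruct Adm as [_ [_ [_ [Hb [Hab [Eb [Eab Ek]]]]]]].
        assert (Ht' : RtoC (1 - be) <> 0%C) by (intros Q; apply RtoC_inj in Q; lra).
        (* The partial fractions of [dlogk] recombined; its zero is [kappa]. *)
        assert (ED : dlogk be a b w =
          (- RtoC (1 - be) * (w - RtoC kappa) / ((w - RtoC a) * (w - RtoC b)))%C).
        { unfold dlogk. rewrite <- Ek, RtoC_minus, RtoC_plus.
          assert (Ea' : RtoC a <> 0%C) by (intros Q; apply RtoC_inj in Q; lra).
          rewrite Eb, RtoC_mult in *. field. now split. }
        rewrite ED, RtoC_opp, RtoC_opp, RtoC_inv, RtoC_div, !RtoC_mult by nra.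
        assert (EQ : ((w - RtoC a) * (w - RtoC b))%C = (w * w - RtoC kappa * w + 4)%C).
        { rewrite <- Ek, RtoC_plus. change (RtoC 4) with (RtoC (IZR 4)). rewrite <- Eab, RtoC_mult. ring. }
        transitivity (- / (2 * RtoC sg) * w + / (2 * RtoC sg) *
          (((w - RtoC a) * (w - RtoC b)) / (w - RtoC kappa)))%C.
        - field. repeat split; assumption.
        - rewrite EQ. field. repeat split; try assumption.
          replace (RtoC sg * w - RtoC kappa * RtoC sg)%C with (RtoC sg * (w - RtoC kappa))%C by ring.
          now apply Cmult_neq_0. }
    apply filter_forall. intros s. rewrite gmap_linv by apply H. reflexivity.
Qed.

End Conformal_map.

(** * The trace *)

Section Trace.

Context {kappa be a b : R} (Adm : admissible kappa be a b).

Definition trace_curve (t : R) : C :=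
  if Rle_dec t 0 then RtoC kappa
  else if Rle_dec 1 t then RtoC b
  else linv (kappa := kappa) (be := be) (RtoC (tip_height be a b - shift (be := be) t)).

Lemma tip_height_slit_strip (x : R) : 0 < x -> slit_strip be a b (RtoC (tip_height be a b + x)).
Proof.
  intros Hx. assert (B := be_range Adm). assert (P := PI_RGT_0).
  unfold slit_strip. simpl. split; [split; nra | intros _; lra].
Qed.

Lemma shift_neg (t : R) : 0 < t < 1 -> shift (be := be) t < 0.
Proof. intros H. rewrite <- (shift_0 (be := be)). now apply (shift_decreasing Adm). Qed.

Lemma trace_curve_inner (t : R) : 0 < t < 1 ->
  trace_curve t = linv (kappa := kappa) (be := be) (RtoC (tip_height be a b - shift (be := be) t)).
Proof. intros H. unfold trace_curve. destruct (Rle_dec t 0), (Rle_dec 1 t); lra || reflexivity. Qed.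

Lemma trace_curve_traces : traces (be := be) (a := a) (b := b) trace_curve.
Proof.
  intros t H. assert (N := shift_neg t H).
  destruct (logk_onto be a b (RtoC (tip_height be a b + - shift (be := be) t)) (be_range Adm) (b_lt_a Adm)
    (tip_height_slit_strip (- shift (be := be) t) ltac:(lra))) as [z [Hz E]].
  rewrite trace_curve_inner by assumption. unfold Rminus.
  rewrite <- E, (linv_logk Adm) by assumption. now split.
Qed.

Lemma trace_curve_level_point (t : R) : 0 < t < 1 ->
  exists p, phase_dom be 0 p /\ logmod be 0 p = slit_tip be - shift (be := be) t /\
    trace_curve t = level_point be a b 0 p /\ arg (trace_curve t - RtoC a)%C = p /\
    arg (trace_curve t - RtoC b)%C = be * p.
Proof.
  intros H. destruct (trace_curve_traces t H) as [U K].
  destruct (upper_level_point be a b _ (b_lt_a Adm) U) as [de [p [D E]]].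
  rewrite E, logk_level_point in K by (try apply (b_lt_a Adm); assumption).
  injection K as K1 K2. subst de. exists p. unfold tip_height in K1. rewrite E.
  assert (D' := D). destruct D' as [D1 [D2 D3]].
  assert (Ba := b_lt_a Adm).
  repeat split; try assumption; [lra| |].
  - apply arg_apex_a; lra.
  - unfold level_point. rewrite arg_apex_b by lra. ring.
Qed.

(** The argument [ph] of the trace, its natural parameter: it increases from 0 to [PI]. *)
Definition phase (t : R) : R := arg (trace_curve t - RtoC a)%C.

Lemma trace_curve_phase (t : R) : 0 < t < 1 ->
  phase_dom be 0 (phase t) /\ logmod be 0 (phase t) = slit_tip be - shift (be := be) t /\
  trace_curve t = level_point be a b 0 (phase t) /\
  arg (trace_curve t - RtoC b)%C = be * phase t.
Proof.
  intros H. destruct (trace_curve_level_point t H) as [p [D [L [E [A B]]]]].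
  unfold phase. rewrite A. exact (conj D (conj L (conj E B))).
Qed.

Lemma shift_slope (t : R) : t < 1 ->
  is_derive (shift (be := be)) t (- ((1 - be) / (2 * (1 - t)))).
Proof. intros H. unfold shift. auto_derive; [lra|]. field. lra. Qed.

Lemma phase_at_0 : filterlim phase (at_right 0) (at_right 0).
Proof.
  intros P [e He]. unfold filtermap.
  set (q := Rmin e 1 / 2).
  assert (E0 := cond_pos e).
  assert (Q1 := Rmin_l e 1). assert (Q2 := Rmin_r e 1).
  assert (Hq : 0 < q) by (unfold q; apply Rdiv_lt_0_compat; [apply Rmin_pos; lra | lra]).
  assert (P3 := PI2_1). assert (B := be_range Adm).
  assert (Dq : phase_dom be 0 q) by (apply phase_dom_0; [exact B | unfold q in *; lra]).
  assert (L := slit_tip_lt_logmod be q B Dq).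
  assert (Cs : rtends (at_right 0) (shift (be := be)) 0).
  { assert (X : continuity_pt (shift (be := be)) 0).
    { apply ex_derive_continuity_pt. eexists. apply shift_slope. lra. }
    generalize (rtends_comp (at_right 0) _ _ _ X (rtends_within _ 0)). now rewrite shift_0. }
  assert (Pe : 0 < logmod be 0 q - slit_tip be) by lra.
  generalize (filter_and _ _ (proj1 (rtends_eps _ _ _) Cs _ Pe) (at_right_lt 0 1 Rlt_0_1)).
  apply filter_imp. intros t [A Ht]. destruct (trace_curve_phase t Ht) as [D [Lt _]].
  assert (PP := phase_dom_pos _ _ _ D).
  assert (phase t < q).
  { apply (logmod_lt_iff be 0); try assumption. rewrite Lt. apply Rabs_def2 in A. lra. }
  apply He; [|lra]. change (Rabs (phase t - 0) < e). rewrite Rminus_0_r, Rabs_right by lra.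
  unfold q in *. lra.
Qed.

Lemma phase_at_1 : filterlim phase (at_left 1) (at_left PI).
Proof.
  intros P [e He]. unfold filtermap.
  set (q := PI - Rmin e 1 / 2).
  assert (E0 := cond_pos e).
  assert (Q1 := Rmin_l e 1). assert (Q2 := Rmin_r e 1).
  assert (Q3 : 0 < Rmin e 1) by (apply Rmin_pos; lra).
  assert (P3 := PI2_1). assert (B := be_range Adm).
  assert (Dq : phase_dom be 0 q) by (apply phase_dom_0; [exact B | unfold q in *; lra]).
  assert (L := slit_tip_lt_logmod be q B Dq).
  destruct (shift_onto Adm (slit_tip be - logmod be 0 q)) as [s [Hs Es]]; [lra|].
  generalize (at_left_gt 1 s (proj2 Hs)). apply filter_imp. intros t Ht.
  assert (Ht' : 0 < t < 1) by lra.
  destruct (trace_curve_phase t Ht') as [D [Lt _]].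
  assert (PP := phase_dom_pos _ _ _ D).
  assert (q < phase t).
  { apply (logmod_lt_iff be 0); try assumption. rewrite Lt.
    assert (X := shift_decreasing Adm s t ltac:(lra)). lra. }
  apply He; [|lra]. change (Rabs (phase t - PI) < e). unfold q in *.
  apply Rabs_def1; lra.
Qed.

Lemma admissible_relations :
  0 < be < 1 /\ 0 < b < a /\ b = be * a /\ kappa = a + b.
Proof. destruct Adm as [_ [_ [_ [H1 [H2 [H3 [_ H4]]]]]]]. repeat split; lra. Qed.

(** The ratio of sines tends to [1 / (1 - be)], and [b + (a - b) / (1 - be) = b + a]. *)
Lemma level_point_at_0 : tends (at_right 0) (level_point be a b 0) (RtoC kappa).
Proof.
  destruct admissible_relations as [B [Hab [Eb Ek]]].
  assert (I : rtends (at_right 0) (fun s => s) 0) by apply rtends_within.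
  apply tends_ext with (y := fun p => (RtoC b + RtoC ((a - b) * ((sin (1 * p) / p) *
      / (sin ((1 - be) * p) / p))) * expi (be * p))%C).
  - exact _.
  - generalize (at_right_lt 0 PI PI_RGT_0). apply filter_imp. intros p Hp.
    destruct (phase_dom_sin be 0 p) as [_ [S _]]; [now apply phase_dom_0|]. rewrite Rplus_0_r in S.
    unfold level_point, apex. rewrite Rmult_1_l, Rminus_0_r.
    replace (p - be * p) with ((1 - be) * p) by ring.
    do 3 f_equal. field. lra.
  - replace (RtoC kappa) with (RtoC b + RtoC ((a - b) * (1 * / (1 - be))) * expi (be * 0))%C.
    + apply tends_polar; try exact _.
      * apply rtends_scal; try exact _. apply rtends_mult; try exact _; [apply sinc_limit|].
        apply rtends_inv; try exact _; [lra | apply sinc_limit].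
      * apply rtends_scal; try exact _. exact I.
    + unfold expi. rewrite Rmult_0_r, cos_0, sin_0.
      replace ((a - b) * (1 * / (1 - be))) with a by (rewrite Eb; field; lra).
      rewrite Ek. apply injective_projections; simpl; ring.
Qed.

Lemma level_point_at_PI : tends (at_left PI) (level_point be a b 0) (RtoC b).
Proof.
  destruct admissible_relations as [B [Hab [Eb Ek]]].
  assert (I : rtends (at_left PI) (fun s => s) PI) by apply rtends_within.
  assert (P := PI_RGT_0).
  unfold level_point, apex.
  assert (Hs : rtends (at_left PI) (fun p => be * p - 0) (be * PI - 0)).
  { apply rtends_minus; try exact _; [apply rtends_scal; try exact _; exact I | apply rtends_const; exact _]. }
  replace (RtoC b) with (RtoC b + RtoC ((a - b) * sin PI / sin (PI - (be * PI - 0)))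
    * expi (be * PI - 0))%C at 1.
  - apply tends_polar; try exact _; [|exact Hs].
    apply rtends_mult; try exact _.
    + apply rtends_scal; try exact _. apply rtends_sin; try exact _. exact I.
    + apply rtends_inv; try exact _.
      * assert (0 < sin (PI - (be * PI - 0))) by (apply sin_gt_0; nra). lra.
      * apply rtends_sin; try exact _. apply rtends_minus; try exact _; assumption.
  - rewrite sin_PI, Rmult_0_r. unfold Rdiv. rewrite Rmult_0_l. ring.
Qed.

(** Inside (0, 1) this is continuity of [linv]; at the two ends the curve is followed
    through its phase. *)
Lemma trace_curve_continuous : continuous_on (fun t => 0 <= t <= 1) trace_curve.
Proof.
  intros t Ht. assert (FF : Filter (within (fun t => 0 <= t <= 1) (locally t))) by apply within_filter, locally_filter.
  apply filterlim_tends; [exact FF|].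
  destruct (Req_dec t 0) as [->|N0]; [|destruct (Req_dec t 1) as [->|N1]].
  - assert (G0 : trace_curve 0 = RtoC kappa) by (unfold trace_curve; destruct Rle_dec; [reflexivity | lra]).
    rewrite G0. intros eps Heps.
    assert (L : at_right 0 (fun s => Cmod (level_point be a b 0 (phase s) - RtoC kappa)%C < eps))
      by exact (phase_at_0 _ (level_point_at_0 eps Heps)).
    generalize (filter_and _ _ L (at_right_lt 0 1 Rlt_0_1)). unfold at_right, within, filtermap.
    apply filter_imp. intros s Hs Ds. destruct (Req_dec s 0) as [->|N].
    + now rewrite G0, Cmod_minus_self.
    + destruct (Hs ltac:(lra)) as [H1 H2].
      destruct (trace_curve_phase s H2) as [_ [_ [-> _]]]. exact H1.
  - assert (G1 : trace_curve 1 = RtoC b).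
    { unfold trace_curve. destruct (Rle_dec 1 0); [lra|]. destruct Rle_dec; [reflexivity | lra]. }
    rewrite G1. intros eps Heps.
    assert (L : at_left 1 (fun s => Cmod (level_point be a b 0 (phase s) - RtoC b)%C < eps))
      by exact (phase_at_1 _ (level_point_at_PI eps Heps)).
    generalize (filter_and _ _ L (at_left_gt 1 0 Rlt_0_1)). unfold at_left, within, filtermap.
    apply filter_imp. intros s Hs Ds. destruct (Req_dec s 1) as [->|N].
    + now rewrite G1, Cmod_minus_self.
    + destruct (Hs ltac:(lra)) as [H1 H2].
      destruct (trace_curve_phase s H2) as [_ [_ [-> _]]]. exact H1.
  - assert (Ht' : 0 < t < 1) by lra.
    destruct (trace_curve_traces t Ht') as [U K].
    apply tends_ext with (y := fun s => linv (kappa := kappa) (be := be)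
      (RtoC (tip_height be a b - shift (be := be) s))).
    + exact FF.
    + apply filter_le_within. assert (Hd : 0 < Rmin t (1 - t)) by (apply Rmin_pos; lra).
      exists (mkposreal _ Hd). intros s Hs. change (Rabs (s - t) < Rmin t (1 - t)) in Hs.
      assert (M1 := Rmin_l t (1 - t)). assert (M2 := Rmin_r t (1 - t)).
      apply Rabs_def2 in Hs. symmetry. apply trace_curve_inner. lra.
    + apply (linv_tends Adm); [exact FF | exact U|]. rewrite K.
      apply tends_pair; [exact FF| |exact (rtends_const _ 0)].
      cbn [Re RtoC fst]. apply rtends_minus; try exact FF; [apply rtends_const; exact FF|].
      apply rtends_comp; [|apply rtends_within].
      apply ex_derive_continuity_pt. eexists. apply shift_slope. lra.
Qed.

(** The argument at [b] is exactly [be] times the phase. *)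
Lemma trace_angle_at_1 : angle_right trace_curve (at_left 1) b (PI * be).
Proof.
  unfold angle_right.
  apply (rtends_ext (at_left 1) (fun t => be * phase t)).
  - generalize (at_left_gt 1 0 Rlt_0_1). apply filter_imp. intros t Ht.
    now destruct (trace_curve_phase t Ht) as [_ [_ [_ ->]]].
  - rewrite Rmult_comm. apply rtends_scal; [exact _|].
    apply (filterlim_comp _ _ _ phase (fun p => p) _ _ _ phase_at_1). apply rtends_within.
Qed.

(** Since [a - b = (1 - be) a] and [sin ((1 - be) p)] expands as
    [sin (p - be p)], the real part of [level_point 0 p - kappa] is proportional to the
    function estimated here, whose derivative is
    [- (1 - be^2) sin p sin (be p)]; so it is smaller than the imaginary part
    by a factor [O(p)]. *)
Lemma angle_defect (p : R) : 0 < p < PI / 2 ->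
  Rabs (cos p * sin (be * p) - be * sin p * cos (be * p)) <= p * (sin p * sin (be * p)).
Proof.
  intros Hp. destruct admissible_relations as [B _]. assert (P := PI_RGT_0).
  destruct (MVT_gen (fun x => cos x * sin (be * x) - be * sin x * cos (be * x)) 0 p
    (fun x => - ((1 - be ^ 2) * (sin x * sin (be * x))))) as [c [Hc E]].
  - intros x _. auto_derive; [easy|]. ring.
  - intros x _. apply ex_derive_continuity_pt. auto_derive. easy.
  - rewrite Rmin_left, Rmax_right in Hc by lra.
    rewrite Rmult_0_r, sin_0 in E. rewrite Rmult_0_r, Rmult_0_r, Rmult_0_l, !Rminus_0_r in E.
    rewrite E.
    assert (Sc : 0 <= sin c) by (apply sin_ge_0; lra).
    assert (Bc : 0 <= be * c <= be * p) by (split; [apply Rmult_le_pos; lra | apply Rmult_le_compat_l; lra]).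
    assert (Bp : be * p <= 1 * p) by (apply Rmult_le_compat_r; lra).
    assert (Sb : 0 <= sin (be * c)) by (apply sin_ge_0; lra).
    assert (M1 : sin c <= sin p) by (apply sin_incr_1; lra).
    assert (M2 : sin (be * c) <= sin (be * p)) by (apply sin_incr_1; lra).
    assert (M : sin c * sin (be * c) <= sin p * sin (be * p)) by (apply Rmult_le_compat; lra).
    assert (M0 : 0 <= sin c * sin (be * c)) by (apply Rmult_le_pos; lra).
    assert (K : 0 <= 1 - be ^ 2 <= 1) by (split; nra).
    rewrite Rabs_mult, Rabs_Ropp, (Rabs_right p), Rabs_right by (try apply Rle_ge, Rmult_le_pos; lra).
    rewrite Rmult_comm. apply Rmult_le_compat_l; [lra|].
    apply Rle_trans with (1 * (sin c * sin (be * c))); [apply Rmult_le_compat_r|]; lra.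
Qed.

Lemma trace_angle_at_0 : angle_right trace_curve (at_right 0) kappa (PI / 2).
Proof.
  unfold angle_right. destruct admissible_relations as [B [Hab [Eb Ek]]].
  apply (rtends_ext (at_right 0) (fun t => arg (level_point be a b 0 (phase t) - RtoC kappa)%C)).
  { generalize (at_right_lt 0 1 Rlt_0_1). apply filter_imp. intros t Ht.
    now destruct (trace_curve_phase t Ht) as [_ [_ [-> _]]]. }
  apply (filterlim_comp _ _ _ phase (fun p => arg (level_point be a b 0 p - RtoC kappa)%C) _ _ _ phase_at_0).
  rewrite <- acos_0. unfold arg.
  apply (rtends_comp _ acos); [apply acos_continuity; lra|].
  apply rtends_eps; [exact _|]. intros eps Heps.
  assert (P := PI_RGT_0).
  assert (Hd : 0 < Rmin (PI / 2) (eps * (1 - be))).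
  { apply Rmin_pos; [lra|]. apply Rmult_lt_0_compat; lra. }
  generalize (at_right_lt 0 _ Hd). apply filter_imp. intros p Hp.
  assert (N1 := Rmin_l (PI / 2) (eps * (1 - be))). assert (N2 := Rmin_r (PI / 2) (eps * (1 - be))).
  assert (D : phase_dom be 0 p) by (apply phase_dom_0; lra).
  destruct (phase_dom_sin _ _ _ D) as [S1 [S2 S3]]. rewrite Rminus_0_r in S1. rewrite Rplus_0_r in S2.
  assert (U := upper_minus_real _ kappa (level_point_upper be a b 0 p (proj2 Hab) D)).
  set (v := (level_point be a b 0 p - RtoC kappa)%C) in *.
  assert (Es : sin ((1 - be) * p) = sin p * cos (be * p) - cos p * sin (be * p)).
  { rewrite <- sin_minus. f_equal. ring. }
  assert (Er : Re v = a / sin ((1 - be) * p) * (cos p * sin (be * p) - be * sin p * cos (be * p))).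
  { unfold v, level_point, apex, expi, Re. simpl. rewrite Rminus_0_r.
    replace (p - be * p) with ((1 - be) * p) by ring. rewrite Ek, Eb.
    rewrite Es in *. field. lra. }
  assert (Ei : Im v = a / sin ((1 - be) * p) * ((1 - be) * (sin p * sin (be * p)))).
  { unfold v, level_point, apex, expi, Im. simpl. rewrite Rminus_0_r.
    replace (p - be * p) with ((1 - be) * p) by ring. rewrite Eb. field. lra. }
  assert (X : Rabs (Re v) <= p / (1 - be) * Im v).
  { assert (A : 0 < a / sin ((1 - be) * p)) by (apply Rdiv_lt_0_compat; lra).
    rewrite Er, Ei, Rabs_mult, (Rabs_right (a / _)) by lra.
    replace (p / (1 - be) * (a / sin ((1 - be) * p) * ((1 - be) * (sin p * sin (be * p)))))
      with (a / sin ((1 - be) * p) * (p * (sin p * sin (be * p)))) by (field; lra).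
    apply Rmult_le_compat_l; [lra|]. apply angle_defect. lra. }
  rewrite Rminus_0_r. unfold Rdiv. rewrite Rabs_mult, Rabs_inv.
  assert (Pc := upper_Cmod_pos _ U). rewrite (Rabs_right (Cmod v)) by lra.
  assert (Ic : Im v <= Cmod v) by (eapply Rle_trans; [apply Rle_abs | apply Im_le_Cmod]).
  assert (Y : p / (1 - be) < eps).
  { apply Rmult_lt_reg_r with (1 - be); [lra|]. replace (p / (1 - be) * (1 - be)) with p by (field; lra). lra. }
  assert (Y0 : 0 < p / (1 - be)) by (apply Rdiv_lt_0_compat; lra).
  apply Rmult_lt_reg_r with (Cmod v); [exact Pc|].
  rewrite Rmult_assoc, Rinv_l, Rmult_1_r by lra.
  apply Rle_lt_trans with (p / (1 - be) * Cmod v).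
  - eapply Rle_trans; [exact X|]. apply Rmult_le_compat_l; lra.
  - apply Rmult_lt_compat_r; assumption.
Qed.

End Trace.

(** * Solutions of the Loewner equation *)

Definition solution (lam : R -> R) (t : R) (u : R -> C) : Prop :=
  forall s, seg t s -> u s <> RtoC (lam s) /\
    derive_on (seg t) u s (2 / (u s - RtoC (lam s)))%C.

Lemma on_mono (D E : R -> Prop) (s : R) : (forall r, D r -> E r) -> filter_le (on D s) (on E s).
Proof.
  intros H P. unfold on, within. apply filter_imp. intros r HP Dr. auto.
Qed.

Lemma seg_mono (s t r : R) : s <= t -> seg s r -> seg t r.
Proof. unfold seg. lra. Qed.

Lemma solution_slope (lam : R -> R) (t s r : R) (u : R -> C) :
  solution lam t u -> s <= t -> seg s r ->
  slope (on (seg s) r) RtoC u (RtoC r) (u r) (2 / (u r - RtoC (lam r)))%C.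
Proof.
  intros H Hst Hr. destruct (H r (seg_mono s t r Hst Hr)) as [_ D].
  apply derive_on_slope in D. eapply slope_filter_le; [|exact D].
  apply on_mono. intros q. now apply seg_mono.
Qed.

Lemma solution_continuous (lam : R -> R) (t s : R) (u : R -> C) :
  solution lam t u -> seg t s -> tends (on (seg t) s) u (u s).
Proof. intros H Hs. eapply slope_on_tends, (solution_slope lam t t s); auto with real. Qed.

Lemma slope_Im (D : R -> Prop) (t : R) (y : R -> C) (y0 l : C) :
  slope (on D t) RtoC y (RtoC t) y0 l ->
  slope (on D t) RtoC (fun s => RtoC (Im (y s))) (RtoC t) (RtoC (Im y0)) (RtoC (Im l)).
Proof.
  intros H. assert (E : forall z, Im z = Re (- Ci * z)%C) by (intros z; unfold Re, Im; simpl; ring).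
  apply (slope_scal _ _ _ _ _ _ (- Ci)%C) in H.
  apply (slope_Re _ (fun r => r)) in H. rewrite <- !E in H.
  eapply slope_ext; [exact _| |exact H]. apply filter_forall. intros s. cbv beta. now rewrite E.
Qed.

Lemma Im_div_real (p : R) (w : C) : w <> 0%C -> Im (RtoC p / w)%C = - p * Im w / (Cmod w) ^ 2.
Proof.
  intros H. rewrite Cmod2_alt.
  assert (0 < Re w ^ 2 + Im w ^ 2).
  { rewrite <- Cmod2_alt. apply pow_lt. now apply Cmod_gt_0. }
  unfold Re, Im in *. simpl in *. field. lra.
Qed.

Lemma positive_lower_bound (t : R) (h : R -> R) : 0 <= t ->
  (forall s, seg t s -> tends (on (seg t) s) (fun r => RtoC (h r)) (RtoC (h s))) ->
  (forall s, seg t s -> 0 < h s) -> exists m, 0 < m /\ forall s, seg t s -> m <= h s.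
Proof.
  intros Ht H P.
  destruct (continuity_ab_min (fun s => h (clamp t s)) 0 t Ht) as [m [Hm Sm]].
  { intros s _. now apply clamp_continuity. }
  exists (h m). split; [now apply P|]. intros s Hs. specialize (Hm s Hs).
  now rewrite !clamp_id in Hm.
Qed.

(** Let [y] be the imaginary part and [d] a positive lower bound of [|u - lam|].  Since
    [y' = - 2 y / |u - lam|^2], the function [y^2 exp (4 s / d^2)] is nondecreasing, so
    [y] never vanishes. *)
Lemma solution_upper (lam : R -> R) (t : R) (u : R -> C) : 0 <= t ->
  (forall s, seg t s -> tends (on (seg t) s) (fun r => RtoC (lam r)) (RtoC (lam s))) ->
  solution lam t u -> upper (u 0) -> forall s, seg t s -> upper (u s).
Proof.
  intros Ht Hl H U0.
  destruct (positive_lower_bound t (fun s => Cmod (u s - RtoC (lam s))%C) Ht) as [d [Hd Bd]].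
  - intros s Hs.
    assert (X : tends (on (seg t) s) (fun r => u r + - RtoC (lam r))%C (u s + - RtoC (lam s))%C).
    { intros eps Heps.
      generalize (filter_and (F := on (seg t) s) _ _
        (solution_continuous lam t s u H Hs (eps / 2) ltac:(lra)) (Hl s Hs (eps / 2) ltac:(lra))).
      apply filter_imp. intros r [A B].
      replace (u r + - RtoC (lam r) - (u s + - RtoC (lam s)))%C with
        ((u r - u s) - (RtoC (lam r) - RtoC (lam s)))%C by ring.
      eapply Rle_lt_trans; [apply Cmod_triangle_minus|]. lra. }
    intros eps Heps. generalize (proj1 (rtends_eps _ _ _) (rtends_Cmod _ _ _ X) eps Heps).
    apply filter_imp. intros r Hr. now rewrite <- RtoC_minus, Cmod_R.
  - intros s Hs. apply Cmod_gt_0. intros E. apply (proj1 (H s Hs)).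
    replace (u s) with ((u s - RtoC (lam s)) + RtoC (lam s))%C by ring. rewrite E. ring.
  - set (c := 4 / (d * d)).
    assert (Hc : 0 < c) by (apply Rdiv_lt_0_compat; [lra | now apply Rmult_lt_0_compat]).
    assert (NZ : forall s, seg t s -> Im (u s) <> 0).
    { intros s Hs E.
      (* The mean value inequality gives upper bounds, hence the factor -1. *)
      set (Y := fun r => (RtoC (Im (u r)) * RtoC (Im (u r)) * RtoC (exp (c * r)))%C).
      assert (M := mean_value_Re s 0 (fun r => RtoC (-1) * Y r)%C
        (fun r => RtoC (-1) *
          ((RtoC (Im (2 / (u r - RtoC (lam r)))%C) * RtoC (Im (u r))
            + RtoC (Im (u r)) * RtoC (Im (2 / (u r - RtoC (lam r)))%C)) * RtoC (exp (c * r))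
           + (RtoC (Im (u r)) * RtoC (Im (u r))) * RtoC (c * exp (c * r))))%C).
      cbv beta in M.
      assert (Z : Re (RtoC (-1) * Y s)%C - Re (RtoC (-1) * Y 0)%C <= 0 * s).
      { apply M; [apply Hs| |].
        - intros r Hr. apply slope_scal; [exact _|]. unfold Y.
          assert (SI : slope (on (seg s) r) RtoC (fun q => RtoC (Im (u q))) (RtoC r)
            (RtoC (Im (u r))) (RtoC (Im (2 / (u r - RtoC (lam r)))%C))).
          { apply slope_Im. apply (solution_slope lam t s r u H); [apply Hs | exact Hr]. }
          apply slope_mult; [exact _ | apply tends_RtoC_on | | ].
          + apply slope_mult; [exact _ | apply tends_RtoC_on | exact SI | exact SI].
          + apply (slope_real (seg s) (fun q => exp (c * q))). auto_derive; [easy|]. ring.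
        - intros r Hr.
          assert (Hr' : seg t r) by (apply (seg_mono s); [apply Hs | exact Hr]).
          assert (N : (u r - RtoC (lam r))%C <> 0%C).
          { apply Cmod_gt_0. specialize (Bd r Hr'). lra. }
          rewrite Im_div_real by exact N.
          assert (I : Im (u r - RtoC (lam r))%C = Im (u r)) by (unfold Im; simpl; ring).
          rewrite I. set (y := Im (u r)). set (D := Cmod (u r - RtoC (lam r))%C) in *.
          assert (HD : d * d <= D ^ 2).
          { specialize (Bd r Hr'). fold D in Bd. simpl. rewrite Rmult_1_r. apply Rmult_le_compat; lra. }
          assert (Hd2 : 0 < d * d) by now apply Rmult_lt_0_compat.
          rewrite <- !RtoC_mult, <- RtoC_plus, <- RtoC_mult, <- RtoC_plus, <- RtoC_mult, re_RtoC.
          replace (-1 * _) with (- (exp (c * r) * (y ^ 2 * (c - 4 / D ^ 2)))).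
          2:{ field. intros E'. rewrite E' in HD. lra. }
          assert (0 <= exp (c * r) * (y ^ 2 * (c - 4 / D ^ 2))); [|lra].
          apply Rmult_le_pos; [left; apply exp_pos|]. apply Rmult_le_pos; [apply pow2_ge_0|].
          assert (4 / D ^ 2 <= c); [|lra].
          unfold c, Rdiv. apply Rmult_le_compat_l; [lra|]. now apply Rinv_le_contravar. }
      unfold Y in Z. rewrite E, Rmult_0_r, exp_0 in Z. rewrite <- !RtoC_mult, !re_RtoC in Z.
      unfold upper in U0. nra. }
    intros s Hs. unfold upper. apply Rnot_le_lt. intros L.
    assert (L' : Im (u s) < 0) by (destruct L as [L|L]; [exact L | now apply NZ in L]).
    assert (S0 : 0 < s).
    { destruct Hs as [[A|A] _]; [exact A|]. rewrite <- A in L'. unfold upper in U0. lra. }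
    destruct (IVT_interv (fun r => - Im (u (clamp t r))) 0 s) as [r [Hr Er]].
    + intros r _. apply continuity_pt_opp.
      apply (clamp_continuity t (fun q => Im (u q))); [assumption|]. intros q Hq.
      eapply slope_on_tends, slope_Im, (solution_slope lam t t q); auto with real.
    + exact S0.
    + rewrite clamp_id by (unfold seg; lra). unfold upper in U0. lra.
    + rewrite clamp_id by exact Hs. lra.
    + assert (seg t r) by (unfold seg in *; lra). rewrite clamp_id in Er by assumption.
      apply (NZ r); [assumption | lra].
Qed.

Lemma real_continuous_on (D : R -> Prop) (f : R -> R) (s : R) :
  continuity_pt f s -> tends (on D s) (fun r => RtoC (f r)) (RtoC (f s)).
Proof.
  intros H eps Heps.
  generalize (proj1 (rtends_eps (on D s) _ _) (rtends_comp (on D s) f _ _ H (rtends_within D s)) eps Heps).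
  apply filter_imp. intros r Hr. now rewrite <- RtoC_minus, Cmod_R.
Qed.

Lemma sqrt_derive (t : R) : t < 1 ->
  is_derive (fun s => sqrt (1 - s)) t (- / (2 * sqrt (1 - t))).
Proof.
  intros H. assert (0 < sqrt (1 - t)) by (apply sqrt_lt_R0; lra).
  auto_derive; [lra|]. unfold Rminus in *. field. lra.
Qed.

Section Hulls.

Context {kappa be a b : R} (Adm : admissible kappa be a b).

(** For [p = a] and for [p = b] one has [p kappa = p^2 + 4], so that the numerator of
    the logarithmic derivative of [u - p sigma] contains the factor [u - p sigma].  As
    [be a = b], the combination [be clog (u - a sigma) - clog (u - b sigma)] is then
    constant. *)
Lemma clog_solution_slope (p t s : R) (u : R -> C) :
  p * kappa = p * p + 4 -> t < 1 ->
  solution (fun r => kappa * sqrt (1 - r)) t u -> upper (u s) -> seg t s ->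
  slope (on (seg t) s) RtoC (fun r => clog (u r - RtoC (p * sqrt (1 - r)))%C) (RtoC s)
    (clog (u s - RtoC (p * sqrt (1 - s)))%C)
    (RtoC p / (2 * RtoC (sqrt (1 - s)) * (u s - RtoC (kappa * sqrt (1 - s)))))%C.
Proof.
  intros Hp Ht H U Hs. set (sg := sqrt (1 - s)).
  assert (P : 0 < sg) by (apply sqrt_lt_R0; unfold seg in Hs; lra).
  assert (N1 := upper_neq_0 _ (upper_minus_real _ (p * sg) U)).
  assert (N2 := upper_neq_0 _ (upper_minus_real _ (kappa * sg) U)).
  assert (N3 : RtoC sg <> 0%C) by (intros Q; apply RtoC_inj in Q; lra).
  replace (RtoC p / _)%C with (/ (u s - RtoC (p * sg)) *
    (2 / (u s - RtoC (kappa * sg)) + RtoC (-1) * (RtoC p * RtoC (- / (2 * sg)))))%C.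
  - apply slope_comp with (f := clog) (y := fun r => (u r - RtoC (p * sqrt (1 - r)))%C);
      [exact _ | apply tends_RtoC_on | | apply cderiv_clog; now apply upper_minus_real].
    apply slope_ext with (y := fun r => (u r + RtoC (-1) * (RtoC p * RtoC (sqrt (1 - r))))%C);
      [exact _| |].
    + apply filter_forall. intros r. rewrite RtoC_mult. ring.
    + replace (u s - RtoC (p * sg))%C with (u s + RtoC (-1) * (RtoC p * RtoC sg))%C
        by (rewrite RtoC_mult; ring).
      apply slope_plus; [exact _| |].
      * apply (solution_slope (fun r => kappa * sqrt (1 - r)) t t); auto with real.
      * apply slope_scal; [exact _|]. apply slope_scal; [exact _|].
        apply (slope_real (seg t) (fun r => sqrt (1 - r))). apply sqrt_derive. unfold seg in Hs. lra.
  - rewrite RtoC_opp, RtoC_inv, RtoC_mult by lra.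
    rewrite !RtoC_mult in *.
    transitivity ((4 * RtoC sg + RtoC p * (u s - RtoC kappa * RtoC sg)) /
      ((u s - RtoC p * RtoC sg) * (2 * RtoC sg * (u s - RtoC kappa * RtoC sg))))%C.
    + field. now repeat split.
    + replace (4 * RtoC sg + RtoC p * (u s - RtoC kappa * RtoC sg))%C with
        (RtoC p * (u s - RtoC p * RtoC sg))%C.
      * field. now repeat split.
      * assert (Q : (RtoC p * RtoC kappa)%C = (RtoC p * RtoC p + 4)%C).
        { rewrite <- !RtoC_mult, Hp. apply RtoC_plus. }
        transitivity (RtoC p * u s + 4 * RtoC sg - (RtoC p * RtoC kappa) * RtoC sg)%C; [rewrite Q|]; ring.
Qed.

Lemma clog_sigma (p t : R) (w : C) : t < 1 -> upper w ->
  clog (RtoC (sqrt (1 - t)) * w - RtoC (p * sqrt (1 - t)))%C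
  = (RtoC (ln (1 - t) / 2) + clog (w - RtoC p))%C.
Proof.
  intros Ht Hw. assert (P : 0 < sqrt (1 - t)) by (apply sqrt_lt_R0; lra).
  replace (RtoC (sqrt (1 - t)) * w - RtoC (p * sqrt (1 - t)))%C with
    (RtoC (sqrt (1 - t)) * (w - RtoC p))%C by (rewrite RtoC_mult; ring).
  rewrite clog_scale by (try assumption; now apply upper_minus_real).
  do 2 f_equal. rewrite <- (sqrt_sqrt (1 - t)) at 2 by lra. rewrite ln_mult by assumption. field.
Qed.

(** The first integral at time [s], rewritten for the rescaled point [w = u s / sigma],
    is [logk w - shift s]. *)
Lemma solution_first_integral (t : R) (u : R -> C) : 0 <= t < 1 ->
  solution (fun r => kappa * sqrt (1 - r)) t u -> upper (u 0) ->
  forall s, seg t s -> exists w, upper w /\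
    logk be a b w = (logk be a b (u 0) + RtoC (shift (be := be) s))%C.
Proof.
  intros Ht H U0.
  destruct Adm as [_ [_ [_ [Hb [Hab [Eb [Eab Ek]]]]]]].
  assert (U : forall s, seg t s -> upper (u s)).
  { apply (solution_upper (fun r => kappa * sqrt (1 - r))); [lra| |assumption..].
    intros s Hs. apply (real_continuous_on _ (fun r => kappa * sqrt (1 - r))), ex_derive_continuity_pt.
    unfold seg in Hs. auto_derive. lra. }
  intros s Hs. assert (Hs' : 0 <= s <= t) by exact Hs.
  assert (P : 0 < sqrt (1 - s)) by (apply sqrt_lt_R0; lra).
  assert (PC : RtoC (sqrt (1 - s)) <> 0%C) by (intros Q; apply RtoC_inj in Q; lra).
  set (w := (RtoC (/ sqrt (1 - s)) * u s)%C).
  assert (Hw : upper w) by (apply upper_scale; [now apply Rinv_0_lt_compat | now apply U]).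
  exists w. split; [exact Hw|].
  set (q := fun r => (RtoC be * clog (u r - RtoC (a * sqrt (1 - r)))
    + RtoC (-1) * clog (u r - RtoC (b * sqrt (1 - r))))%C).
  assert (Q : Cmod (q s - q 0)%C <= 0 * s).
  { apply mean_value_Cmod with (l := fun r =>
      (RtoC be * (RtoC a / (2 * RtoC (sqrt (1 - r)) * (u r - RtoC (kappa * sqrt (1 - r)))))
      + RtoC (-1) * (RtoC b / (2 * RtoC (sqrt (1 - r)) * (u r - RtoC (kappa * sqrt (1 - r))))))%C);
      [lra| |].
    - intros r Hr.
      assert (Hr' : seg t r) by (apply (seg_mono s); [lra | exact Hr]).
      apply slope_filter_le with (G := on (seg t) r); [apply on_mono; intros x; now apply seg_mono|].
      unfold q. apply slope_plus; [exact _| |]; (apply slope_scal; [exact _|]);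
        apply clog_solution_slope; try assumption; try lra; try (now apply U); nra.
    - intros r Hr. right. rewrite <- Cmod_0. f_equal.
      rewrite Eb, (RtoC_mult be a). unfold Cdiv. ring. }
  rewrite Rmult_0_l in Q.
  assert (E : q s = q 0).
  { assert (Z : (q s - q 0)%C = 0%C) by (apply Cmod_eq_0; generalize (Cmod_ge_0 (q s - q 0)%C); lra).
    replace (q s) with ((q s - q 0) + q 0)%C by ring. rewrite Z. ring. }
  assert (Es : u s = (RtoC (sqrt (1 - s)) * w)%C).
  { unfold w. rewrite RtoC_inv by lra. field. exact PC. }
  unfold q in E. rewrite Es, !clog_sigma in E by (assumption || lra).
  rewrite Rminus_0_r, sqrt_1, !Rmult_1_r in E.
  unfold logk, shift.
  transitivity ((RtoC be * (RtoC (ln (1 - s) / 2) + clog (w - RtoC a)) +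
     RtoC (-1) * (RtoC (ln (1 - s) / 2) + clog (w - RtoC b)))
     + RtoC ((1 - be) / 2 * ln (1 - s)))%C.
  - apply injective_projections; simpl; field.
  - rewrite E. ring.
Qed.

(** Off the arc [gmap] is a solution.  On the arc, a solution started at [gamma s] would
    give at time [s] a point of the upper half-plane where [logk] takes its value at
    the tip of the slit. *)
Lemma trace_generates_hulls (gamma : R -> C) (t : R) (z : C) :
  traces (be := be) (a := a) (b := b) gamma -> 0 <= t < 1 ->
  (loewner_hull (fun r => kappa * sqrt (1 - r)) t z <-> arc gamma t z).
Proof.
  intros HG Ht. split.
  - intros [Hz N]. apply NNPP. intros A. apply N.
    destruct (gmap_flow Adm gamma HG) as [G0 G].
    exists (fun s => gmap kappa s z). split; [now apply G0|].
    intros s Hs. destruct (G s z) as [G1 G2]; [lra| |].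
    + split; [exact Hz|]. intros [r [Hr Er]]. apply A. exists r. split; [lra | exact Er].
    + split; [exact G1|]. apply derive_on_slope in G2. apply derive_on_slope.
      eapply slope_filter_le; [|exact G2]. apply on_mono. intros r. lra.
  - intros [s [Hs <-]]. destruct (HG s ltac:(lra)) as [U K].
    split; [exact U|]. intros [u [U0 Hu]].
    rewrite <- U0 in U, K.
    destruct (solution_first_integral t u Ht Hu U s) as [w [Hw E]]; [unfold seg; lra|].
    rewrite K in E.
    destruct (logk_strip be a b w (be_range Adm) (b_lt_a Adm) Hw) as [_ S].
    rewrite E in S. simpl in S. specialize (S ltac:(ring)). lra.
Qed.

End Hulls.

(** * Expansion at infinity *)

(** Continuous induction: the supremum of the times up to which the bound holds can be
    increased, since the bound holds there with room to spare. *)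
Lemma bootstrap (f : R -> R) (t : R) : 0 <= t -> (forall s, continuity_pt f s) -> f 0 <= 1 ->
  (forall s, seg t s -> (forall r, seg s r -> f r <= 1) -> f s <= 1 / 2) ->
  forall s, seg t s -> f s <= 1.
Proof.
  intros Ht C F0 H.
  assert (Cd : forall x eps, 0 < eps -> exists d, 0 < d /\ forall y, Rabs (y - x) < d -> Rabs (f y - f x) < eps).
  { intros x eps Heps.
    destruct (proj1 (continuity_pt_locally f x) (C x) (mkposreal eps Heps)) as [d Hd].
    exists d. split; [apply cond_pos|]. intros y Hy. now apply Hd. }
  destruct (completeness (fun s => seg t s /\ forall r, seg s r -> f r <= 1)) as [S [S1 S2]].
  - exists t. intros s [Hs _]. apply Hs.
  - exists 0. split; [unfold seg; lra|]. intros r Hr. replace r with 0 by (unfold seg in Hr; lra). exact F0.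
  - assert (S0 : 0 <= S).
    { apply S1. split; [unfold seg; lra|]. intros r Hr. replace r with 0 by (unfold seg in Hr; lra). exact F0. }
    assert (St : S <= t) by (apply S2; intros s [Hs _]; apply Hs).
    assert (B : forall r, 0 <= r < S -> f r <= 1).
    { intros r Hr. apply Rnot_lt_le. intros L.
      assert (S <= r); [|lra]. apply S2. intros s [Hs Fs]. apply Rnot_lt_le. intros L'.
      assert (f r <= 1) by (apply Fs; unfold seg in *; lra). lra. }
    assert (BS : f S <= 1).
    { destruct S0 as [S0|S0]; [|now rewrite <- S0]. apply Rnot_lt_le. intros L.
      destruct (Cd S (f S - 1) ltac:(lra)) as [d [Hd Fd]].
      assert (M1 := Rmin_l d S). assert (M2 := Rmin_r d S).
      assert (M3 : 0 < Rmin d S) by (apply Rmin_pos; assumption).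
      assert (X : Rabs (f (S - Rmin d S / 2) - f S) < f S - 1).
      { apply Fd. replace (S - Rmin d S / 2 - S) with (- (Rmin d S / 2)) by ring.
        rewrite Rabs_Ropp, Rabs_right; lra. }
      apply Rabs_def2 in X. specialize (B (S - Rmin d S / 2) ltac:(lra)). lra. }
    assert (BS' : forall r, seg S r -> f r <= 1).
    { intros r [Hr [L| ->]]; [apply B; lra | exact BS]. }
    assert (half : f S <= 1 / 2) by (apply H; [unfold seg; lra | exact BS']).
    destruct (Cd S (1 / 2) ltac:(lra)) as [d [Hd Fd]].
    assert (E : S = t).
    { apply Rle_antisym; [exact St|]. apply Rnot_lt_le. intros L.
      assert (M1 := Rmin_l (d / 2) (t - S)). assert (M2 := Rmin_r (d / 2) (t - S)).
      assert (M3 : 0 < Rmin (d / 2) (t - S)) by (apply Rmin_pos; lra).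
      assert (S + Rmin (d / 2) (t - S) <= S); [|lra].
      apply S1. split; [unfold seg; lra|]. intros r Hr.
      destruct (Rle_or_lt r S) as [A|A]; [apply BS'; unfold seg in *; lra|].
      assert (X : Rabs (f r - f S) < 1 / 2).
      { apply Fd. rewrite Rabs_right; unfold seg in Hr; lra. }
      apply Rabs_def2 in X. lra. }
    intros s Hs. apply BS'. now rewrite E.
Qed.

(** While [u] is within 1 of [z] its speed is at most [2 / 5], so up to time 1 it cannot
    even travel the distance [1 / 2]. *)
Lemma solution_near_start (lam : R -> R) (K t : R) (z : C) (u : R -> C) :
  0 <= t <= 1 -> (forall s, seg t s -> Rabs (lam s) <= K) -> solution lam t u -> u 0 = z ->
  2 * K + 10 <= Cmod z -> forall s, seg t s -> Cmod (u s - z)%C <= 1.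
Proof.
  intros Ht HK H U0 Hz s Hs.
  assert (C : forall s, continuity_pt (fun r => Cmod (u (clamp t r) - z)%C) s).
  { intros x. apply (clamp_continuity t (fun q => Cmod (u q - z)%C)); [lra|].
    intros r Hr eps Heps. generalize (solution_continuous lam t r u H Hr eps Heps).
    apply filter_imp. intros q Hq. rewrite <- RtoC_minus, Cmod_R.
    eapply Rle_lt_trans; [|exact Hq].
    replace (u q - u r)%C with ((u q - z) - (u r - z))%C by ring.
    apply Rabs_le. assert (A := Cmod_triangle_rev (u q - z) (u r - z)).
    assert (B := Cmod_triangle_rev (u r - z) (u q - z)). rewrite (Cmod_minus_sym (u r - z)) in B. lra. }
  assert (X := bootstrap (fun r => Cmod (u (clamp t r) - z)%C) t ltac:(lra) C).
  cbv beta in X. rewrite <- (clamp_id t s Hs). apply X; [| |exact Hs].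
  - rewrite clamp_id by (unfold seg; lra). rewrite U0, Cmod_minus_self. lra.
  - intros r Hr B. rewrite clamp_id by assumption. rewrite <- U0 at 1.
    assert (Hr' := Hr). unfold seg in Hr'.
    apply Rle_trans with (2 / 5 * r); [|lra].
    apply mean_value_Cmod with (l := fun q => (2 / (u q - RtoC (lam q)))%C); [lra| |].
    + intros q Hq. apply (solution_slope lam t); [assumption|lra|assumption].
    + intros q Hq. assert (Hq' : seg t q) by (unfold seg in *; lra).
      specialize (B q Hq). rewrite clamp_id in B by exact Hq'.
      assert (D : 5 <= Cmod (u q - RtoC (lam q))%C).
      { assert (A := Cmod_triangle_rev z ((z - u q) + RtoC (lam q))%C).
        replace (z - (z - u q + RtoC (lam q)))%C with (u q - RtoC (lam q))%C in A by ring.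
        assert (A' := Cmod_triangle (z - u q) (RtoC (lam q))).
        rewrite (Cmod_minus_sym z), Cmod_R in A'. specialize (HK q Hq').
        assert (0 <= Rabs (lam q)) by apply Rabs_pos. lra. }
      rewrite Cmod_div by (apply Cmod_gt_0; lra). rewrite Cmod_R, Rabs_right by lra.
      unfold Rdiv. apply Rmult_le_compat_l; [lra|]. apply Rinv_le_contravar; lra.
Qed.

(** The velocity differs from [2 / z] by [2 (z - u + lam) / (z (u - lam))], where
    [|u - lam| >= |z| / 2] and [|z - u| <= 1]. *)
Lemma solution_expansion (lam : R -> R) (K t : R) (z : C) (u : R -> C) :
  0 <= t <= 1 -> (forall s, seg t s -> Rabs (lam s) <= K) -> solution lam t u -> u 0 = z ->
  2 * K + 10 <= Cmod z ->
  Cmod (u t - (z + RtoC (2 * t) / z))%C <= 4 * (1 + K) / Cmod z ^ 2.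
Proof.
  intros Ht HK H U0 Hz.
  assert (K0 : 0 <= K).
  { eapply Rle_trans; [apply Rabs_pos | apply (HK 0); unfold seg; lra]. }
  assert (Nz : z <> 0%C) by (apply Cmod_gt_0; lra).
  assert (Near := solution_near_start lam K t z u Ht HK H U0 Hz).
  assert (P2 : 0 < Cmod z ^ 2) by (apply pow_lt; lra).
  assert (M : Cmod ((u t + (- 2 / z) * RtoC t) - (u 0 + (- 2 / z) * RtoC 0))%C
    <= 4 * (1 + K) / Cmod z ^ 2 * t).
  { apply mean_value_Cmod with (h := fun s => (u s + (- 2 / z) * RtoC s)%C)
      (l := fun s => (2 / (u s - RtoC (lam s)) + (- 2 / z) * 1)%C); [lra| |].
    - intros s Hs. apply slope_plus; [exact _| |].
      + apply (solution_slope lam t); [assumption|lra|assumption].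
      + apply slope_scal; [exact _|]. apply slope_id. exact _.
    - intros s Hs.
      assert (D : Cmod z / 2 <= Cmod (u s - RtoC (lam s))%C /\
        Cmod (z - u s + RtoC (lam s))%C <= 1 + K).
      { assert (A := Cmod_triangle_rev z ((z - u s) + RtoC (lam s))%C).
        replace (z - (z - u s + RtoC (lam s)))%C with (u s - RtoC (lam s))%C in A by ring.
        assert (A' := Cmod_triangle (z - u s) (RtoC (lam s))).
        rewrite (Cmod_minus_sym z), Cmod_R in A'. specialize (HK s Hs). specialize (Near s Hs). lra. }
      destruct D as [D1 D2].
      assert (N : (u s - RtoC (lam s))%C <> 0%C) by (apply Cmod_gt_0; lra).
      replace (2 / (u s - RtoC (lam s)) + - 2 / z * 1)%C with
        ((2 * (z - u s + RtoC (lam s))) / ((u s - RtoC (lam s)) * z))%C by (field; now split).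
      rewrite Cmod_div by now apply Cmult_neq_0. rewrite !Cmod_mult, Cmod_R, Rabs_right by lra.
      replace (4 * (1 + K) / Cmod z ^ 2) with (2 * (1 + K) * / (Cmod z / 2 * Cmod z)) by (field; lra).
      unfold Rdiv at 1. apply Rmult_le_compat.
      + apply Rmult_le_pos; [lra | apply Cmod_ge_0].
      + left. apply Rinv_0_lt_compat, Rmult_lt_0_compat; lra.
      + lra.
      + apply Rinv_le_contravar; [apply Rmult_lt_0_compat; lra|]. apply Rmult_le_compat_r; lra. }
  rewrite U0 in M.
  replace (u t - (z + RtoC (2 * t) / z))%C with
    (u t + - 2 / z * RtoC t - (z + - 2 / z * RtoC 0))%C by (rewrite RtoC_mult; field; exact Nz).
  eapply Rle_trans; [exact M|].
  rewrite <- (Rmult_1_r (4 * (1 + K) / Cmod z ^ 2)) at 2.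
  apply Rmult_le_compat_l; [|lra]. apply Rlt_le, Rdiv_lt_0_compat; lra.
Qed.

(** Beyond the largest modulus on the trace every starting point survives, so that the
    expansion of solutions applies to [gmap]. *)
Lemma trace_mapping_out {kappa be a b : R} (Adm : admissible kappa be a b) (gamma : R -> C) :
  traces (be := be) (a := a) (b := b) gamma -> continuous_on (fun t => 0 <= t <= 1) gamma ->
  mapping_out 1 gamma (gmap kappa).
Proof.
  intros HG Hc t Ht. split; [now apply (gmap_conformal Adm)|].
  assert (Hk : 0 < kappa) by (destruct Adm as [_ [_ [_ H]]]; lra).
  destruct (continuity_ab_maj (fun s => Cmod (gamma (clamp 1 s))) 0 1 Rle_0_1) as [m [Hm _]].
  { intros s _. apply (clamp_continuity 1 (fun q => Cmod (gamma q))); [lra|].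
    intros r Hr. assert (X := Hc r Hr).
    apply (filterlim_tends (on (seg 1) r)) in X.
    intros eps Heps. generalize (proj1 (rtends_eps _ _ _) (rtends_Cmod _ _ _ X) eps Heps).
    apply filter_imp. intros q Hq. now rewrite <- RtoC_minus, Cmod_R. }
  set (B := Cmod (gamma (clamp 1 m))) in *.
  assert (B0 : 0 <= B) by apply Cmod_ge_0.
  exists (4 * (1 + kappa)), (2 * kappa + 10 + B). split; [lra|].
  intros z Hz Hl.
  assert (A : forall s, 0 <= s <= t -> setminus upper (arc gamma s) z).
  { intros s Hs. split; [exact Hz|]. intros [r [Hr <-]].
    specialize (Hm r ltac:(lra)). rewrite clamp_id in Hm by (unfold seg; lra). lra. }
  destruct (gmap_flow Adm gamma HG) as [G0 G].
  apply (solution_expansion (fun s => kappa * sqrt (1 - s)) kappa t z (fun s => gmap kappa s z)).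
  - lra.
  - intros s Hs. unfold seg in Hs. rewrite Rabs_mult, (Rabs_right kappa) by lra.
    assert (S1 := sqrt_pos (1 - s)). rewrite Rabs_right by lra.
    assert (sqrt (1 - s) <= 1) by (rewrite <- sqrt_1 at 2; apply sqrt_le_1; lra).
    rewrite <- (Rmult_1_r kappa) at 2. apply Rmult_le_compat_l; lra.
  - intros s Hs. destruct (G s z) as [G1 G2]; [unfold seg in Hs; lra | apply A, Hs |].
    split; [exact G1|]. apply derive_on_slope in G2. apply derive_on_slope.
    eapply slope_filter_le; [|exact G2]. apply on_mono. unfold seg. intros r. lra.
  - now apply G0.
  - lra.
Qed.

(** * The case [4 < kappa] *)

Lemma trace_of_ray {kappa be a b : R} (Adm : admissible kappa be a b) (gamma : R -> C) (z : C) :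
  traces (be := be) (a := a) (b := b) gamma ->
  ((exists t, 0 < t < 1 /\ gamma t = z) <->
   (upper z /\ setminus (ray (PI * (1 - be))) (slit (PI * (1 - be)) (exp (tip_height be a b)))
     (kmap kappa z))).
Proof.
  intros HG. assert (B := be_range Adm). assert (Hab := b_lt_a Adm).
  split.
  - intros [t [Ht <-]]. destruct (HG t Ht) as [U K]. split; [exact U|].
    assert (S := logk_in_strip Adm _ U).
    unfold setminus. rewrite (kmap_strip_map Adm), strip_map_ray, strip_map_slit by assumption.
    assert (N := logk_strip be a b _ B Hab U). destruct N as [_ N].
    rewrite K in *. simpl in *. split; [reflexivity|]. intros [_ L]. specialize (N eq_refl). lra.
  - intros [U [R1 R2]]. assert (S := logk_in_strip Adm _ U).
    rewrite (kmap_strip_map Adm) in R1, R2 by exact U.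
    apply strip_map_ray in R1; try assumption.
    destruct (logk_strip be a b z B Hab U) as [_ N]. specialize (N R1).
    destruct (shift_onto Adm (tip_height be a b - Re (logk be a b z))) as [s [Hs Es]]; [lra|].
    exists s. split; [exact Hs|]. destruct (HG s Hs) as [U' K].
    apply (logk_inj be a b); try assumption. rewrite K, Es.
    apply injective_projections; [|now symmetry]. simpl. unfold Re. ring.
Qed.

Lemma kappa_gt_4_case (kappa : R) : 4 < kappa ->
    let th := theta kappa in
    let k := kmap kappa in
    let g := gmap kappa in
    let lam := fun t => kappa * sqrt (1 - t) in
    0 < th < 1 /\
    exists (L : R) (gamma : R -> C),
      let S := slit (PI * th) L in
      0 < L /\
      conformal_onto upper (setminus upper S) k /\
      loewner_trace lam 1 gamma /\
      (forall t z, 0 <= t < 1 -> upper z ->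
         (setminus upper (arc gamma t) z <->
          setminus upper S (RtoC (Rpower (1 - t) (th / 2)) * k z)%C)) /\
      mapping_out 1 gamma g /\
      loewner_flow lam 1 gamma g /\
      (forall z, (exists t, 0 < t < 1 /\ gamma t = z) <->
                 (upper z /\ setminus (ray (PI * th)) S (k z))) /\
      gamma 0 = RtoC kappa /\
      angle_right gamma (at_right 0) kappa (PI / 2) /\
      gamma 1 = RtoC (2 * sqrt (1 - th)) /\
      angle_right gamma (at_left 1) (2 * sqrt (1 - th)) (PI * (1 - th)).
Proof.
  intros Hk th k g lam.
  destruct (admissible_exists kappa Hk) as [be [a [b Adm]]].
  assert (B := be_range Adm).
  assert (Et : th = 1 - be) by apply (theta_be Adm).
  assert (Eb : 2 * sqrt (1 - th) = b) by apply Adm.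
  split; [lra|].
  set (gamma := trace_curve (kappa := kappa) (be := be) (a := a) (b := b)).
  assert (HG : traces (be := be) (a := a) (b := b) gamma) by apply (trace_curve_traces Adm).
  assert (HC := trace_curve_continuous Adm).
  exists (exp (tip_height be a b)), gamma. cbv zeta. rewrite Eb, Et.
  split; [apply exp_pos|]. split; [apply (kmap_conformal Adm)|].
  split; [|split; [|split; [|split; [|split; [|split; [|split; [|split]]]]]]].
  - split; [exact HC|]. split; [intros t Ht; now apply HG|].
    intros t Ht z. now apply (trace_generates_hulls Adm).
  - intros t z Ht Hz. rewrite (arc_domain Adm gamma t z HG Ht).
    assert (S := scaled_kmap_domain Adm t z Hz). rewrite (theta_be Adm) in S.
    unfold k. rewrite S. tauto.
  - now apply (trace_mapping_out Adm).
  - now apply (gmap_flow Adm).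
  - intros z. now apply (trace_of_ray Adm).
  - unfold gamma, trace_curve. destruct Rle_dec; [reflexivity | lra].
  - apply (trace_angle_at_0 Adm).
  - unfold gamma, trace_curve. destruct (Rle_dec 1 0); [lra|]. destruct Rle_dec; [reflexivity | lra].
  - replace (1 - (1 - be)) with be by ring. apply (trace_angle_at_1 Adm).
Qed.

(** * Reflection about the imaginary axis *)

Lemma reflect_involutive (z : C) : reflect (reflect z) = z.
Proof. unfold reflect. apply injective_projections; simpl; ring. Qed.

Lemma reflect_minus (z w : C) : reflect (z - w)%C = (reflect z - reflect w)%C.
Proof. unfold reflect. apply injective_projections; simpl; ring. Qed.

Lemma reflect_RtoC (x : R) : reflect (RtoC x) = RtoC (- x).
Proof. unfold reflect. apply injective_projections; simpl; ring. Qed.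

Lemma reflect_mult_real (x : R) (z : C) : reflect (RtoC x * z)%C = (RtoC x * reflect z)%C.
Proof. unfold reflect. apply injective_projections; simpl; ring. Qed.

Lemma reflect_mult (z w : C) : reflect (z * w)%C = (Cconj z * reflect w)%C.
Proof. unfold reflect. apply injective_projections; simpl; ring. Qed.

Lemma Cmod_reflect (z : C) : Cmod (reflect z) = Cmod z.
Proof. unfold reflect. now rewrite Cmod_opp, Cmod_conj. Qed.

Lemma upper_reflect (z : C) : upper (reflect z) <-> upper z.
Proof. unfold upper, reflect, Im. simpl. rewrite Ropp_involutive. tauto. Qed.

Lemma reflect_div_real (x : R) (z : C) : z <> 0%C -> reflect (RtoC x / z)%C = (RtoC x / reflect z)%C.
Proof.
  intros H. assert (H' : Cconj z <> 0%C).
  { intros E. apply H. apply Cmod_eq_0. now rewrite <- Cmod_conj, E, Cmod_0. }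
  unfold reflect. rewrite Cdiv_conj by exact H.
  replace (Cconj (RtoC x)) with (RtoC x) by (apply injective_projections; simpl; ring).
  field. exact H'.
Qed.

Lemma arg_reflect (z : C) : arg (reflect z) = PI - arg z.
Proof.
  unfold arg. rewrite Cmod_reflect, <- acos_opp. f_equal. unfold reflect. simpl.
  unfold Re, Rdiv. ring.
Qed.

Lemma tends_reflect {T : Type} (F : (T -> Prop) -> Prop) {FF : Filter F} (y : T -> C) (y0 : C) :
  tends F y y0 -> tends F (fun s => reflect (y s)) (reflect y0).
Proof.
  intros H eps Heps. generalize (H eps Heps). apply filter_imp. intros s.
  now rewrite <- reflect_minus, Cmod_reflect.
Qed.

(** Two conjugations cancel, leaving a complex linear derivative. *)
Lemma cderiv_reflect_map (f : C -> C) (z l : C) :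
  cderiv f (reflect z) l -> cderiv (reflect_map f) z (Cconj l).
Proof.
  intros H eps Heps.
  assert (R1 := tends_reflect (locally z) _ _ (tends_id z)).
  apply (filterlim_tends (locally z)) in R1.
  generalize (R1 _ (H eps Heps)). unfold filtermap. apply filter_imp. intros w Hw.
  rewrite <- reflect_minus, Cmod_reflect in Hw. unfold reflect_map.
  replace (reflect (f (reflect w)) - reflect (f (reflect z)) - Cconj l * (w - z))%C
    with (reflect (f (reflect w) - f (reflect z) - l * reflect (w - z)))%C.
  - now rewrite Cmod_reflect.
  - now rewrite (reflect_minus (_ - _)%C), (reflect_minus (f _)), reflect_mult, reflect_involutive.
Qed.

Lemma derive_on_reflect (D : R -> Prop) (f : R -> C) (t : R) (l : C) :
  derive_on D f t l -> derive_on D (fun s => reflect (f s)) t (reflect l).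
Proof.
  rewrite !derive_on_slope. intros H eps Heps. generalize (H eps Heps).
  apply filter_imp. intros s Hs. rewrite <- RtoC_minus in *.
  rewrite <- Cmod_reflect, !reflect_minus in Hs.
  rewrite (Cmult_comm l), reflect_mult_real in Hs. now rewrite (Cmult_comm (reflect l)).
Qed.

Lemma conformal_onto_reflect (U V : C -> Prop) (f : C -> C) :
  conformal_onto U V f ->
  conformal_onto (reflect_set U) (reflect_set V) (reflect_map f).
Proof.
  intros [H [I S]]. unfold reflect_set, reflect_map. split; [|split].
  - intros z Hz. destruct (ex_derive_cderiv f _ (H _ Hz)) as [l Hl].
    eapply cderiv_ex_derive, cderiv_reflect_map, Hl.
  - intros z w Hz Hw E. apply (f_equal reflect) in E. rewrite !reflect_involutive in E.
    apply I in E; try assumption. apply (f_equal reflect) in E. now rewrite !reflect_involutive in E.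
  - intros w. rewrite S. split.
    + intros [z [Hz E]]. exists (reflect z). now rewrite reflect_involutive, E, reflect_involutive.
    + intros [z [Hz E]]. exists (reflect z). split; [exact Hz|]. now rewrite <- E, reflect_involutive.
Qed.

Lemma conformal_onto_ext (U U' V V' : C -> Prop) (f : C -> C) :
  (forall z, U z <-> U' z) -> (forall z, V z <-> V' z) ->
  conformal_onto U V f -> conformal_onto U' V' f.
Proof.
  intros HU HV [H [I S]]. split; [|split].
  - intros z Hz. now apply H, HU.
  - intros z w Hz Hw. now apply I; apply HU.
  - intros w. rewrite <- HV, S. split; intros [z [Hz E]]; exists z; (split; [now apply HU | exact E]).
Qed.

Lemma setminus_reflect (K : C -> Prop) (z : C) :
  reflect_set (setminus upper K) z <-> setminus upper (reflect_set K) z.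
Proof. unfold reflect_set, setminus. now rewrite upper_reflect. Qed.

Lemma arc_reflect (gamma : R -> C) (t : R) (z : C) :
  arc (fun s => reflect (gamma s)) t z <-> arc gamma t (reflect z).
Proof.
  split; intros [s [Hs E]]; exists s; (split; [exact Hs|]).
  - now rewrite <- E, reflect_involutive.
  - now rewrite E, reflect_involutive.
Qed.

Lemma setminus_arc_reflect (gamma : R -> C) (t : R) (z : C) :
  setminus upper (arc (fun s => reflect (gamma s)) t) z <->
  setminus upper (arc gamma t) (reflect z).
Proof. unfold setminus. now rewrite arc_reflect, upper_reflect. Qed.

Lemma loewner_reflect (D : R -> Prop) (lam : R -> R) (s : R) (u : R -> C) :
  u s <> RtoC (lam s) -> derive_on D u s (2 / (u s - RtoC (lam s)))%C ->
  reflect (u s) <> RtoC (- lam s) /\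
  derive_on D (fun r => reflect (u r)) s (2 / (reflect (u s) - RtoC (- lam s)))%C.
Proof.
  intros N H. split.
  - rewrite <- reflect_RtoC. intros E. apply N.
    apply (f_equal reflect) in E. now rewrite !reflect_involutive in E.
  - rewrite <- reflect_RtoC, <- reflect_minus, <- reflect_div_real by now apply Cminus_eq_contra.
    now apply derive_on_reflect.
Qed.

Lemma loewner_hull_reflect (lam mu : R -> R) (t : R) (z : C) :
  (forall s, mu s = - lam s) ->
  loewner_hull mu t (reflect z) -> loewner_hull lam t z.
Proof.
  intros E [U N]. split; [now apply upper_reflect|]. intros [u [U0 H]]. apply N.
  exists (fun s => reflect (u s)). split; [now rewrite U0|]. intros s Hs.
  destruct (H s Hs) as [H1 H2]. rewrite E. now apply loewner_reflect.
Qed.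

Lemma loewner_trace_reflect (lam mu : R -> R) (T : R) (gamma : R -> C) :
  (forall s, mu s = - lam s) ->
  loewner_trace lam T gamma -> loewner_trace mu T (fun t => reflect (gamma t)).
Proof.
  intros E [H1 [H2 H3]]. split; [|split].
  - intros t Ht. assert (FF : Filter (within (fun t => 0 <= t <= T) (locally t)))
      by apply within_filter, locally_filter.
    apply filterlim_tends; [exact FF|]. apply tends_reflect; [exact FF|].
    apply filterlim_tends; [exact FF|]. now apply H1.
  - intros t Ht. now apply upper_reflect, H2.
  - intros t Ht z. rewrite arc_reflect, <- H3 by exact Ht. split.
    + intros H. apply loewner_hull_reflect with mu; [exact E|]. now rewrite reflect_involutive.
    + apply loewner_hull_reflect. intros s. rewrite E. ring.
Qed.

Lemma mapping_out_reflect (T : R) (gamma : R -> C) (g : R -> C -> C) :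
  mapping_out T gamma g ->
  mapping_out T (fun t => reflect (gamma t)) (fun t => reflect_map (g t)).
Proof.
  intros H t Ht. destruct (H t Ht) as [C1 [M [R0 [HR E]]]]. split.
  - apply conformal_onto_reflect in C1. revert C1. apply conformal_onto_ext.
    + intros z. rewrite setminus_arc_reflect. reflexivity.
    + apply upper_reflect.
  - exists M, R0. split; [exact HR|]. intros z Hz Hl.
    specialize (E (reflect z)). rewrite upper_reflect, Cmod_reflect in E. specialize (E Hz Hl).
    rewrite <- (Cmod_reflect (_ - _)%C) in E. unfold reflect_map.
    assert (N := upper_neq_0 z Hz).
    assert (Q : reflect (reflect z + RtoC (2 * t) / reflect z)%C = (z + RtoC (2 * t) / z)%C).
    { rewrite <- reflect_div_real by exact N.
      transitivity (reflect (reflect z) + reflect (reflect (RtoC (2 * t) / z)))%C.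
      - unfold reflect. apply injective_projections; simpl; ring.
      - now rewrite !reflect_involutive. }
    now rewrite reflect_minus, Q in E.
Qed.

Lemma loewner_flow_reflect (lam mu : R -> R) (T : R) (gamma : R -> C) (g : R -> C -> C) :
  (forall s, mu s = - lam s) -> loewner_flow lam T gamma g ->
  loewner_flow mu T (fun t => reflect (gamma t)) (fun t => reflect_map (g t)).
Proof.
  intros E [G0 G]. split.
  - intros z Hz. unfold reflect_map. rewrite G0 by now apply upper_reflect. apply reflect_involutive.
  - intros t z Ht H. apply setminus_arc_reflect in H. destruct (G t _ Ht H) as [G1 G2].
    unfold reflect_map. rewrite E.
    exact (loewner_reflect _ lam t (fun s => g s (reflect z)) G1 G2).
Qed.

Lemma angle_right_reflect (gamma : R -> C) (F : (R -> Prop) -> Prop) {FF : Filter F} (p alpha : R) :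
  angle_right gamma F p alpha ->
  angle_right (fun t => reflect (gamma t)) F (- p) (PI - alpha).
Proof.
  unfold angle_right. intros H.
  apply (rtends_ext F (fun t => PI - arg (gamma t - RtoC p)%C)).
  - apply filter_forall. intros t. now rewrite <- arg_reflect, reflect_minus, reflect_RtoC.
  - apply rtends_minus; [exact FF | now apply rtends_const | exact H].
Qed.

Theorem proposition3p2 (kappa : R) :
  (4 < kappa ->
    let th := theta kappa in
    let k := kmap kappa in
    let g := gmap kappa in
    let lam := fun t => kappa * sqrt (1 - t) in
    0 < th < 1 /\
    exists (L : R) (gamma : R -> C),
      let S := slit (PI * th) L in
      0 < L /\
      conformal_onto upper (setminus upper S) k /\
      loewner_trace lam 1 gamma /\
      (* the formula for g t makes sense exactly on H \ gamma((0, t]) *)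
      (forall t z, 0 <= t < 1 -> upper z ->
         (setminus upper (arc gamma t) z <->
          setminus upper S (RtoC (Rpower (1 - t) (th / 2)) * k z)%C)) /\
      mapping_out 1 gamma g /\
      loewner_flow lam 1 gamma g /\
      (forall z, (exists t, 0 < t < 1 /\ gamma t = z) <->
                 (upper z /\ setminus (ray (PI * th)) S (k z))) /\
      gamma 0 = RtoC kappa /\
      angle_right gamma (at_right 0) kappa (PI / 2) /\
      gamma 1 = RtoC (2 * sqrt (1 - th)) /\
      angle_right gamma (at_left 1) (2 * sqrt (1 - th)) (PI * (1 - th)))
  /\
  (kappa < -4 ->
    let th := theta (- kappa) in
    let k := reflect_map (kmap (- kappa)) in
    let g := fun t => reflect_map (gmap (- kappa) t) in
    let lam := fun t => kappa * sqrt (1 - t) in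
    0 < th < 1 /\
    exists (L : R) (gamma : R -> C),
      let S := reflect_set (slit (PI * th) L) in
      0 < L /\
      conformal_onto upper (setminus upper S) k /\
      loewner_trace lam 1 gamma /\
      (forall t z, 0 <= t < 1 -> upper z ->
         (setminus upper (arc gamma t) z <->
          setminus upper S (RtoC (Rpower (1 - t) (th / 2)) * k z)%C)) /\
      mapping_out 1 gamma g /\
      loewner_flow lam 1 gamma g /\
      (forall z, (exists t, 0 < t < 1 /\ gamma t = z) <->
                 (upper z /\
                  setminus (reflect_set (ray (PI * th))) S (k z))) /\
      gamma 0 = RtoC kappa /\
      angle_right gamma (at_right 0) kappa (PI / 2) /\
      gamma 1 = RtoC (- (2 * sqrt (1 - th))) /\
      (* angle PI * (1 - th) with the half-line (-oo, gamma 1] *)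
      angle_right gamma (at_left 1) (- (2 * sqrt (1 - th)))
        (PI - PI * (1 - th))).
Proof.
  split; [apply kappa_gt_4_case|].
  intros Hk th k g lam.
  destruct (kappa_gt_4_case (- kappa)) as [Hth [L [gamma H]]]; [lra|].
  fold th in Hth, H. split; [exact Hth|].
  destruct H as [HL [H1 [H2 [H3 [H4 [H5 [H6 [H7 [H8 [H9 H10]]]]]]]]]].
  assert (El : forall s, lam s = - (- kappa * sqrt (1 - s))) by (intros s; unfold lam; ring).
  exists L, (fun t => reflect (gamma t)). cbv zeta.
  split; [exact HL|]. split; [|split; [|split; [|split; [|split; [|split; [|split; [|split; [|split]]]]]]]].
  - apply conformal_onto_reflect in H1. revert H1. apply conformal_onto_ext.
    + apply upper_reflect.
    + apply setminus_reflect.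
  - eapply loewner_trace_reflect; [exact El | exact H2].
  - intros t z Ht Hz. rewrite setminus_arc_reflect, H3 by (try apply upper_reflect; assumption).
    unfold k, reflect_map. rewrite <- reflect_mult_real, <- setminus_reflect.
    unfold reflect_set at 1. now rewrite reflect_involutive.
  - now apply mapping_out_reflect.
  - eapply loewner_flow_reflect; [exact El | exact H5].
  - intros z. transitivity (exists t, 0 < t < 1 /\ gamma t = reflect z).
    + split; intros [t [Ht E]]; exists t; (split; [exact Ht|]).
      * now rewrite <- E, reflect_involutive.
      * now rewrite E, reflect_involutive.
    + rewrite H6, upper_reflect. unfold setminus, reflect_set, k, reflect_map.
      now rewrite reflect_involutive.
  - now rewrite H7, reflect_RtoC, Ropp_involutive.
  - apply angle_right_reflect in H8; [|exact _]. rewrite Ropp_involutive in H8.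
    now replace (PI - PI / 2) with (PI / 2) in H8 by field.
  - now rewrite H9, reflect_RtoC.
  - apply angle_right_reflect; [exact _ | exact H10].
Qed.
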